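(* Let $R$ be a commutative noetherian ring. If $C$ is a semidualizing $R$-module and $M$ is an $R$-module such that $\mathcal{F}_C\text{-}\operatorname{pd}_R(M)=0$ and $\mathcal{I}_C\text{-}\operatorname{id}_R(M)<\infty$, then $R_{\mathfrak{p}}$ is Gorenstein for all $\mathfrak{p}\in\operatorname{Spec}(R)$ such that $\operatorname{width}_{R_{\mathfrak{p}}}(M_{\mathfrak{p}})$ is finite.
   Context: Modules are not assumed finitely generated unless stated. A finitely generated $R$-module $C$ is semidualizing if the natural homothety map $R\to\operatorname{Hom}_R(C,C)$ is an isomorphism and $\operatorname{Ext}^{i}_R(C,C)=0$ for all $i\geq 1$. For a class $\mathcal{X}$ of $R$-modules, an $\mathcal{X}$-resolution of $M$ is a complex $X=\cdots\to X_1\to X_0\to 0$ of modules in $\mathcal{X}$ with $\operatorname{H}_0(X)\cong M$ and $\operatorname{H}_n(X)=0$ for $n\geq 1$; the $\mathcal{X}$-projective dimension $\mathcal{X}\text{-}\operatorname{pd}_R(M)$ is the infimum over all $\mathcal{X}$-resolutions $X$ of $M$ of $\sup\{n\geq 0\mid X_n\neq 0\}$. Dually, an $\mathcal{X}$-coresolution of $M$ is a complex $X=0\to X_0\to X_{-1}\to X_{-2}\to\cdots$ of modules in $\mathcal{X}$ with $\operatorname{H}_0(X)\cong M$ and $\operatorname{H}_n(X)=0$ for $n\leq -1$; the $\mathcal{X}$-injective dimension $\mathcal{X}\text{-}\operatorname{id}_R(M)$ is the infimum over all $\mathcal{X}$-coresolutions $X$ of $M$ of $\sup\{-n\geq 0\mid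 X_n\neq 0\}$. Conventions: each of these dimensions is $\infty$ if no such (co)resolution exists, and is $-\infty$ for $M=0$; the modules of $\mathcal{X}$-projective (respectively $\mathcal{X}$-injective) dimension $0$ are the nonzero modules of $\mathcal{X}$. $\mathcal{F}_C(R)$ is the class of modules isomorphic to $F\otimes_R C$ with $F$ a flat $R$-module, and $\mathcal{I}_C(R)$ is the class of modules isomorphic to $\operatorname{Hom}_R(C,I)$ with $I$ an injective $R$-module; $\mathcal{F}_C\text{-}\operatorname{pd}_R$ and $\mathcal{I}_C\text{-}\operatorname{id}_R$ are the associated dimensions. For a local ring $S$ with residue field $k$ and any $S$-module $N$, $\operatorname{width}_S(N)=\inf\{i\geq 0\mid\operatorname{Tor}_i^S(k,N)\neq 0\}$ (with $\inf\emptyset=\infty$). *)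

(* Defs.v *)
From HB Require Import structures.
From mathcomp Require Import all_boot all_order all_algebra.
From mathcomp Require Import all_classical constructive_ereal ring.
Import GRing.Theory.
Set Implicit Arguments.
Unset Strict Implicit.
Unset Printing Implicit Defensive.
Local Open Scope ring_scope.
Local Open Scope classical_set_scope.
Local Open Scope quotient_scope.

(* Commutative rings are comPzRingType, so that the zero ring is allowed. *)

Definition is_zero (R : comPzRingType) (M : lmodType R) := forall x : M, x = 0.

Definition isomorphic (R : comPzRingType) (M N : lmodType R) :=
  exists f : {linear M -> N}, bijective f.

Definition exact_at (R : comPzRingType) (L M N : lmodType R)
    (f : {linear L -> M}) (g : {linear M -> N}) :=
  range f = [set y | g y = 0].

Section Span.
Variables (R : comPzRingType) (V : lmodType R).

Definition span (A : set V) : {pred V} :=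
  [in smallest (fun B : set V => submod_closed [in B]) A].

Lemma span_submod (A : set V) : submod_closed (span A).
Proof.
split; first by rewrite inE => B [[B0 _] _]; move: B0; rewrite inE.
move=> a x y; rewrite !inE => Ax Ay B BP.
have [[_ BZ] _] := BP; have := BZ a x y; rewrite !inE.
by apply; [exact: Ax|exact: Ay].
Qed.

HB.instance Definition _ (A : set V) :=
  GRing.isSubmodClosed.Build R V (span A) (span_submod A).

Lemma sub_span (A : set V) x : A x -> x \in span A.
Proof. by move=> Ax; rewrite inE; exact: sub_gen_smallest. Qed.

Lemma span_min (A : set V) (B : set V) x :
  submod_closed [in B] -> A `<=` B -> x \in span A -> B x.
Proof. by move=> Bs AB; rewrite inE; apply: smallest_sub. Qed.

Definition quot_mod (A : set V) := Quotient.quot (span A).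

HB.instance Definition _ (A : set V) := GRing.Zmodule.on (quot_mod A).
HB.instance Definition _ (A : set V) :=
  EqQuotient.on (quot_mod A).

Section QuotScale.
Variable A : set V.
Notation Q := (quot_mod A).

Lemma quot_modE (x y : V) : (\pi_Q x == \pi_Q y) = (x - y \in span A).
Proof. by rewrite -[LHS]Quotient.idealrBE. Qed.

Lemma quot_modP (x y : V) : \pi_Q x = \pi_Q y <-> x - y \in span A.
Proof. by rewrite -quot_modE; split=> [->|/eqP]. Qed.

Definition quot_scale (a : R) (x : Q) : Q := \pi_Q (a *: repr x).

Lemma pi_scale a x : quot_scale a (\pi_Q x) = \pi_Q (a *: x).
Proof.
apply/quot_modP; rewrite -scalerBr rpredZ//.
by apply/quot_modP; rewrite reprK.
Qed.

Lemma pi_quotD (x y : V) : \pi_Q (x + y) = \pi_Q x + \pi_Q y.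
Proof. exact: (Quotient.pi_add (span A) x y). Qed.

Lemma quot_scalerA a b x : quot_scale a (quot_scale b x) = quot_scale (a * b) x.
Proof. by rewrite -[x]reprK (pi_scale b) !pi_scale scalerA. Qed.
Lemma quot_scale1r : left_id 1 quot_scale.
Proof. by move=> x; rewrite -[x]reprK pi_scale scale1r. Qed.
Lemma quot_scalerDr : right_distributive quot_scale +%R.
Proof.
move=> a x y; rewrite -[x]reprK -[y]reprK -pi_quotD !pi_scale.
by rewrite scalerDr pi_quotD.
Qed.
Lemma quot_scalerDl x : {morph quot_scale^~ x : a b / a + b}.
Proof. by move=> a b; rewrite -[x]reprK !pi_scale scalerDl pi_quotD. Qed.

HB.instance Definition _ := GRing.Zmodule_isLmodule.Build R Q
  quot_scalerA quot_scale1r quot_scalerDr quot_scalerDl.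

Definition quot_pi (x : V) : Q := \pi_Q x.

Lemma quot_pi_linear : linear quot_pi.
Proof. by move=> a x y; rewrite /quot_pi pi_quotD -pi_scale. Qed.

HB.instance Definition _ :=
  GRing.isLinear.Build R V Q *:%R quot_pi quot_pi_linear.

Section Lift.
Variables (W : lmodType R) (f : {linear V -> W}).

(* fA is an argument so that the instance below applies to the term. *)
Definition quot_lift (fA : forall x, A x -> f x = 0) (x : Q) : W := f (repr x).

Variable fA : forall x, A x -> f x = 0.

Lemma quot_liftE x : quot_lift fA (quot_pi x) = f x.
Proof.
apply/eqP; rewrite -subr_eq0 -raddfB/=; apply/eqP.
apply: (@span_min A [set z | f z = 0]) => //.
  split; first by rewrite inE /= raddf0.
  move=> a u v; rewrite !inE/= linearP => -> ->.
  by rewrite scaler0 addr0.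
by apply/quot_modP; rewrite reprK.
Qed.

Lemma quot_lift_linear : linear (quot_lift fA).
Proof.
move=> a x y; rewrite -[x]reprK -[y]reprK.
rewrite -![\pi_Q _]/(quot_pi _) -linearP !quot_liftE.
exact: linearP.
Qed.

HB.instance Definition _ :=
  GRing.isLinear.Build R Q W *:%R (quot_lift fA) quot_lift_linear.
End Lift.

End QuotScale.
End Span.

Arguments quot_lift {R V A W f} fA x.

Section Kernel.
Variables (R : comPzRingType) (U V : lmodType R) (f : {linear U -> V}).

Definition kernel_pred : {pred U} := [pred x | f x == 0].

Lemma kernel_submod : submod_closed kernel_pred.
Proof.
split; first by rewrite inE raddf0.
move=> a x y; rewrite !inE => /eqP fx /eqP fy.
by rewrite linearP fx fy scaler0 addr0.
Qed.

Record kernel := Kernel { kernel_val :> U; _ : kernel_val \in kernel_pred }.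

HB.instance Definition _ := [isSub for kernel_val].
HB.instance Definition _ := [Choice of kernel by <:].
HB.instance Definition _ := GRing.SubChoice_isSubLmodule.Build
  R U kernel_pred kernel (GRing.submod_closed_semi kernel_submod).
End Kernel.

Section FreeModule.
Variables (R : comPzRingType) (T : choiceType).

Definition fin_supp : {pred T -> R^o} :=
  [in [set f : T -> R^o | finite_set (f @^-1` [set~ 0])]].

Lemma fin_supp_submod : submod_closed fin_supp.
Proof.
split.
  by rewrite inE /=; apply: (sub_finite_set (B := set0)) => // t /= /(_ erefl).
move=> a f g; rewrite !inE /= => ff fg.
apply: (sub_finite_set (B := f @^-1` [set~ 0] `|` g @^-1` [set~ 0])).
  move=> t /=; apply: contra_notP => /not_orP[/notP ft /notP gt].
  by rewrite -[LHS]/(a * f t + g t) ft gt mulr0 addr0.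
by rewrite finite_setU.
Qed.

Record free_mod := FreeMod { free_val :> T -> R^o; _ : free_val \in fin_supp }.

HB.instance Definition _ := [isSub for free_val].
HB.instance Definition _ := [Choice of free_mod by <:].
HB.instance Definition _ := GRing.SubChoice_isSubLmodule.Build
  R (T -> R^o) fin_supp free_mod (GRing.submod_closed_semi fin_supp_submod).

Lemma free_basis_subproof (t : T) :
  (fun u => if u == t then 1 else 0) \in fin_supp.
Proof.
rewrite inE /=; apply: (sub_finite_set (B := [set t])) => // u /=.
by case: eqP.
Qed.

Definition free_basis (t : T) : free_mod := FreeMod (free_basis_subproof t).

Section Lift.
Variables (M : lmodType R) (g : T -> M).

Definition free_lift (f : free_mod) : M := \sum_(t \in [set: T]) f t *: g t.

Lemma free_liftE (f : free_mod) (r : seq T) : uniq r ->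
  f @^-1` [set~ 0] `<=` [set` r] -> free_lift f = \sum_(t <- r) f t *: g t.
Proof.
move=> ur fr; rewrite /free_lift (fsbigE r)//; last first.
  move=> t _ tr; have [->|/eqP/fr/=] := eqVneq (f t) 0.
    by rewrite scale0r.
  by rewrite (negPf tr).
by apply: eq_bigl => t; rewrite in_setT.
Qed.

Lemma free_finite (f : free_mod) : finite_set (f @^-1` [set~ 0]).
Proof. by case: f => f /=; rewrite inE. Qed.

Lemma free_lift_linear : linear free_lift.
Proof.
move=> a f h; have fU : finite_set (f @^-1` [set~ 0] `|` h @^-1` [set~ 0]).
  by rewrite finite_setU; split; exact: free_finite.
pose r : seq T :=
  finmap.enum_fset (fset_set (f @^-1` [set~ 0] `|` h @^-1` [set~ 0])).
have rE t : (t \in r) = (t \in f @^-1` [set~ 0] `|` h @^-1` [set~ 0]).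
  by rewrite /r -in_fset_set.
have ur : uniq r by exact: finmap.fset_uniq.
have fr : f @^-1` [set~ 0] `<=` [set` r].
  by move=> t ft /=; rewrite rE inE; left.
have hr : h @^-1` [set~ 0] `<=` [set` r].
  by move=> t ht /=; rewrite rE inE; right.
rewrite !(@free_liftE _ r)//; last first.
  move=> t afht /=; rewrite rE inE /=.
  apply: contrapT => /not_orP[/notP ft /notP ht].
  have E : a * f t + h t = 0 by rewrite ft ht mulr0 addr0.
  by apply: afht; exact: E.
rewrite scaler_sumr -big_split/=; apply: eq_bigr => t _.
by rewrite -[X in X *: _]/(a * f t + h t) scalerDl scalerA.
Qed.

HB.instance Definition _ :=
  GRing.isLinear.Build R free_mod M *:%R free_lift free_lift_linear.

Lemma free_lift_basis t : free_lift (free_basis t) = g t.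
Proof.
rewrite (@free_liftE _ [:: t])//.
  by rewrite big_seq1 /= eqxx scale1r.
by move=> u /=; rewrite inE; case: eqP.
Qed.
End Lift.

Lemma free_mod_eq (M : lmodType R) (u v : {linear free_mod -> M}) :
  (forall t, u (free_basis t) = v (free_basis t)) -> u =1 v.
Proof.
move=> uv f.
have -> : f = \sum_(t <- finmap.enum_fset (fset_set (f @^-1` [set~ 0])))
    f t *: free_basis t.
  apply: val_inj; apply/funext => t.
  rewrite raddf_sum fct_sumE /=.
  have E s : val (f s *: free_basis s) t = if t == s then f s else 0.
    rewrite linearZ /= -[LHS]/(f s * (if t == s then 1 else 0)).
    by case: eqP; rewrite ?mulr1 ?mulr0.
  rewrite (eq_bigr (fun s => if t == s then f s else 0)); last first.
    by move=> s _; exact: E.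
  have [/eqP ft|ft] := boolP (f t == 0).
    rewrite big1 ?ft// => s _; case: eqP => // <-; exact: ft.
  rewrite (bigD1_seq t)/= ?finmap.fset_uniq ?eqxx//; last first.
    by rewrite in_fset_set ?inE //=; [exact/eqP|exact: free_finite].
  rewrite big1 ?addr0// => s; rewrite eq_sym => /negPf -> //.
by rewrite !linear_sum; apply: eq_bigr => t _; rewrite !linearZ_LR uv.
Qed.
End FreeModule.
Arguments free_mod : clear implicits.
Arguments free_basis R {T} t.

Section Tensor.
Variable R : comPzRingType.

Section Def.
Variables M N : lmodType R.
Implicit Types (x : M) (y : N) (a : R).

Definition tensor_rel : set (free_mod R (M * N)%type) :=
  [set z | exists a x x' y, z = free_basis R (a *: x + x', y)
             - (a *: free_basis R (x, y) + free_basis R (x', y))] `|`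
  [set z | exists a x y y', z = free_basis R (x, a *: y + y')
             - (a *: free_basis R (x, y) + free_basis R (x, y'))].

Definition tensor := quot_mod tensor_rel.
HB.instance Definition _ := GRing.Lmodule.on tensor.

Definition tmul x y : tensor := quot_pi tensor_rel (free_basis R (x, y)).

Lemma tmulPl a x x' y : tmul (a *: x + x') y = a *: tmul x y + tmul x' y.
Proof.
rewrite /tmul -linearP; apply/quot_modP/sub_span; left.
by exists a, x, x', y.
Qed.

Lemma tmulPr a x y y' : tmul x (a *: y + y') = a *: tmul x y + tmul x y'.
Proof.
rewrite /tmul -linearP; apply/quot_modP/sub_span; right.
by exists a, x, y, y'.
Qed.

Lemma tmul0l y : tmul 0 y = 0.
Proof. by have := tmulPl (-1) 0 0 y; rewrite scaler0 add0r scaleN1r addNr. Qed.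

Lemma tensor_eq (P : lmodType R) (u v : {linear tensor -> P}) :
  (forall x y, u (tmul x y) = v (tmul x y)) -> u =1 v.
Proof.
move=> uv z; rewrite -[z]reprK -[\pi_ _ _]/(quot_pi tensor_rel (repr z)).
apply: (@free_mod_eq _ _ _ (u \o quot_pi tensor_rel) (v \o quot_pi tensor_rel)).
by move=> -[x y]; exact: uv.
Qed.
End Def.

Section Map.
Variables (M M' N N' : lmodType R).
Variables (f : {linear M -> M'}) (g : {linear N -> N'}).

Definition tensor_map0 : {linear free_mod R (M * N)%type -> tensor M' N'} :=
  free_lift (fun p => tmul (f p.1) (g p.2)).

Lemma tensor_map_rel z : tensor_rel z -> tensor_map0 z = 0.
Proof.
by case=> -[a [x [x' [y ->]]]];
  rewrite raddfB /= linearP /= !free_lift_basis /= linearP ?tmulPl ?tmulPr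
    subrr.
Qed.

Definition tensor_map : {linear tensor M N -> tensor M' N'} :=
  quot_lift tensor_map_rel.

Lemma tensor_mapE x y : tensor_map (tmul x y) = tmul (f x) (g y).
Proof.
by rewrite [LHS](@quot_liftE _ _ _ _ tensor_map0) /= free_lift_basis.
Qed.
End Map.
End Tensor.

Section Hom.
Variable R : comPzRingType.

Section Def.
Variables M N : lmodType R.

Definition linear_pred : {pred M -> N} := [in [set f : M -> N | linear f]].

Lemma linear_pred_submod : submod_closed linear_pred.
Proof.
split.
  by rewrite inE /= => a x y; rewrite -[RHS]/(a *: 0 + 0) scaler0 addr0.
move=> a f g; rewrite !inE /= => fl gl b x y.
have E z : (a *: f + g) z = a *: f z + g z by [].
rewrite !E fl gl !scalerDr !scalerA (mulrC b a).
by rewrite -!addrA; congr +%R; rewrite addrCA.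
Qed.

Record hom := HomMod {
  hom_fun :> M -> N;
  hom_linear : hom_fun \in linear_pred }.

HB.instance Definition _ := [isSub for hom_fun].
HB.instance Definition _ := [Choice of hom by <:].
HB.instance Definition _ := GRing.SubChoice_isSubLmodule.Build
  R (M -> N) linear_pred hom (GRing.submod_closed_semi linear_pred_submod).

Lemma hom_funP (h : hom) : linear h.
Proof. by case: h => h /=; rewrite inE. Qed.

HB.instance Definition _ (h : hom) :=
  GRing.isLinear.Build R M N *:%R (hom_fun h) (hom_funP h).

Lemma to_hom_subproof (f : {linear M -> N}) : (f : M -> N) \in linear_pred.
Proof. by rewrite inE /=; exact: linearP. Qed.

Definition to_hom (f : {linear M -> N}) : hom := HomMod (to_hom_subproof f).
End Def.

Section Precomp.
Variables (M' M N : lmodType R) (f : {linear M' -> M}).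

Definition hom_precomp (h : hom M N) : hom M' N := to_hom (h \o f).

Lemma hom_precomp_linear : linear hom_precomp.
Proof. by move=> a h k; apply: val_inj; apply/funext. Qed.

HB.instance Definition _ := GRing.isLinear.Build
  R (hom M N) (hom M' N) *:%R hom_precomp hom_precomp_linear.
End Precomp.
End Hom.

Section Complexes.
Variable R : comPzRingType.

Definition homology (L M N : lmodType R)
    (f : {linear L -> M}) (g : {linear M -> N}) : lmodType R :=
  quot_mod [set z : kernel g | range f (val z)].

Record chain_complex := ChainComplex {
  ch_mod :> nat -> lmodType R;
  ch_diff : forall n, {linear ch_mod n.+1 -> ch_mod n};
  ch_diffK : forall n x, ch_diff n (ch_diff n.+1 x) = 0 }.

Definition chain_homology (X : chain_complex) (n : nat) : lmodType R :=
  match n with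
  | 0 => homology (ch_diff X 0) (\0 : {linear X 0 -> X 0})
  | m.+1 => homology (ch_diff X m.+1) (ch_diff X m)
  end.

(* The module in cohomological degree n is the X_{-n} of the homological
   indexing. *)
Record cochain_complex := CochainComplex {
  coch_mod :> nat -> lmodType R;
  coch_diff : forall n, {linear coch_mod n -> coch_mod n.+1};
  coch_diffK : forall n x, coch_diff n.+1 (coch_diff n x) = 0 }.

Definition cochain_homology (X : cochain_complex) (n : nat) : lmodType R :=
  match n with
  | 0 => homology (\0 : {linear X 0 -> X 0}) (coch_diff X 0)
  | m.+1 => homology (coch_diff X m) (coch_diff X m.+1)
  end.

Lemma tensor_chain_diffK (X : chain_complex) (N : lmodType R) n x :
  tensor_map (ch_diff X n) (idfun : {linear N -> N})
    (tensor_map (ch_diff X n.+1) (idfun : {linear N -> N}) x) = 0.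
Proof.
rewrite -[LHS]/((tensor_map (ch_diff X n) (idfun : {linear N -> N}) \o
  tensor_map (ch_diff X n.+1) (idfun : {linear N -> N})) x).
rewrite -[RHS]/((\0 : {linear _ -> _}) x); apply: tensor_eq => {}x y.
rewrite [LHS](congr1 (tensor_map _ _) (tensor_mapE _ _ _ _)) tensor_mapE.
by rewrite ch_diffK tmul0l.
Qed.

Definition tensor_chain (X : chain_complex) (N : lmodType R) : chain_complex :=
  @ChainComplex (fun n => tensor (X n) N : lmodType R)
    (fun n => tensor_map (ch_diff X n) (idfun : {linear N -> N}))
    (@tensor_chain_diffK X N).

Lemma hom_cochain_diffK (X : chain_complex) (N : lmodType R) n
    (h : hom (X n) N) :
  hom_precomp (ch_diff X n.+1) (hom_precomp (ch_diff X n) h) = 0.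
Proof. by apply: val_inj; apply/funext => x /=; rewrite ch_diffK raddf0. Qed.

Definition hom_cochain (X : chain_complex) (N : lmodType R) : cochain_complex :=
  @CochainComplex (fun n => hom (X n) N : lmodType R)
    (fun n => @hom_precomp _ _ _ N (ch_diff X n))
    (@hom_cochain_diffK X N).

(* The standard free resolution of M: with Z_0 = M, the n-th module is free on
   the underlying set of Z_n, and Z_{n+1} is the kernel of the canonical
   surjection eps from it onto Z_n. *)
Definition eps (M : lmodType R) : {linear free_mod R M -> M} := free_lift id.

Fixpoint syzygy (M : lmodType R) (n : nat) : lmodType R :=
  if n is m.+1 then kernel (eps (syzygy M m)) else M.

Definition std_diff (M : lmodType R) (n : nat) :
    {linear free_mod R (syzygy M n.+1) -> free_mod R (syzygy M n)} :=
  (val : {linear kernel (eps (syzygy M n)) -> _}) \o eps (syzygy M n.+1).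

Lemma std_diffK M n x : std_diff M n (std_diff M n.+1 x) = 0.
Proof.
rewrite /std_diff /=; set z := free_lift _ x.
by have /eqP -> := valP z.
Qed.

Definition std_resolution (M : lmodType R) : chain_complex :=
  @ChainComplex (fun n => free_mod R (syzygy M n) : lmodType R)
    (std_diff M) (@std_diffK M).

Definition Tor (i : nat) (M N : lmodType R) : lmodType R :=
  chain_homology (tensor_chain (std_resolution M) N) i.

Definition Ext (i : nat) (M N : lmodType R) : lmodType R :=
  cochain_homology (hom_cochain (std_resolution M) N) i.

(* The supremum of the empty set is -oo, so that the zero complex has length -oo
   and proj_dim, inj_dim below take the value -oo at the zero module; the
   infimum of the empty set is +oo. *)
Definition length_of (X : nat -> lmodType R) : \bar int :=
  supremum -oo%E [set n%:Z%:E%E | n in [set n | ~ is_zero (X n)]].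

Section Dimension.
Variable X : lmodType R -> Prop.

Definition is_resolution (M : lmodType R) (P : chain_complex) :=
  [/\ forall n, X (P n), isomorphic (chain_homology P 0) M &
      forall n, (1 <= n)%N -> is_zero (chain_homology P n)].

Definition is_coresolution (M : lmodType R) (I : cochain_complex) :=
  [/\ forall n, X (I n), isomorphic (cochain_homology I 0) M &
      forall n, (1 <= n)%N -> is_zero (cochain_homology I n)].

Definition proj_dim (M : lmodType R) : \bar int :=
  infimum +oo%E [set d | exists2 P, is_resolution M P & length_of P = d].

Definition inj_dim (M : lmodType R) : \bar int :=
  infimum +oo%E [set d | exists2 I, is_coresolution M I & length_of I = d].
End Dimension.

Definition fin_gen (M : lmodType R) :=
  exists s : seq M, forall x, x \in span [set` s].

Definition flat (F : lmodType R) :=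
  forall (L M N : lmodType R) (f : {linear L -> M}) (g : {linear M -> N}),
    exact_at f g ->
    exact_at (tensor_map f (idfun : {linear F -> F}))
             (tensor_map g (idfun : {linear F -> F})).

Definition injective_mod (I : lmodType R) :=
  forall (M N : lmodType R) (f : {linear M -> N}) (g : {linear M -> I}),
    injective f -> exists h : {linear N -> I}, forall x, h (f x) = g x.

Definition homothety (C : lmodType R) (r : R) : hom C C :=
  to_hom ( *:%R r : {linear C -> C}).

Definition semidualizing (C : lmodType R) :=
  [/\ fin_gen C, bijective (@homothety C) &
      forall i, (1 <= i)%N -> is_zero (Ext i C C)].

Definition F_class (C : lmodType R) (M : lmodType R) :=
  exists2 F : lmodType R, flat F & isomorphic (tensor F C) M.

Definition I_class (C : lmodType R) (M : lmodType R) :=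
  exists2 I : lmodType R, injective_mod I & isomorphic (hom C I) M.

End Complexes.

Definition is_ideal (R : comPzRingType) (I : set R) :=
  submod_closed [in (I : set R^o)].

Definition noetherian (R : comPzRingType) :=
  forall I : set R, is_ideal I ->
    exists s : seq R, I = [set x | x \in span [set y : R^o | y \in s]].

Record spectrum (R : comPzRingType) := Spectrum {
  prime_set :> set R;
  prime_ideal : is_ideal prime_set;
  prime_proper : ~ prime_set 1;
  primeM : forall x y, prime_set (x * y) -> prime_set x \/ prime_set y }.

Definition maximal_ideal (R : comPzRingType) (m : set R) :=
  [/\ is_ideal m, ~ m 1 &
      forall J : set R, is_ideal J -> m `<=` J -> J = m \/ J = setT].

Definition is_local (R : comPzRingType) := exists! m : set R, maximal_ideal m.

(* In a local ring the set of nonunits is the maximal ideal, so that its span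
   is the maximal ideal and the quotient is the residue field. *)
Definition residue_field (R : comPzRingType) : lmodType R :=
  quot_mod [set x : R^o | ~ exists y : R, y * (x : R) = 1].

Definition width (S : comPzRingType) (N : lmodType S) : \bar int :=
  infimum +oo%E
    [set i%:Z%:E%E | i in [set i | ~ is_zero (Tor i (residue_field S) N)]].

Definition gorenstein_local (S : comPzRingType) :=
  [/\ noetherian S, is_local S & (inj_dim (@injective_mod S) S^o < +oo)%E].

Section Localization.
Variables (R : comPzRingType) (p : spectrum R).

Record denom := Denom { denom_val :> R; _ : `[< ~ prime_set p denom_val >] }.

HB.instance Definition _ := [isSub for denom_val].
HB.instance Definition _ := [Choice of denom by <:].

Lemma denom1_subproof : `[< ~ prime_set p 1 >].
Proof. by apply/asboolP; exact: prime_proper. Qed.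
Definition denom1 : denom := Denom denom1_subproof.

Lemma denomM_subproof (s t : denom) :
  `[< ~ prime_set p (denom_val s * denom_val t) >].
Proof.
have /asboolP sp := valP s; have /asboolP tp := valP t.
by apply/asboolP => /primeM[].
Qed.
Definition denomM (s t : denom) : denom := Denom (denomM_subproof s t).

Section Module.
Variable M : lmodType R.
Definition loc_equiv : rel (M * denom) := fun x y =>
  `[< exists t : denom,
        denom_val t *: (denom_val y.2 *: x.1 - denom_val x.2 *: y.1) = 0 >].

Lemma loc_equivP (x y : M * denom) : reflect
  (exists t : denom, (denom_val t * denom_val y.2) *: x.1 =
                     (denom_val t * denom_val x.2) *: y.1)
  (loc_equiv x y).
Proof.
apply: (iffP (asboolP _)) => -[t tP]; exists t; move: tP;
  rewrite scalerBr !scalerA.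
  by move/subr0_eq.
by move=> ->; rewrite subrr.
Qed.

Lemma loc_equiv_is_equiv : equiv_class_of loc_equiv.
Proof.
split.
- by move=> x; apply/loc_equivP; exists denom1.
- by move=> x y; apply/loc_equivP/loc_equivP => -[t e]; exists t; rewrite e.
- move=> y x z /loc_equivP[t xy] /loc_equivP[u yz]; apply/loc_equivP.
  exists (denomM (denomM t u) y.2); rewrite /=.
  transitivity ((denom_val u * denom_val z.2) *:
    ((denom_val t * denom_val y.2) *: x.1)).
    by rewrite scalerA; congr (_ *: _); ring.
  rewrite xy scalerA.
  transitivity ((denom_val t * denom_val x.2) *:
    ((denom_val u * denom_val z.2) *: y.1)).
    by rewrite scalerA mulrC.
  by rewrite yz scalerA; congr (_ *: _); ring.
Qed.

Canonical loc_equiv_equiv := EquivRelPack loc_equiv_is_equiv.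
Canonical loc_equiv_encModRel := defaultEncModRel loc_equiv.

Definition localization := {eq_quot loc_equiv}.
HB.instance Definition _ := Choice.on localization.
HB.instance Definition _ := EqQuotient.on localization.

Definition frac (x : M) (s : denom) : localization := \pi_localization (x, s).

Implicit Types (x y : M) (s t : denom).

Lemma frac_eq x y s t : frac x s = frac y t <->
  exists u : denom, (denom_val u * denom_val t) *: x =
                       (denom_val u * denom_val s) *: y.
Proof.
split=> [/eqP|e]; rewrite /frac.
  by rewrite eqmodE => /loc_equivP.
by apply/eqP; rewrite eqmodE; apply/loc_equivP.
Qed.

Lemma fracP (z : localization) : exists x s, z = frac x s.
Proof.
by exists (repr z).1, (repr z).2; rewrite /frac -surjective_pairing reprK.
Qed.

Definition loc_add (u v : localization) : localization :=
  frac (denom_val (repr v).2 *: (repr u).1 + denom_val (repr u).2 *: (repr v).1)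
       (denomM (repr u).2 (repr v).2).

Definition loc_opp (u : localization) : localization :=
  frac (- (repr u).1) (repr u).2.

Lemma repr_frac x s : exists u : denom,
  (denom_val u * denom_val s) *: (repr (frac x s)).1 =
  (denom_val u * denom_val (repr (frac x s)).2) *: x.
Proof. by apply/frac_eq; rewrite /frac -surjective_pairing reprK. Qed.

Lemma loc_addE x y s t : loc_add (frac x s) (frac y t) =
  frac (denom_val t *: x + denom_val s *: y) (denomM s t).
Proof.
rewrite /loc_add.
have [u] := repr_frac x s; have [v] := repr_frac y t.
move: (repr (frac x s)) (repr (frac y t)) => [x' s'] [y' t'] /= yt xs.
apply/frac_eq; exists (denomM u v); rewrite /= !scalerDr !scalerA.
congr (_ + _).
  transitivity ((denom_val v * denom_val t * denom_val t') *:
    ((denom_val u * denom_val s) *: x')).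
    by rewrite scalerA; congr (_ *: _); ring.
  by rewrite xs scalerA; congr (_ *: _); ring.
transitivity ((denom_val u * denom_val s * denom_val s') *:
    ((denom_val v * denom_val t) *: y')).
  by rewrite scalerA; congr (_ *: _); ring.
by rewrite yt scalerA; congr (_ *: _); ring.
Qed.

Lemma loc_oppE x s : loc_opp (frac x s) = frac (- x) s.
Proof.
rewrite /loc_opp; have [u] := repr_frac x s.
move: (repr (frac x s)) => [x' s'] /= xs.
by apply/frac_eq; exists u; rewrite !scalerN xs.
Qed.

Lemma loc_addA : associative loc_add.
Proof.
move=> a b c; have [x [s ->]] := fracP a; have [y [t ->]] := fracP b.
have [z [u ->]] := fracP c; rewrite !loc_addE; apply/frac_eq.
exists denom1; rewrite /= !mul1r; congr (_ *: _); first by ring.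
by rewrite !scalerDr !scalerA addrA; congr (_ *: _ + _ *: _ + _ *: _); ring.
Qed.

Lemma loc_addC : commutative loc_add.
Proof.
move=> a b; have [x [s ->]] := fracP a; have [y [t ->]] := fracP b.
rewrite !loc_addE; apply/frac_eq; exists denom1.
by rewrite /= !mul1r addrC; congr (_ *: _); ring.
Qed.

Lemma loc_add0 : left_id (frac 0 denom1) loc_add.
Proof.
move=> a; have [x [s ->]] := fracP a; rewrite loc_addE; apply/frac_eq.
by exists denom1; rewrite /= !mul1r scaler0 add0r scale1r.
Qed.

Lemma loc_addN : left_inverse (frac 0 denom1) loc_opp loc_add.
Proof.
move=> a; have [x [s ->]] := fracP a; rewrite loc_oppE loc_addE; apply/frac_eq.
by exists denom1; rewrite scalerN addNr !scaler0.
Qed.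

HB.instance Definition _ := GRing.isZmodule.Build localization
  loc_addA loc_addC loc_add0 loc_addN.
End Module.

Section Scale.
Variable M : lmodType R.

Definition loc_scale (a : localization R^o) (u : localization M) :
    localization M :=
  frac (((repr a).1 : R) *: (repr u).1) (denomM (repr a).2 (repr u).2).

Lemma loc_scaleE (r : R) (x : M) s t :
  loc_scale (frac (r : R^o) s) (frac x t) = frac (r *: x) (denomM s t).
Proof.
rewrite /loc_scale.
have [u] := repr_frac (r : R^o) s; have [v] := repr_frac x t.
move: (repr (frac (r : R^o) s)) (repr (frac x t)) => [r' s'] [x' t'] /= xt rs0.
have rs : denom_val u * denom_val s * (r' : R) =
    denom_val u * denom_val s' * r by exact: rs0.
apply/frac_eq; exists (denomM u v); rewrite /= !scalerA.
transitivity ((denom_val u * denom_val s * (r' : R)) *: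
    ((denom_val v * denom_val t) *: x')).
  by rewrite scalerA; congr (_ *: _); ring.
by rewrite xt rs scalerA; congr (_ *: _); ring.
Qed.

End Scale.
Arguments loc_scale {M} a u.

Section ScaleTheory.
Variable M : lmodType R.
Implicit Types a b : localization R^o.

Lemma loc_scaleA a b (u : localization M) :
  loc_scale a (loc_scale b u) = loc_scale (loc_scale a b) u.
Proof.
have [x [s ->]] := fracP a; have [y [t ->]] := fracP b.
have [z [v ->]] := fracP u.
rewrite (loc_scaleE y z) (loc_scaleE x (y *: z)) (loc_scaleE x y) loc_scaleE.
apply/frac_eq; exists denom1.
by rewrite /= -[x *: y]/((x : R) * (y : R)) !scalerA; congr (_ *: _); ring.
Qed.

Lemma loc_scale1 : left_id (frac (1 : R^o) denom1) (@loc_scale M).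
Proof.
move=> u; have [x [s ->]] := fracP u; rewrite loc_scaleE; apply/frac_eq.
by exists denom1; rewrite /= !mul1r scale1r.
Qed.

Lemma loc_scaleDr : right_distributive (@loc_scale M) +%R.
Proof.
move=> a u v; have [x [s ->]] := fracP a; have [y [t ->]] := fracP u.
have [z [w ->]] := fracP v; rewrite -![_ + _]/(loc_add _ _).
rewrite (loc_addE y z) (loc_scaleE x y) (loc_scaleE x z) loc_addE loc_scaleE.
apply/frac_eq; exists denom1.
by rewrite /= !mul1r !scalerDr !scalerA; congr (_ *: _ + _ *: _); ring.
Qed.

Lemma loc_scaleDl (u : localization M) : {morph loc_scale^~ u : a b / a + b}.
Proof.
move=> a b; have [x [s ->]] := fracP a; have [y [t ->]] := fracP b.
have [z [w ->]] := fracP u; rewrite -![_ + _]/(loc_add _ _).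
rewrite (loc_addE x y) (loc_scaleE x z) (loc_scaleE y z) loc_addE.
rewrite (loc_scaleE (denom_val t * (x : R) + denom_val s * (y : R)) z).
apply/frac_eq; exists denom1.
by rewrite /= !mul1r !scalerDr !scalerA -scalerDl; congr (_ *: _); ring.
Qed.
End ScaleTheory.

Definition loc_ring := localization R^o.
HB.instance Definition _ := GRing.Zmodule.on loc_ring.

Definition loc_mul (a b : loc_ring) : loc_ring := loc_scale a b.

Lemma loc_mulA : associative loc_mul.
Proof. by move=> a b c; exact: loc_scaleA. Qed.

Lemma loc_mulC : commutative loc_mul.
Proof.
move=> a b; have [x [s ->]] := fracP a; have [y [t ->]] := fracP b.
rewrite /loc_mul !loc_scaleE; apply/frac_eq; exists denom1; rewrite /= !mul1r.
rewrite -[_ *: y]/(_ * y : R) -[_ *: x]/(_ * x : R) -![_ *: _]/(_ * _ : R).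
by ring.
Qed.

Lemma loc_mul1 : left_id (frac (1 : R^o) denom1 : loc_ring) loc_mul.
Proof. exact: loc_scale1. Qed.

Lemma loc_mulDl : left_distributive loc_mul +%R.
Proof. by move=> a b c; exact: loc_scaleDl. Qed.

HB.instance Definition _ := GRing.Zmodule_isComPzRing.Build loc_ring
  loc_mulA loc_mulC loc_mul1 loc_mulDl.

HB.instance Definition _ (M : lmodType R) :=
  GRing.Zmodule_isLmodule.Build loc_ring (localization M)
    (@loc_scaleA M) (@loc_scale1 M) (@loc_scaleDr M) (@loc_scaleDl M).

End Localization.

Definition F_pd (R : comPzRingType) (C M : lmodType R) : \bar int :=
  proj_dim (F_class C) M.

Definition I_id (R : comPzRingType) (C M : lmodType R) : \bar int :=
  inj_dim (I_class C) M.

(* Main.v *)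
Require Import Defs.
From HB Require Import structures.
From mathcomp Require Import all_boot all_order all_algebra.
From mathcomp Require Import all_classical constructive_ereal ring.
(* Again, to give [span] and [hom] precedence over the names in vector. *)
Import Defs.
Import GRing.Theory.
Set Implicit Arguments.
Unset Strict Implicit.
Unset Printing Implicit Defensive.
Local Open Scope ring_scope.
Local Open Scope classical_set_scope.

(* Write M = F (x) C with F flat. Since M has a bounded coresolution by modules
   Hom(C, I), it lies in the Auslander class of C, so that the unit
   M -> Hom(C, C (x) M) is surjective. Applied to x |-> y (x) (f (x) x) this
   produces m with y (x) (f (x) x) = x (x) m for all x in C. If F_p / p F_p is
   nonzero, which is what finiteness of the width gives, such an identity cannot
   hold for x, y linearly independent in C (x) k(p). Hence C_p is cyclic, and
   being faithful it is isomorphic to R_p. Now M_p is a flat R_p-module of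
   finite injective dimension with p M_p <> M_p. An element w of M_p outside
   p M_p gives a pure embedding 1 |-> w of R_p into M_p, so the vanishing of
   Ext^i(K, M_p) for finitely generated K and large i passes to Ext^i(K, R_p),
   and by Baer's criterion a cosyzygy of R_p is injective. *)

(** * Linear maps and short exact sequences *)

Section LinearMaps.
Variable R : comPzRingType.
Implicit Types A B D K L M N P Q V W : lmodType R.

(** Finiteness of the width enters by contraposition. If F_p = p F_p, flatness makes every solution
    in F (x) C of a linear system a combination of p-multiples of solutions, up to a denominator. So
    the cycles computing Tor(k(p), M_p) are combinations of p R_p-multiples of cycles, hence
    boundaries because p R_p annihilates Tor(k(p), -); all these Tor vanish and the width is
    infinite. As F need not be finitely generated, F_p = p F_p does not mean F_p = 0. Membership in
    the Auslander class is proved for Hom(C, I) by Hom evaluation and descends along the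
    coresolution. The descent needs Tor_1(K, -) = 0 for K = C and, to continue, for its syzygies;
    this is why all finitely generated K with Ext^i(K, C) = 0 for i >= 1 are treated together. The
    isomorphism of C_p with R_p is never formed. It is replaced by identities over R that hold up to
    a denominator t, which avoids commuting localization with tensor and Hom. *)

Lemma linear_of_fun V W (f : V -> W) :
  linear f -> exists F : {linear V -> W}, forall x, F x = f x.
Proof.
move=> lf; pose m := GRing.isLinear.Build R V W *:%R f lf.
by exists (HB.pack f m : {linear V -> W}).
Qed.

(** For a linear relation, uniqueness of the value at 0 gives uniqueness everywhere. Maps defined
    through chosen preimages or decompositions are built this way. *)
Lemma linear_of_rel V W (G : V -> W -> Prop) :
  (forall a x x' y y', G x y -> G x' y' -> G (a *: x + x') (a *: y + y')) ->
  (forall x, exists y, G x y) -> (forall y, G 0 y -> y = 0) ->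
  exists f : {linear V -> W}, forall x y, G x y <-> f x = y.
Proof.
move=> Glin /choice[f Gf] G0.
have Gu x y y' : G x y -> G x y' -> y = y'.
  move=> /(Glin (-1)) /[apply].
  by rewrite !scaleN1r addNr => /G0/eqP; rewrite addrC subr_eq0 => /eqP.
have [|F FE] := @linear_of_fun _ _ f.
  by move=> a x y; apply: Gu (Gf _) _; apply: Glin.
exists F => x y; rewrite FE; split=> [Gxy|<-//].
exact: Gu (Gf x) Gxy.
Qed.

Lemma factor_inj A B Q (f : {linear A -> B}) (h : {linear Q -> B}) :
  injective f -> (forall q, exists a, f a = h q) ->
  exists h' : {linear Q -> A}, forall q, f (h' q) = h q.
Proof.
move=> fI fh; have [|//||h' h'P] := @linear_of_rel _ _ (fun q a => f a = h q).
- by move=> a x x' y y' e e'; rewrite !linearP e e'.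
- by move=> y; rewrite raddf0 -(raddf0 f) => /fI.
- by exists h' => q; apply/h'P.
Qed.

Lemma factor_surj B D W (g : {linear B -> D}) (h : {linear B -> W}) :
  (forall d, exists b, g b = d) -> (forall b, g b = 0 -> h b = 0) ->
  exists h' : {linear D -> W}, forall b, h' (g b) = h b.
Proof.
move=> gS gh.
have [|||h' h'P] := @linear_of_rel _ _
    (fun d w => exists2 b, g b = d & h b = w).
- move=> a x x' y y' [b <- <-] [b' <- <-].
  by exists (a *: b + b'); rewrite linearP.
- by move=> d; have [b bd] := gS d; exists (h b), b.
- by move=> y [b /gh ->].
- by exists h' => b; apply/h'P; exists b.
Qed.

Definition ses A B D (f : {linear A -> B}) (g : {linear B -> D}) :=
  [/\ injective f, forall a, g (f a) = 0, forall b, g b = 0 -> exists a, f a = b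
    & forall d, exists b, g b = d].

Lemma kernel_ses B D (g : {linear B -> D}) : (forall d, exists b, g b = d) ->
  ses (val : {linear kernel g -> B}) g.
Proof.
move=> gS; split=> //.
- by move=> a; apply/eqP; exact: (valP a).
- move=> b gb; have kb : b \in kernel_pred g by rewrite inE gb.
  by exists (Kernel kb).
Qed.

Definition projective P :=
  forall B D (g : {linear B -> D}) (h : {linear P -> D}),
  (forall d, exists b, g b = d) ->
  exists h' : {linear P -> B}, forall x, g (h' x) = h x.

Lemma free_mod_projective (T : choiceType) : projective (free_mod R T).
Proof.
move=> B D g h gS.
have [k kP] := choice (fun t => gS (h (free_basis R t))).
exists (free_lift k); apply: (@free_mod_eq _ _ _ (g \o free_lift k) h) => t /=.
by rewrite free_lift_basis kP.
Qed.

Section Row.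
Variables (r : nat) (M : lmodType R).

Definition row_comb (g : 'I_r -> M) (v : 'rV[R]_r) : M := \sum_i v 0 i *: g i.

Lemma row_comb_linear g : linear (row_comb g).
Proof.
move=> a u v; rewrite /row_comb scaler_sumr -big_split; apply: eq_bigr =>
  i _ /=.
by rewrite !mxE scalerDl scalerA.
Qed.

HB.instance Definition _ g :=
  GRing.isLinear.Build R 'rV[R]_r M *:%R (row_comb g) (row_comb_linear g).

Lemma row_comb_delta g i : row_comb g (delta_mx 0 i) = g i.
Proof.
rewrite /row_comb (bigD1 i)//= big1 ?addr0; first by rewrite mxE !eqxx scale1r.
by move=> j /negPf ji; rewrite mxE ji andbF scale0r.
Qed.

Lemma row_linearE (f : {linear 'rV[R]_r -> M}) v :
  f v = \sum_i v 0 i *: f (delta_mx 0 i).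
Proof.
rewrite {1}[v]row_sum_delta linear_sum; apply: eq_bigr => i _.
by rewrite linearZ.
Qed.
End Row.

Lemma row_projective r : projective 'rV[R]_r.
Proof.
move=> B D g h gS.
have [k kP] := choice (fun i => gS (h (delta_mx 0 i))).
exists (row_comb k) => x; rewrite (row_linearE h) linear_sum.
by apply: eq_bigr => i _; rewrite linearZ kP.
Qed.

Lemma submod_set_closed V (B : set V) : submod_closed [in B] <->
  B 0 /\ forall a u v, B u -> B v -> B (a *: u + v).
Proof.
split=> [[B0 BP]|[B0 BP]].
  split=> [|a u v]; first by move: B0; rewrite inE.
  by have := BP a u v; rewrite !inE.
by split=> [|a u v]; rewrite !inE; auto.
Qed.

End LinearMaps.

(** * Vanishing of Ext *)

Section Ext1.
Variable R : comPzRingType.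
Implicit Types A B D K L M N P Q V W Z : lmodType R.

(** Quantifying over all extensions of K, with no condition on the middle term, keeps the notion
    independent of a resolution. *)
Definition ext1_vanish K N :=
  forall A Q (i : {linear A -> Q}) (g : {linear Q -> K}),
  ses i g -> forall h : {linear A -> N},
  exists e : {linear Q -> N}, forall a, e (i a) = h a.

(** One projective presentation suffices. A lift [l] of [g] to Q gives Q = j(B) + l(P), and the
    extension sends j b + l p to h b + e p; the two parts agree where they overlap because [e]
    extends h u. *)
Lemma ext1_vanish_projective A P K N (i : {linear A -> P})
  (g : {linear P -> K}) :
  ses i g -> projective P ->
  (forall h : {linear A -> N}, exists e : {linear P -> N}, forall a,
    e (i a) = h a) ->
  ext1_vanish K N.
Proof.
move=> [iI gi gE gS] pP ext B Q j q [jI qj qE qS] h.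
have [l lE] := pP _ _ q g qS.
have [|u uE] := @factor_inj _ _ _ _ j (l \o i) jI.
  by move=> a; apply: qE; rewrite /= lE gi.
have [e eE] := ext (h \o u).
have [|||f fP] := @linear_of_rel _ Q N (fun x y => exists b p,
    j b + l p = x /\ h b + e p = y).
- move=> a _ _ _ _ [b [p [<- <-]]] [b' [p' [<- <-]]].
  exists (a *: b + b'), (a *: p + p').
  by rewrite !linearP !scalerDr ![_ + (_ *: _ + _)]addrACA.
- move=> x; have [p gp] := gS (q x).
  have [|b bE] := qE (x - l p); first by rewrite raddfB /= lE gp subrr.
  by exists (h b + e p), b, p; rewrite bE subrK.
- move=> _ [b [p [E <-]]].
  have [|a ap] := gE p.
    by rewrite -lE -[q _]add0r -[X in X + _](qj b) -raddfD /= E raddf0.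
  rewrite -ap eE /= -raddfD; suff -> : b + u a = 0 by rewrite raddf0.
  by apply: jI; rewrite raddfD /= uE /= ap E raddf0.
- exists f => b; apply/fP; exists b, 0; by rewrite !raddf0 !addr0.
Qed.

(* Stands in for Schanuel's lemma and the comparison of projective resolutions.
  *)
Definition stable_retract K Z := exists2 P, projective P &
  exists (u : {linear K -> Z}) (p : {linear K -> P})
         (v : {linear Z -> K}) (q : {linear P -> K}),
  forall k, v (u k) + q (p k) = k.

Lemma stable_retract_refl K : stable_retract K K.
Proof.
exists 'rV[R]_0; first exact: row_projective.
exists idfun, \0, idfun, \0 => k; exact: addr0.
Qed.

(** The three maps [uB], [vA], [rA] lift the retraction to the projectives. The defect 1 - vA uB -
    rA p g is killed by g, so it factors through K' as [w], and on K' the last term disappears. The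
    relation j u = uB i serves to transport extensions along j to extensions along i. *)
Lemma stable_retract_lift K Z K' A Z' B
    (i : {linear K' -> A}) (g : {linear A -> K})
    (j : {linear Z' -> B}) (q : {linear B -> Z}) :
  stable_retract K Z -> ses i g -> ses j q -> projective A -> projective B ->
  exists (u : {linear K' -> Z'}) (uB : {linear A -> B})
         (v : {linear Z' -> K'}) (w : {linear A -> K'}),
    (forall k, j (u k) = uB (i k)) /\ (forall k, v (u k) + w (i k) = k).
Proof.
move=> [P pP [u [p [v [r rE]]]]] [iI gi gE gS] [jI qj qE qS] pA pB.
have [uB uBE] := pA _ _ q (u \o g) qS.
have [vA vAE] := pB _ _ g (v \o q) gS.
have [rA rAE] := pP _ _ g r gS.
have [|u' u'E] := @factor_inj _ _ _ _ j (uB \o i) jI.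
  by move=> k; apply: qE; rewrite /= uBE /= gi raddf0.
have [|v' v'E] := @factor_inj _ _ _ _ i (vA \o j) iI.
  by move=> z; apply: gE; rewrite /= vAE /= qj raddf0.
pose w0 : {linear A -> A} := (idfun \- (vA \o uB)) \- (rA \o (p \o g)).
have w0E x : w0 x = x - vA (uB x) - rA (p (g x)) by [].
have [|w wE] := @factor_inj _ _ _ _ i w0 iI.
  move=> x; apply: gE; rewrite w0E !raddfB /= vAE /= uBE rAE /=.
  by rewrite -addrA -opprD rE subrr.
exists u', uB, v', w; split=> // k; apply: iI.
rewrite raddfD /= wE w0E v'E /= u'E /= gi.
by rewrite !raddf0 addr0 addrC subrK.
Qed.

Lemma stable_retract_syzygy K Z K' A Z' B
    (i : {linear K' -> A}) (g : {linear A -> K})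
    (j : {linear Z' -> B}) (q : {linear B -> Z}) :
  stable_retract K Z -> ses i g -> ses j q -> projective A -> projective B ->
  stable_retract K' Z'.
Proof.
move=> KZ ig jq pA pB.
have [u [uB [v [w [uE vE]]]]] := stable_retract_lift KZ ig jq pA pB.
by exists A => //; exists u, i, v, w.
Qed.

Lemma eps_surj K : forall x, exists y, eps K y = x.
Proof. by move=> x; exists (free_basis R x); exact: free_lift_basis. Qed.

Lemma eps_ses K : ses (val : {linear kernel (eps K) -> _}) (eps K).
Proof. exact/kernel_ses/eps_surj. Qed.

Lemma ext1_vanish_retract K Z N :
  stable_retract K Z -> ext1_vanish Z N -> ext1_vanish K N.
Proof.
move=> KZ extZ; apply: (ext1_vanish_projective (eps_ses K)).
  exact: free_mod_projective.
move=> h; have [u [uB [v [w [uE vE]]]]] := stable_retract_lift KZ (eps_ses K)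
  (eps_ses Z) (@free_mod_projective _ _) (@free_mod_projective _ _).
have [e eE] := extZ _ _ _ _ (eps_ses Z) (h \o v).
have [|f fE] := @linear_of_fun _ (free_mod R K) N (fun x => e (uB x) + h (w x)).
  by move=> a x y; rewrite !linearP scalerDr addrACA.
by exists f => a; rewrite fE -uE eE /= -raddfD vE.
Qed.

(** By dimension shifting, Ext^(n+1)(K, N) is Ext^1 of the n-th syzygy. *)
Definition ext_vanish K N := forall n, ext1_vanish (syzygy K n) N.

(** The n-th standard syzygy of A is a stable retract of the (n+1)-st standard syzygy of K, by
    induction on n. *)
Lemma ext_vanish_syzygy K N A P (i : {linear A -> P}) (g : {linear P -> K}) :
  ses i g -> projective P -> ext_vanish K N -> ext_vanish A N.
Proof.
move=> ig pP extK n; apply: (ext1_vanish_retract _ (extK n.+1)).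
elim: n => [|n IHn].
  exact: stable_retract_syzygy (stable_retract_refl K) ig (eps_ses K) pP
    (@free_mod_projective _ _).
exact: stable_retract_syzygy IHn (eps_ses _) (eps_ses _)
  (@free_mod_projective _ _) (@free_mod_projective _ _).
Qed.

Lemma homology_zero L M N (f : {linear L -> M}) (g : {linear M -> N}) :
  is_zero (homology f g) -> forall y, g y = 0 -> exists x, f x = y.
Proof.
move=> H y gy; have ky : y \in kernel_pred g by rewrite inE gy.
have := H (quot_pi _ (Kernel ky)); rewrite -(raddf0 (quot_pi _)).
move=> /quot_modP; rewrite subr0.
have sub : submod_closed [in [set z : kernel g | range f (val z)]].
  split; first by rewrite inE /=; exists 0 => //; rewrite !raddf0.
  move=> a u v; rewrite !inE /= => -[x _ xu] [x' _ xv]; exists (a *: x + x') =>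
    //.
  by rewrite !linearP xu xv.
by move=> /(span_min sub (@subset_refl _ _))[x _ xy]; exists x.
Qed.

Lemma zero_homology L M N (f : {linear L -> M}) (g : {linear M -> N}) :
  (forall y, g y = 0 -> exists x, f x = y) -> is_zero (homology f g).
Proof.
move=> H z; rewrite -[z]reprK -[LHS]/(quot_pi _ (repr z)) -(raddf0 (quot_pi _)).
apply/quot_modP; rewrite subr0; apply: sub_span => /=.
by have [|x <-] := H (val (repr z));
  [apply/eqP; exact: (valP (repr z))|exists x].
Qed.

Lemma Ext_ext_vanish K N :
  (forall i, (1 <= i)%N -> is_zero (Ext i K N)) -> ext_vanish K N.
Proof.
move=> extK n; apply: (ext1_vanish_projective (eps_ses _)).
  exact: free_mod_projective.
(* Composed with [eps], the map h on the (n+1)-st syzygy is a cocycle of degree n+1. A cochain of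
   degree n bounding it is the wanted extension. *)
move=> h; have /homology_zero/= H := extK n.+1 isT.
have [|e /(congr1 val)/= eE] := H (to_hom (h \o eps (syzygy K n.+1))).
  apply: val_inj; apply/funext => x /=.
  have /eqP E := valP (eps (syzygy K n.+2) x).
  by rewrite [eps _ _]E raddf0.
exists e => a; have [y <-] := eps_surj a.
exact: (congr1 (fun F => F y) eE).
Qed.

End Ext1.

(** * Noetherian modules and dimension shifting *)

Section FiniteGeneration.
Variable R : comPzRingType.
Implicit Types A B D K L M N P Q V W Z : lmodType R.

Lemma span_sub V (X Y : set V) : X `<=` Y -> {subset span X <= span Y}.
Proof.
move=> XY x; apply: (@span_min R V X [set y | y \in span Y]).
  have [s0 sP] := span_submod Y.
  by split=> [|a u v]; rewrite !inE; [exact: s0|exact: sP].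
by move=> y /XY; exact: sub_span.
Qed.

Lemma span_cons V (a : V) (s : seq V) x :
  x \in span [set` a :: s] <-> exists r, x - r *: a \in span [set` s].
Proof.
split.
  apply: (@span_min R V _ [set y | exists r, y - r *: a \in span [set` s]]).
    split; first by rewrite inE; exists 0; rewrite scale0r subr0 rpred0.
    move=> b u v; rewrite !inE => -[r ru] [r' rv]; exists (b * r + r').
    rewrite scalerDl opprD addrACA -scalerA -scalerBr.
    by rewrite rpredD ?rpredZ.
  move=> y /=; rewrite inE => /predU1P[->|ys].
    by exists 1; rewrite scale1r subrr rpred0.
  by exists 0; rewrite scale0r subr0; exact: sub_span.
move=> [r xs]; rewrite -(subrK (r *: a) x) rpredD//.
  by apply: span_sub xs => y /= ys; rewrite inE ys orbT.
by rewrite rpredZ//; apply: sub_span => /=; rewrite inE eqxx.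
Qed.

Lemma span_nil V (x : V) : x \in span [set` [::]] -> x = 0.
Proof.
apply: (@span_min R V _ [set 0]) => //.
split; first by rewrite inE.
by move=> a u v; rewrite !inE => -> ->; rewrite scaler0 addr0.
Qed.

Lemma span_subset V (X B : set V) : submod_closed [in B] -> X `<=` B ->
  forall x, x \in span X -> B x.
Proof. by move=> Bs XB x; exact: span_min. Qed.

(** Induction on the generators: the coefficients of a in elements of B form an ideal [I], and
    finitely many generators of it lift to B. Subtracting a combination of these lifts from an
    element of B leaves an element of B in the span of s. *)
Lemma noetherian_span V (s : seq V) (B : set V) : noetherian R ->
  submod_closed [in B] -> (forall x, B x -> x \in span [set` s]) ->
  exists t : seq V, forall x, B x <-> x \in span [set` t].
Proof.
move=> nR; elim: s B => [|a s IHs] B Bs BS.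
  exists [::] => x; split=> [/BS//|/span_nil ->].
  by have /submod_set_closed[] := Bs.
have /submod_set_closed[B0 BP] := Bs.
have BD u v : B u -> B v -> B (u - v).
  by move=> Bu Bv; rewrite addrC -scaleN1r; exact: BP.
pose I := [set r : R | exists2 b, B b & b - r *: a \in span [set` s]].
have Iid : is_ideal I.
  apply/submod_set_closed; split; first by exists 0;
    rewrite // scale0r subr0 rpred0.
  move=> c u v [b Bb ub] [b' Bb' vb']; exists (c *: b + b'); first exact: BP.
  rewrite -[_ *: u]/(c * (u : R)) scalerDl opprD addrACA -scalerA -scalerBr.
  by rewrite rpredD ?rpredZ.
have [t tE] := nR I Iid.
have [||t1 t1E] := IHs (B `&` [set x | x \in span [set` s]]).
- apply/submod_set_closed; split; first by split; rewrite /= ?rpred0.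
  by move=> c u v [Bu us] [Bv vs]; split; [exact: BP|rewrite /= rpredD ?rpredZ].
- by move=> x [].
- have /choice[b bP] : forall r : R, exists b, I r ->
    B b /\ b - r *: a \in span [set` s].
    move=> r; have [[b]|nI] := pselect (I r); first by exists b.
    by exists 0.
  have tI r : r \in t -> I r.
    by move=> rt; rewrite tE; apply: sub_span.
  exists (t1 ++ map b t) => x; split=> [Bx|].
    have /span_cons[r xr] := BS x Bx.
    have [y yb yr] : exists2 y,
      y \in span [set` map b t] & y - r *: a \in span [set` s].
      have : r \in span [set y : R^o | y \in t].
        have : I r by exists x.
        by rewrite {1}tE.
      apply: (@span_min R R^o _ [set r : R^o | exists2 y,
        y \in span [set` map b t] & y - (r : R) *: a \in span [set` s]]).
        apply/submod_set_closed; split; first by exists 0;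
          rewrite ?scale0r ?subr0 rpred0.
        move=> c u v [z zb uz] [z' zb' vz']; exists (c *: z + z').
          by rewrite rpredD ?rpredZ.
        rewrite -[_ *: u]/(c * (u : R)) scalerDl opprD addrACA -scalerA
          -scalerBr.
        by rewrite rpredD ?rpredZ.
      move=> r' /= r't; exists (b r'); last by have [] := bP r' (tI _ r't).
      by apply: sub_span => /=; exact: map_f.
    have By : B y.
      apply: (span_subset Bs) yb => _ /= /mapP[r' r't ->].
      by have [] := bP r' (tI _ r't).
    rewrite -(subrK y x) rpredD//; last first.
      by apply: span_sub yb => z /= zt; rewrite mem_cat zt orbT.
    apply: (@span_sub _ [set` t1]); first by move=> z /= zt; rewrite mem_cat zt.
    apply/t1E; split; first exact: BD.
    have -> : x - y = (x - r *: a) - (y - r *: a) by rewrite opprB addrA subrK.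
    by rewrite /= rpredB.
  apply: (span_subset Bs) => y /=; rewrite mem_cat => /orP[yt1|/mapP[r rt ->]].
    by have [] : (B `&` [set x | x \in span [set` s]]) y by apply/t1E/sub_span.
  by have [] := bP r (tI _ rt).
Qed.

Lemma fin_gen_sub A Q (i : {linear A -> Q}) :
  noetherian R -> fin_gen Q -> injective i -> fin_gen A.
Proof.
move=> nR [s sQ] iI.
have [|//|t tE] := noetherian_span (s := s) (B := range i) nR.
  apply/submod_set_closed; split; first by exists 0; rewrite ?raddf0.
  by move=> a _ _ [u _ <-] [v _ <-]; exists (a *: u + v); rewrite ?linearP.
have /choice[k kE] : forall x : Q, exists a, x \in t -> i a = x.
  move=> x.
  have [xt|_] := boolP (x \in t); last by exists 0.
  have [a _ ax] : range i x by apply/tE/sub_span.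
  by exists a.
exists (map k t) => x.
have : i x \in span [set` t] by apply/tE; exists x.
suff H : forall y, y \in span [set` t] ->
    exists2 a, a \in span [set` map k t] & i a = y.
  by move=> /H[a ak /iI <-].
apply: span_subset.
  apply/submod_set_closed; split; first by exists 0; rewrite ?rpred0 ?raddf0.
  move=> c _ _ [u us <-] [v vs <-]; exists (c *: u + v); rewrite ?linearP//.
  by rewrite rpredD ?rpredZ.
move=> y /= yt; exists (k y); last exact: kE.
by apply: sub_span => /=; exact: map_f.
Qed.

Lemma fin_gen_row r : fin_gen 'rV[R]_r.
Proof.
exists [seq delta_mx 0 i | i <- enum 'I_r] => x.
rewrite [x]row_sum_delta rpred_sum// => i _; rewrite rpredZ//.
by apply: sub_span => /=; apply: map_f; rewrite mem_enum.
Qed.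

Lemma span_row_comb V (s : seq V) x : x \in span [set` s] ->
  exists c : 'rV[R]_(size s), x = row_comb (fun i : 'I_(size s) => s`_i) c.
Proof.
apply: (@span_min R V _ [set x | exists c : 'rV[R]_(size s), x = row_comb _ c]).
  apply/submod_set_closed; split; first by exists 0; rewrite linear0.
  by move=> a _ _ [c ->] [c' ->]; exists (a *: c + c'); rewrite linearP.
move=> y /= ys; have ys' : (index y s < size s)%N by rewrite index_mem.
by exists (delta_mx 0 (Ordinal ys')); rewrite row_comb_delta nth_index.
Qed.

Lemma fin_gen_cover K : fin_gen K ->
  exists r (g : {linear 'rV[R]_r -> K}), forall d, exists b, g b = d.
Proof.
move=> [s sK]; exists (size s), (row_comb (fun i : 'I_(size s) => s`_i)) => d.
by have [c ->] := span_row_comb (sK d); exists c.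
Qed.

Lemma fin_gen_surj P K (g : {linear P -> K}) :
  (forall d, exists b, g b = d) -> fin_gen P -> fin_gen K.
Proof.
move=> gS [s sP]; exists (map g s) => d; have [b <-] := gS d.
have := sP b; apply: (@span_min R P _ [set b | g b \in span [set` map g s]]).
  apply/submod_set_closed; split; first by rewrite /= raddf0 rpred0.
  by move=> a u v /= us vs; rewrite linearP rpredD ?rpredZ.
by move=> y /= ys; apply: sub_span => /=; exact: map_f.
Qed.

Lemma fin_gen_resolve K : noetherian R -> fin_gen K ->
  exists r A (i : {linear A -> 'rV[R]_r}) (g : {linear 'rV[R]_r -> K}),
    fin_gen A /\ ses i g.
Proof.
move=> nR /fin_gen_cover[r [g gS]].
exists r, (kernel g : lmodType R), val, g; split; last exact: kernel_ses.
apply: (fin_gen_sub (i := val) nR (fin_gen_row r)); exact: val_inj.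
Qed.

Lemma ses_fin_gen A r K (i : {linear A -> 'rV[R]_r})
  (g : {linear 'rV[R]_r -> K}) :
  noetherian R -> ses i g -> fin_gen A.
Proof. by move=> nR [iI _ _ _]; exact: fin_gen_sub nR (fin_gen_row r) iI. Qed.

End FiniteGeneration.

(** * Dimension shifting along injective modules *)

Section ExtShift.
Variable R : comPzRingType.
Implicit Types A B D K L M N P Q V W Z : lmodType R.

(** The connecting map from Ext^1(K, D) to Ext^2(K, A) = Ext^1(K', A) is surjective as B is
    injective. Concretely, f h extends to [e] with values in B; the map it induces from K' to D
    extends to P and lifts to B, and subtracting this lift from [e] gives a map into A. *)
Lemma ext1_shift_left A B D K K' P (f : {linear A -> B}) (q : {linear B -> D})
    (i : {linear K' -> P}) (g : {linear P -> K}) :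
  ses f q -> injective_mod B -> ses i g -> projective P ->
  ext1_vanish K D -> ext1_vanish K' A.
Proof.
move=> [fI qf qE qS] injB ig pP extK; have [iI gi gE gS] := ig.
move=> K2 Q j k [jI kj kE kS] h.
have [e eE] := injB _ _ j (f \o h) jI.
have [|d dE] := factor_surj (h := q \o e) kS.
  by move=> b /kE[a <-]; rewrite /= eE qf.
have [d' d'E] := extK _ _ _ _ ig d.
have [l lE] := pP _ _ q d' qS.
have [|u uE] := @factor_inj _ A B Q f (e \- (l \o (i \o k))) fI.
  by move=> x; apply: qE; rewrite raddfB /= lE d'E dE /= subrr.
exists u => a; apply: fI; rewrite uE /= eE kj !raddf0.
by rewrite addr0.
Qed.

(** The same connecting map is also injective, since Ext^1(K, B) = 0. *)
Lemma ext1_shift_right A B D K K' P (f : {linear A -> B}) (q : {linear B -> D})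
    (i : {linear K' -> P}) (g : {linear P -> K}) :
  ses f q -> injective_mod B -> ses i g -> projective P ->
  ext1_vanish K' A -> ext1_vanish K D.
Proof.
move=> [fI qf qE qS] injB ig pP extK.
apply: (ext1_vanish_projective ig pP) => h; have [iI _ _ _] := ig.
have [jI kj kE kS] := eps_ses K'.
have [l lE] := @free_mod_projective R K' _ _ q (h \o eps K') qS.
have [|h' h'E] := @factor_inj _ _ _ (kernel (eps K')) f (l \o val) fI.
  by move=> x; apply: qE; rewrite /= lE /= [eps _ _]kj raddf0.
have [e eE] := extK _ _ _ _ (eps_ses K') h'.
have [|u uE] := @factor_surj _ _ _ _ (eps K') (l \- (f \o e)) kS.
  by move=> b /kE[a <-]; rewrite /= eE h'E /= subrr.
have [v vE] := injB _ _ i u iI.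
exists (q \o v) => a; have [b <-] := kS a.
by rewrite /= vE uE raddfB /= lE qf subr0.
Qed.

(* For K finitely generated over a noetherian ring this says that
   Ext^(n+1)(K, N) = 0. *)
Fixpoint ext_zero (n : nat) K N : Prop :=
  if n is m.+1 then
    forall r A (i : {linear A -> 'rV[R]_r}) (g : {linear 'rV[R]_r -> K}),
      ses i g -> ext_zero m A N
  else ext1_vanish K N.

Lemma ext_zero_left n A B D K (f : {linear A -> B}) (q : {linear B -> D}) :
  ses f q -> injective_mod B -> ext_zero n K D -> ext_zero n.+1 K A.
Proof.
move=> fq injB; elim: n K => [|n IHn] K extK r L i g ig.
  exact: ext1_shift_left fq injB ig (@row_projective _ _) extK.
by apply: IHn; exact: extK ig.
Qed.

(** At a successor, [ext_zero] only speaks of presentations by row modules. Finite generation of K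
    provides one, and the noetherian hypothesis keeps its kernel finitely generated. *)
Lemma ext_zero_right n A B D K (f : {linear A -> B}) (q : {linear B -> D}) :
  noetherian R -> ses f q -> injective_mod B -> fin_gen K ->
  ext_zero n.+1 K A -> ext_zero n K D.
Proof.
move=> nR fq injB; elim: n K => [|n IHn] K fgK extK.
  have [r [L [i [g [_ ig]]]]] := fin_gen_resolve nR fgK.
  exact: ext1_shift_right fq injB ig (@row_projective _ _) (extK _ _ _ _ ig).
move=> r L i g ig; apply: IHn; first exact: ses_fin_gen ig.
exact: extK ig.
Qed.

Lemma ext_zero0 n K N : is_zero N -> ext_zero n K N.
Proof.
move=> N0; elim: n K => [|n IHn] K; last by move=> r L i g _; exact: IHn.
by move=> A Q i g _ h; exists \0 => a; rewrite (N0 (h a)).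
Qed.

(* At most n terms: 0 -> M -> X^0 -> ... -> X^(n-1) -> 0. *)
Fixpoint coresolved (X : lmodType R -> Prop) (n : nat) M : Prop :=
  if n is m.+1 then
    exists B D (f : {linear M -> B}) (q : {linear B -> D}),
      [/\ X B, ses f q & coresolved X m D]
  else is_zero M.

Lemma coresolved_ext_zero n K N :
  coresolved (@injective_mod R) n N -> ext_zero n K N.
Proof.
elim: n N => [|n IHn] N /=; first exact: (@ext_zero0 0).
by move=> [B [D [f [q [injB fq /IHn]]]]]; exact: ext_zero_left fq injB.
Qed.

End ExtShift.

(** * Injective modules *)

Section Baer.
Variable R : comPzRingType.

(** A map on an ideal is given as a total function of which only the values on the ideal count, so
    that ideals need not be made into modules. Zorn's lemma is applied to graphs of partial
    extensions of g. *)
Lemma baer (I : lmodType R) :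
  (forall (a : set R) (h : R -> I), is_ideal a ->
     (forall r x y, a x -> a y -> h (r * x + y) = r *: h x + h y) ->
     exists u, forall x, a x -> h x = x *: u) ->
  injective_mod I.
Proof.
move=> ideal_ext A B f g fI.
pose P0 (G : set (B * I)%type) := [/\ forall a, G (f a, g a),
  forall c u v, G u -> G v -> G (c *: u + v) & forall y, G (0, y) -> y = 0].
have P0base : P0 [set z | exists a, z = (f a, g a)].
  split; first by move=> a; exists a.
    by move=> c _ _ [a ->] [b ->]; exists (c *: a + b); rewrite !linearP.
  by move=> y [a [/esym]]; rewrite -(raddf0 f) => /fI -> ->; rewrite raddf0.
have [|G [PG Gmax]] := @Zorn_bigcup _ [set G | G = set0 \/ P0 G].
  move=> F FP Ftot; have [[X FX XP]|F0] := pselect (exists2 X, F X & P0 X).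
    right; split.
    - by move=> a; exists X => //; have [] := XP.
    - move=> c u v [Y FY Yu] [Z FZ Zv].
      have [YZ|ZY] := Ftot _ _ FY FZ.
        have [Z0|[_ ZP _]] := FP _ FZ; first by move: Zv; rewrite Z0.
        by exists Z => //; apply: ZP => //; exact: YZ.
      have [Y0|[_ YP _]] := FP _ FY; first by move: Yu; rewrite Y0.
      by exists Y => //; apply: YP => //; exact: ZY.
    - move=> y [Y FY Yy]; have [Y0|[_ _ YP]] := FP _ FY; last exact: YP.
      by move: Yy; rewrite Y0.
  left; apply/seteqP; split=> // z [X FX Xz].
  have [X0|XP] := FP _ FX; last by case: F0; exists X.
  by move: Xz; rewrite X0.
have {}PG : P0 G.
  case: PG => // G0; case: (Gmax [set z | exists a, z = (f a, g a)]);
    last by right.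
  by rewrite G0; split=> // /(_ (f 0, g 0)); apply; exists 0.
have [Gbase Glin G0] := PG.
have G00 : G (0, 0) by have := Gbase 0; rewrite !raddf0.
have Gdom b : exists y, G (b, y).
  (* The values of the partial extension on R b define a map on the ideal [a]. Its extension to R
     yields a candidate u for the value at b, and maximality forces (b, u) into G. *)
  pose a : set R := [set r | exists y, G (r *: b, y)].
  have /choice[h hP] : forall r : R, exists y, a r -> G (r *: b, y).
    move=> r; have [[y Gy]|nr] := pselect (a r); first by exists y.
    by exists 0 => /nr.
  have Gu x y y' : G (x, y) -> G (x, y') -> y = y'.
    move=> /(Glin (-1)) /[apply]; rewrite /GRing.add /GRing.scale /=.
    rewrite /scale_pair/add_pair/= !scaleN1r addNr => /G0/eqP.
    by rewrite addrC subr_eq0 => /eqP.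
  have [||u uP] := ideal_ext a h.
  - apply/submod_set_closed; split; first by exists 0; rewrite scale0r.
    move=> c u v [y Gy] [y' Gy']; exists (c *: y + y').
    rewrite -[_ *: u]/(c * (u : R)) scalerDl -scalerA.
    exact: (Glin c _ _ Gy Gy').
  - move=> r x y ax ay.
    have axy : a (r * x + y).
      exists (r *: h x + h y); rewrite scalerDl -scalerA.
      exact: (Glin r _ _ (hP _ ax) (hP _ ay)).
    apply: Gu (hP _ axy) _; rewrite scalerDl -scalerA.
    exact: (Glin r _ _ (hP _ ax) (hP _ ay)).
  pose G' : set (B * I)%type :=
    [set z | exists2 w, G w & exists r, z = w + r *: (b, u)].
  have GG' : G `<=` G' by move=> w Gw; exists w => //; exists 0;
    rewrite scale0r addr0.
  have PG' : P0 G'.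
    split; first by move=> x; apply: GG'.
      move=> c _ _ [w Gw [r ->]] [w' Gw' [r' ->]].
      exists (c *: w + w'); first exact: Glin.
      by exists (c * r + r'); rewrite scalerDr scalerDl scalerA addrACA.
    move=> y [[x z] Gxz [r [/esym/eqP xE ->]]].
    move: xE; rewrite addrC addr_eq0 => /eqP xE.
    have ar : a (- r).
      by exists z; rewrite scaleNr xE opprK.
    have zE : z = h (- r).
      by apply: Gu Gxz _; rewrite -[x]opprK -xE -scaleNr; exact: hP.
    by rewrite zE uP// scaleNr addNr.
  exists u; apply: contrapT => Gbu; apply: (Gmax G'); last by right.
  split=> // /(_ (b, u)) H; apply/Gbu/H; exists (0, 0) => //; exists 1.
  by rewrite scale1r; congr (_, _); rewrite /= add0r.
have [|//|//|e eP] := @linear_of_rel _ B I (fun x y => G (x, y)).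
  by move=> c x x' y y' Gx Gx'; exact: (Glin c _ _ Gx Gx').
by exists e => a; apply/eP.
Qed.

End Baer.

Lemma divisible_injective (D : lmodType int) :
  (forall (n : int) (d : D), n != 0 -> exists d', n *: d' = d) ->
    injective_mod D.
Proof.
move=> div; apply: baer => a h aid hlin.
have /submod_set_closed[a0 aP] := aid.
have {}aP (r x y : int) : a x -> a y -> a (r * x + y) := aP r x y.
have h0 : h 0 = 0.
  by have := hlin (-1) 0 0 a0 a0; rewrite mulr0 addr0 scaleN1r addNr.
have [[x0 ax0 x0n0]|az] := pselect (exists2 x, a x & x != 0); last first.
  exists 0 => x ax; have [x0|xn0] := eqVneq x 0; last by case: az; exists x.
  by rewrite scaler0 x0.
have exn : exists n : nat, `[< a n.+1%:Z >].
  exists (`|x0|.-1)%N; rewrite prednK ?absz_gt0//; apply/asboolP.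
  have [x0ge|x0lt] := Num.Theory.ger0P x0.
    by rewrite abszE Num.Theory.ger0_norm.
  rewrite abszE (Num.Theory.ltr0_norm x0lt).
  by have := aP (-1) _ _ ax0 a0; rewrite addr0 mulN1r.
(* The least positive element of the ideal generates it, so dividing the value of h there settles
   all of them. *)
have [n /asboolP an nmin] := ex_minnP exn.
have [d' d'E] := div n.+1%:Z (h n.+1%:Z) isT.
exists d' => x ax.
have ar : a (x %% n.+1)%Z.
  have -> : (x %% n.+1)%Z = - (x %/ n.+1)%Z * n.+1%:Z + x.
    by rewrite {3}(divz_eq x n.+1) mulNr addrA addNr add0r.
  exact: aP.
have r0 : (x %% n.+1)%Z = 0.
  move: ar (modz_ge0 x (isT : n.+1%:Z != 0)) (ltz_pmod x (isT : 0 < n.+1%:Z)).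
  case: (x %% n.+1)%Z => [[//|m]|//] am _ lt_mn.
  by have := nmin m (asboolT am); rewrite leqNgt; move: lt_mn;
    rewrite ltz_nat ltnS => ->.
rewrite {1}(divz_eq x n.+1) r0 hlin// -d'E.
by rewrite h0 addr0 scalerA [in RHS](divz_eq x n.+1) r0 addr0.
Qed.

(** * Embedding a module into an injective module *)

Section DivisibleHull.
Variable N : zmodType.

Let Q := zmodule (free_mod rat N).

(* N = Z^(N) / relations embeds in Q^(N) / relations, which is divisible. *)
Definition hull_rel : set Q := [set z | exists2 k : free_mod int N,
  forall t, (z : free_mod rat N) t = (k t : int)%:~R & eps (zmodule N) k = 0].

Lemma hull_rel_closed : submod_closed [in hull_rel].
Proof.
apply/submod_set_closed; split.
  by exists 0 => [t|]; rewrite ?raddf0// -[RHS]/((0 : int)%:~R) mulr0z.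
move=> n u v [k ku k0] [l lv l0]; exists (n *: k + l) => [t|].
  rewrite -[LHS]/(((u : free_mod rat N) *~ n) t + (v : free_mod rat N) t).
  rewrite lv -scaler_int -[RHS]/((n * k t + l t : int)%:~R).
  rewrite -[(_ *: (u : free_mod rat N)) t]/(n%:~R * (u : free_mod rat N) t) ku.
  by rewrite rmorphD rmorphM.
by rewrite linearP k0 l0 scaler0 addr0.
Qed.

Definition divisible_hull := quot_mod hull_rel.
HB.instance Definition _ := GRing.Lmodule.on divisible_hull.

Definition hull_in (x : N) : divisible_hull :=
  quot_pi hull_rel (free_basis rat x : Q).

Lemma hull_divisible (n : int) (d : divisible_hull) :
  n != 0 -> exists d', n *: d' = d.
Proof.
move=> n0; exists (quot_pi hull_rel
  ((n%:~R)^-1 *: (repr d : free_mod rat N) : Q)).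
rewrite -linearZ /=.
suff -> : n *: (((n%:~R)^-1 *: (repr d : free_mod rat N)) : Q) = repr d.
  by rewrite /quot_pi reprK.
rewrite scalezrE -scaler_int scalerA divff ?scale1r//.
by rewrite intr_eq0.
Qed.

Lemma hull_in_additive : zmod_morphism hull_in.
Proof.
move=> x y; rewrite /hull_in -raddfB; apply/quot_modP/sub_span.
exists (free_basis int (x - y) - (free_basis int x - free_basis int y)).
  move=> t; rewrite rmorphB rmorphB /=.
  by congr (_ - (_ - _)) => /=; case: eqP.
rewrite raddfB [X in _ - X]raddfB /= /eps !free_lift_basis; exact: subrr.
Qed.

HB.instance Definition _ := GRing.isZmodMorphism.Build
  N divisible_hull hull_in hull_in_additive.

(** The relations divided out are integral, and integers embed in the rationals: if [x] - [y]
    becomes a relation over the rationals, it already is one over the integers, and evaluating it in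
    N gives x = y. *)
Lemma hull_in_inj : injective hull_in.
Proof.
move=> x y; rewrite /hull_in =>
  /quot_modP /(span_min hull_rel_closed (@subset_refl _ _)).
move=> [k kE keps]; suff kE' : k = free_basis int x - free_basis int y.
  move: keps; rewrite kE' raddfB /= /eps !free_lift_basis.
  by move/eqP; rewrite subr_eq0 => /eqP.
apply: val_inj; apply/funext => t; apply: (@intr_inj rat); rewrite -kE.
rewrite raddfB -[LHS]/((if t == x then 1 else 0) - (if t == y then 1 else 0) :
  rat) /=.
by case: eqP; case: eqP.
Qed.

End DivisibleHull.

Section EnoughInjectives.
Variable S : comPzRingType.

Section Coinduced.
Variable D : lmodType int.

Definition coinduced := hom (zmodule S) D.
HB.instance Definition _ := GRing.Zmodule.on coinduced.

Lemma int_linear (V W : lmodType int) (f : V -> W) : zmod_morphism f ->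
  linear f.
Proof.
move=> fB; pose F : {additive V -> W} :=
  HB.pack f (GRing.isZmodMorphism.Build V W f fB).
by move=> n x y; rewrite -[n]intz !scaler_int -[f]/(F : V -> W) raddfD raddfMz.
Qed.

Lemma coinduced_of_fun (f : S -> D) :
  zmod_morphism f -> exists F : coinduced, forall x, F x = f x.
Proof.
move=> fB; have [F FE] := linear_of_fun (int_linear (V := zmodule S) fB).
by exists (to_hom F).
Qed.

Lemma coinduced_scale_subproof (s : S) (F : coinduced) :
  exists G : coinduced, forall x : S, G x = F (s * x).
Proof.
apply: coinduced_of_fun => x y; rewrite mulrBr.
exact: (raddfB F (s * x) (s * y)).
Qed.

Definition coinduced_scale s F : coinduced :=
  sval (cid (coinduced_scale_subproof s F)).

Lemma coinduced_scaleE s F x : coinduced_scale s F x = F (s * x).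
Proof. by rewrite /coinduced_scale; case: cid. Qed.

Lemma coinduced_eq (F G : coinduced) : (forall x, F x = G x) -> F = G.
Proof. by move=> FG; apply: val_inj; apply/funext. Qed.

Lemma coinduced_scaleA a b F :
  coinduced_scale a (coinduced_scale b F) = coinduced_scale (a * b) F.
Proof. by apply: coinduced_eq => x; rewrite !coinduced_scaleE mulrCA mulrA. Qed.
Lemma coinduced_scale1 : left_id 1 coinduced_scale.
Proof. by move=> F; apply: coinduced_eq => x;
  rewrite coinduced_scaleE mul1r. Qed.
Lemma coinduced_scaleDr : right_distributive coinduced_scale +%R.
Proof.
move=> a F G; apply: coinduced_eq => x.
by rewrite -[RHS]/(coinduced_scale a F x + coinduced_scale a G x)
  !coinduced_scaleE.
Qed.
Lemma coinduced_scaleDl F : {morph coinduced_scale^~ F : a b / a + b}.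
Proof.
move=> a b; apply: coinduced_eq => x.
rewrite -[RHS]/(coinduced_scale a F x + coinduced_scale b F x)
  !coinduced_scaleE.
rewrite mulrDl; exact: (raddfD F (a * x) (b * x)).
Qed.

HB.instance Definition _ := GRing.Zmodule_isLmodule.Build S coinduced
  coinduced_scaleA coinduced_scale1 coinduced_scaleDr coinduced_scaleDl.

Lemma coinduced_map (M : lmodType S) (f : {additive M -> D}) :
  exists F : {linear M -> coinduced}, forall m x, F m x = f (x *: m).
Proof.
have /choice[F FE] : forall m, exists F : coinduced, forall x, F x = f (x *: m).
  by move=> m; apply: coinduced_of_fun => x y; rewrite scalerBl raddfB.
have [|G GE] := @linear_of_fun _ M coinduced F.
  move=> a u v; apply: coinduced_eq => x.
  rewrite -[RHS]/(coinduced_scale a (F u) x + F v x) coinduced_scaleE !FE.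
  by rewrite scalerDr scalerA [a * x]mulrC raddfD.
by exists G => m x; rewrite GE.
Qed.

(** Coinduction is right adjoint to the restriction of scalars to the integers, which preserves
    injective maps. The extension [e] of the adjoint map [g1] is sent back by [coinduced_map]. *)
Lemma coinduced_injective : injective_mod D -> injective_mod coinduced.
Proof.
move=> injD A B f g fI.
have [f1 f1E] := linear_of_fun
  (@int_linear (zmodule A) (zmodule B) f (raddfB f)).
have [g1 g1E] : exists g1 : {linear zmodule A -> D}, forall a, g1 a = g a 1.
  apply: linear_of_fun; apply: int_linear => x y.
  by rewrite (raddfB g).
have [|e eE] := injD _ _ f1 g1; first by move=> x y; rewrite !f1E => /fI.
have [h hE] := coinduced_map e.
exists h => a; apply: coinduced_eq => x;
  rewrite hE -linearZ /= -f1E eE g1E linearZ.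
by rewrite -[LHS]/(coinduced_scale x (g a) 1) coinduced_scaleE mulr1.
Qed.

End Coinduced.

Lemma enough_injectives (M : lmodType S) :
  exists (J : lmodType S) (f : {linear M -> J}), injective_mod J /\ injective f.
Proof.
exists (coinduced (divisible_hull M)).
have [f fE] := coinduced_map (@hull_in M : {additive M -> divisible_hull M}).
exists f; split.
  apply/coinduced_injective/divisible_injective; exact: hull_divisible.
move=> x y /(congr1 (fun F : coinduced _ => F 1)).
by rewrite !fE !scale1r => /hull_in_inj.
Qed.

End EnoughInjectives.

(** * Finite injective dimension over a noetherian ring *)

Section FiniteInjectiveDimension.
Variable S : comPzRingType.
Implicit Types A B D K L M N P Q V W Z : lmodType S.

Lemma quot_pi_surj V (X : set V) d : exists b, quot_pi X b = d.
Proof. by exists (repr d); exact: reprK. Qed.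

Lemma quot_pi_eq0 V (X : set V) b : quot_pi X b = 0 <-> b \in span X.
Proof. by rewrite -(raddf0 (quot_pi X)) quot_modP subr0. Qed.

Lemma cokernel_ses A B (f : {linear A -> B}) : injective f ->
  ses f (quot_pi (range f)).
Proof.
move=> fI; split=> //.
- by move=> a; apply/quot_pi_eq0; apply: sub_span; exists a.
- move=> b /quot_pi_eq0;
    apply: (@span_subset _ _ _ [set b | exists a, f a = b]).
    apply/submod_set_closed; split; first by exists 0; rewrite raddf0.
    by move=> c _ _ [u <-] [v <-]; exists (c *: u + v); rewrite linearP.
  by move=> _ [a _ <-]; exists a.
- by move=> d; exact: (@quot_pi_surj B (range f) d).
Qed.

(** Passes from a function on an ideal, as in [baer], to a linear map on an actual module, the ideal
    being realized as the kernel of S -> S/a. *)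
Lemma ideal_hom N (a : set S) (h : S -> N) : is_ideal a ->
  (forall r x y, a x -> a y -> h (r * x + y) = r *: h x + h y) ->
  exists A (i : {linear A -> S^o}) (q : {linear S^o -> quot_mod (a : set S^o)})
         (k : {linear A -> N}),
    [/\ ses i q, forall y, a (i y) /\ k y = h (i y) & forall x, a x ->
      exists y, i y = x].
Proof.
move=> aid hlin; pose q : {linear S^o -> quot_mod (a : set S^o)} :=
  quot_pi (a : set S^o).
have qE (x : S) : q x = 0 <-> a x.
  split=> [/quot_pi_eq0|ax]; last by apply/quot_pi_eq0; exact: sub_span.
  by apply: span_subset.
have ka (x : kernel q) : a (val x) by apply/qE/eqP; exact: (valP x).
have [|k kE] := @linear_of_fun _ (kernel q) N (fun x => h (val x)).
  move=> r x y; rewrite linearP -hlin; [exact: erefl|exact: ka|exact: ka].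
exists (kernel q : lmodType S), val, q, k; split.
- by apply: kernel_ses => d; exact: (quot_pi_surj d).
- by move=> y; rewrite kE; split=> //; exact: ka.
move=> x ax; have kx : (x : S^o) \in kernel_pred q.
  by rewrite inE; apply/eqP/qE.
by exists (Kernel kx).
Qed.

Lemma ext1_vanish_injective N :
  (forall K, fin_gen K -> ext1_vanish K N) -> injective_mod N.
Proof.
move=> extN; apply: baer => a h aid hlin.
have [A [i [q [k [iq kh ia]]]]] := ideal_hom aid hlin.
have fgS : fin_gen S^o.
  exists [:: 1] => x; have -> : x = (x : S) *: (1 : S^o).
    by rewrite -[RHS]/((x : S) * 1) mulr1.
  rewrite rpredZ//.
  by apply: sub_span; rewrite /= inE.
have [e eE] := extN _ (fin_gen_surj (@quot_pi_surj _ _) fgS) _ _ _ _ iq k.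
exists (e 1) => x /ia[y <-]; have [_ <-] := kh y.
by rewrite -eE -linearZ; congr (e _); rewrite -[RHS]/((i y : S) * 1) mulr1.
Qed.

Lemma injective_ideal_ext N (a : set S) (h : S -> N) : injective_mod N ->
  is_ideal a ->
  (forall r x y, a x -> a y -> h (r * x + y) = r *: h x + h y) ->
  exists u, forall x, a x -> h x = x *: u.
Proof.
move=> injN aid hlin; have [A [i [q [k [[iI _ _ _] kh ia]]]]] :=
  ideal_hom aid hlin.
have [e eE] := injN _ _ i k iI.
exists (e 1) => x /ia[y <-]; have [_ <-] := kh y.
by rewrite -eE -linearZ; congr (e _); rewrite -[RHS]/((i y : S) * 1) mulr1.
Qed.

Lemma ext_zero_coresolved n N : noetherian S ->
  (forall K, fin_gen K -> ext_zero n K N) ->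
    coresolved (@injective_mod S) n.+1 N.
Proof.
move=> nS; elim: n N => [|n IHn] N extN.
  (* For n = 0 the module is itself injective; the coresolution has one term, and ['rV[S]_0] is its
     zero cokernel. *)
  exists N, 'rV[S]_0, idfun, \0; split; first exact: ext1_vanish_injective.
    by split=> //; [move=> b _; exists b|move=> d; exists 0; apply/rowP; case].
  by move=> x; apply/rowP; case.
have [J [f [injJ fI]]] := enough_injectives N.
exists J, (quot_mod (range f)), f, (quot_pi (range f)).
split=> //; first exact: cokernel_ses.
apply: IHn => K fgK.
exact: ext_zero_right nS (cokernel_ses fI) injJ fgK (extN _ fgK).
Qed.

(* The map 1 |-> w from S to W is a pure monomorphism. *)
Definition pure_element W (w : W) :=
  forall m n (b : 'I_m -> S) (A : 'I_m -> 'I_n -> S) (x : 'I_n -> W),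
    (forall i, b i *: w = \sum_j A i j *: x j) ->
    exists y : 'I_n -> S, forall i, b i = \sum_j A i j * y j.

(** Extending h from the relations of K to the free module is a linear system: one equation per
    generator of the relations, one unknown per basis vector. The hypothesis on W solves it after
    multiplication by w, and purity brings the solution back to S. *)
Lemma pure_ext_zero W (w : W) n K : noetherian S -> pure_element w ->
  fin_gen K -> ext_zero n K W -> ext_zero n K S^o.
Proof.
move=> nS wpure; elim: n K => [|n IHn] K fgK extK; last first.
  move=> r A i g ig; apply: IHn; first exact: ses_fin_gen ig.
  exact: extK ig.
have [r [A [i [g [[s sA] ig]]]]] := fin_gen_resolve nS fgK.
apply: (ext1_vanish_projective ig); first exact: row_projective.
move=> h; have [|hw hwE] := @linear_of_fun _ A W (fun x => (h x : S) *: w).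
  by move=> a x y; rewrite linearP scalerDl scalerA.
have [e eE] := extK _ _ _ _ ig hw.
have [k|y yE] := wpure (size s) r (fun k => h s`_k : S) (fun k l => i s`_k 0 l)
    (fun l => e (delta_mx 0 l)).
  by rewrite -hwE -eE row_linearE.
pose f : {linear 'rV[S]_r -> S^o} := row_comb (y : 'I_r -> S^o).
exists f => a; have := sA a.
apply: (@span_subset _ _ _ [set a | f (i a) = h a]).
  apply/submod_set_closed; split; first by rewrite /= !raddf0.
  by move=> c u v uE vE; rewrite /= 3!linearP uE vE.
move=> x /= xs; have xs' : (index x s < size s)%N by rewrite index_mem.
have /= := yE (Ordinal xs'); rewrite nth_index// => ->; exact: erefl.
Qed.

Lemma pure_coresolved W (w : W) n : noetherian S -> pure_element w ->
  coresolved (@injective_mod S) n W -> coresolved (@injective_mod S) n.+1 S^o.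
Proof.
move=> nS wpure corW; apply: ext_zero_coresolved => // K fgK.
exact: pure_ext_zero wpure fgK (coresolved_ext_zero _ corW).
Qed.

End FiniteInjectiveDimension.

(** * Tensor products *)

(* Otherwise simplification exposes its construction. *)
Opaque tensor_map.

Section TensorTheory.
Variable R : comPzRingType.
Implicit Types A B D K L M N P Q V W Z : lmodType R.

Section Bilinear.
Variables M N : lmodType R.

Lemma tmul_linear (x : M) : linear (fun y : N => tmul x y).
Proof. by move=> a y y'; exact: tmulPr. Qed.

HB.instance Definition _ x :=
  GRing.isLinear.Build R N (tensor M N) *:%R (@tmul R M N x) (tmul_linear x).

Definition tmulr (y : N) (x : M) : tensor M N := tmul x y.

Lemma tmulr_linear y : linear (tmulr y).
Proof. by move=> a x x'; exact: tmulPl. Qed.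

HB.instance Definition _ y :=
  GRing.isLinear.Build R M (tensor M N) *:%R (tmulr y) (tmulr_linear y).

Lemma tmul0r (x : M) : tmul x (0 : N) = 0.
Proof. exact: raddf0 (@tmul R M N x). Qed.

Lemma tmulZl a (x : M) (y : N) : tmul (a *: x) y = a *: tmul x y.
Proof. by rewrite -[LHS]/(tmulr y _) linearZ. Qed.

Lemma tmulZr a (x : M) (y : N) : tmul x (a *: y) = a *: tmul x y.
Proof. by rewrite linearZ. Qed.

Lemma tmul_suml I (r : seq I) (F : I -> M) (y : N) :
  tmul (\sum_(i <- r) F i) y = \sum_(i <- r) tmul (F i) y.
Proof. by rewrite -[LHS]/(tmulr y _) linear_sum. Qed.

Lemma tmul_sumr I (r : seq I) (F : I -> N) (x : M) :
  tmul x (\sum_(i <- r) F i) = \sum_(i <- r) tmul x (F i).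
Proof. by rewrite linear_sum. Qed.

Lemma tensor_lift P (b : M -> N -> P) :
  (forall a x x' y, b (a *: x + x') y = a *: b x y + b x' y) ->
  (forall a x y y', b x (a *: y + y') = a *: b x y + b x y') ->
  exists u : {linear tensor M N -> P}, forall x y, u (tmul x y) = b x y.
Proof.
move=> bl br.
pose u0 : {linear free_mod R (M * N)%type -> P} :=
  free_lift (fun p => b p.1 p.2).
have u0E z : tensor_rel z -> u0 z = 0.
  by move=> [[a [x [x' [y ->]]]]|[a [x [y [y' ->]]]]];
    rewrite raddfB /= linearP /= !free_lift_basis /= ?bl ?br subrr.
exists (quot_lift u0E) => x y.
by rewrite [LHS](@quot_liftE _ _ _ _ u0) /= free_lift_basis.
Qed.

Lemma tensor_sum (z : tensor M N) :
  exists n (x : 'I_n -> M) (y : 'I_n -> N), z = \sum_i tmul (x i) (y i).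
Proof.
have [w <-] := quot_pi_surj z.
pose s := finmap.enum_fset (fset_set (w @^-1` [set~ 0])).
have fE : w = free_lift (free_basis R) w.
  apply: (@free_mod_eq R _ _ idfun (free_lift (free_basis R))) => t /=.
  by rewrite free_lift_basis.
have sE : w @^-1` [set~ 0] `<=` [set` s].
  by move=> t ft /=; rewrite in_fset_set ?inE//; exact: free_finite.
rewrite fE (free_liftE _ (finmap.fset_uniq _) sE) linear_sum.
exists (size s), (fun i => w (tnth (in_tuple s) i) *: (tnth (in_tuple s) i).1),
  (fun i => (tnth (in_tuple s) i).2).
rewrite big_tnth; apply: eq_bigr => i _; rewrite linearZ tmulZl /=;
  congr (_ *: _).
by rewrite /tmul -surjective_pairing.
Qed.

Lemma tensor_zero_r : is_zero N -> is_zero (tensor M N).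
Proof.
move=> N0 z; apply: (@tensor_eq R M N _ idfun \0) => x y /=.
by rewrite (N0 y) tmul0r.
Qed.

End Bilinear.

Lemma tensor_map_comp M M' M2 N N' N2 (f : {linear M -> M'})
  (f' : {linear M' -> M2})
    (g : {linear N -> N'}) (g' : {linear N' -> N2}) z :
  tensor_map f' g' (tensor_map f g z) =
  tensor_map (f' \o f) (g' \o g) z.
Proof.
move: z; apply: (@tensor_eq _ _ _ _ (tensor_map f' g' \o tensor_map f g)) =>
  x y /=.
by rewrite [in LHS]tensor_mapE !tensor_mapE.
Qed.

Lemma tensor_map_eq M M' N N' (f f' : {linear M -> M'})
  (g g' : {linear N -> N'}) :
  f =1 f' -> g =1 g' -> tensor_map f g =1 tensor_map f' g'.
Proof. by move=> ff gg;
  apply: (@tensor_eq R M N _ (tensor_map f g) (tensor_map f' g')) => x y;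
    rewrite !tensor_mapE ff gg. Qed.

Lemma tensor_map_id M N (f : {linear M -> M}) (g : {linear N -> N}) :
  (forall x, f x = x) -> (forall x, g x = x) -> forall z, tensor_map f g z = z.
Proof.
move=> fE gE; apply: (@tensor_eq R M N _ (tensor_map f g) idfun) => x y.
by rewrite tensor_mapE fE gE.
Qed.

Lemma tensor_swap M N : exists s : {linear tensor M N -> tensor N M},
  forall x y, s (tmul x y) = tmul y x.
Proof.
apply: tensor_lift => a x x' y; first exact: tmulPr.
exact: tmulPl.
Qed.

Lemma tensor_map_surj M M' N N' (f : {linear M -> M'}) (g : {linear N -> N'}) :
  (forall x, exists y, f y = x) -> (forall x, exists y, g y = x) ->
  forall z, exists y, tensor_map f g y = z.
Proof.
move=> fS gS z; have [n [x [y ->]]] := tensor_sum z.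
have /choice[x' x'E] : forall i, exists x', f x' = x i by [].
have /choice[y' y'E] : forall i, exists y', g y' = y i by [].
exists (\sum_i tmul (x' i) (y' i)); rewrite linear_sum.
by apply: eq_bigr => i _; rewrite tensor_mapE x'E y'E.
Qed.

(** With s a set-theoretic section of q, the rule sending k (x) d to the class of k (x) s d is a
    well defined map from K (x) D to the cokernel of K (x) f. So an element killed by K (x) q has
    class zero. *)
Lemma tensor_right_exact K A B D (f : {linear A -> B}) (q : {linear B -> D}) :
  ses f q -> forall z, tensor_map (idfun : {linear K -> K}) q z = 0 ->
  exists y, tensor_map (idfun : {linear K -> K}) f y = z.
Proof.
move=> [fI qf qE qS] z qz; have [s sE] := choice qS.
pose F := tensor_map (idfun : {linear K -> K}) f.
pose T : {linear tensor K B -> quot_mod (range F)} := quot_pi (range F).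
have Tim k a : T (tmul k (f a)) = 0.
  by apply/quot_pi_eq0/sub_span; exists (tmul k a); rewrite // tensor_mapE.
have Ts k b d : q b = d -> T (tmul k (s d)) = T (tmul k b).
  move=> bd; have [|a aE] := qE (s d - b);
    first by rewrite raddfB /= sE bd subrr.
  have -> : s d = f a + b by rewrite aE subrK.
  transitivity (T (tmul k (f a)) + T (tmul k b)); last by rewrite Tim add0r.
  by rewrite (raddfD (@tmul R K B k)) (raddfD T).
have [||u uE] := @tensor_lift K D (quot_mod (range F))
  (fun k d => T (tmul k (s d))).
- by move=> a x x' d; rewrite tmulPl linearP.
- move=> a x d d'; rewrite -linearP /= -linearP /=; apply: Ts.
  by rewrite linearP !sE.
have Tz : T z = 0.
  have <- : u (tensor_map idfun q z) = T z.
    move: z {qz}; apply: (@tensor_eq _ _ _ _ (u \o tensor_map idfun q) T) =>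
      x y.
    by rewrite /= tensor_mapE uE; exact: Ts.
  by rewrite qz raddf0.
move/quot_pi_eq0: Tz; apply: (@span_subset _ _ _ [set z | exists y, F y = z]).
  apply/submod_set_closed; split; first by exists 0; rewrite raddf0.
  by move=> a _ _ [u1 <-] [v <-]; exists (a *: u1 + v); rewrite linearP.
by move=> _ [y _ <-]; exists y.
Qed.

Lemma tensor_right_exact_left K A B D (f : {linear A -> B})
  (q : {linear B -> D}) :
  ses f q -> forall z, tensor_map q (idfun : {linear K -> K}) z = 0 ->
  exists y, tensor_map f (idfun : {linear K -> K}) y = z.
Proof.
move=> fq z qz.
have [s sE] := tensor_swap B K; have [s' s'E] := tensor_swap K A.
have [sD sDE] := tensor_swap D K; have [sB sBE] := tensor_swap K B.
have [|y yE] := tensor_right_exact (K := K) fq (z := s z).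
  have <- : sD (tensor_map q idfun z) = tensor_map idfun q (s z).
    apply: (@tensor_eq _ _ _ _ (sD \o tensor_map q idfun)
      (tensor_map (idfun : {linear K -> K}) q \o s)) => x y /=.
    by rewrite tensor_mapE sE sDE tensor_mapE.
  by rewrite qz raddf0.
exists (s' y).
have -> : tensor_map f idfun (s' y) = sB
  (tensor_map (idfun : {linear K -> K}) f y).
  apply: (@tensor_eq _ _ _ _ (tensor_map f (idfun : {linear K -> K}) \o s')
    (sB \o tensor_map (idfun : {linear K -> K}) f)) => x w /=.
  by rewrite tensor_mapE sBE s'E tensor_mapE.
rewrite yE; apply: (@tensor_eq _ _ _ _ (sB \o s) idfun) => x w /=.
by rewrite sE sBE.
Qed.

End TensorTheory.

(** * Injectivity of tensored maps *)

Section TensorExact.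
Variable R : comPzRingType.
Implicit Types A B D K L M N P Q V W Z : lmodType R.

Lemma linear_inj A B (f : {linear A -> B}) :
  (forall x, f x = 0 -> x = 0) -> injective f.
Proof. exact: raddf_inj. Qed.

Lemma row_coord r N (i : 'I_r) :
  exists u : {linear tensor 'rV[R]_r N -> N}, forall v y,
    u (tmul v y) = v 0 i *: y.
Proof.
apply: tensor_lift => [a x x' y|a x y y'];
  first by rewrite !mxE scalerDl scalerA.
by rewrite scalerDr !scalerA mulrC.
Qed.

Lemma row_tensor r N (z : tensor 'rV[R]_r N) :
  exists y : 'I_r -> N, z = \sum_i tmul (delta_mx 0 i) (y i).
Proof.
have [n [v [y ->]]] := tensor_sum z; exists (fun i => \sum_j v j 0 i *: y j).
under [RHS]eq_bigr do rewrite tmul_sumr.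
rewrite exchange_big; apply: eq_bigr => j _ /=.
rewrite {1}[v j]row_sum_delta tmul_suml; apply: eq_bigr => i _.
by rewrite tmulZl tmulZr.
Qed.

Lemma row_tensor_inj r A B (f : {linear A -> B}) : injective f ->
  injective (tensor_map (idfun : {linear 'rV[R]_r -> 'rV[R]_r}) f).
Proof.
move=> fI; apply: linear_inj => z; have [y ->] := row_tensor z => zE.
rewrite big1// => i _; have [u uE] := row_coord B i.
have fy : f (y i) = 0.
  have <- : u (tensor_map idfun f (\sum_j tmul (delta_mx 0 j) (y j))) = 0.
    by rewrite zE raddf0.
  rewrite (linear_sum (tensor_map idfun f)) (linear_sum u) (bigD1 i)//= big1 =>
    [|j /negPf ji].
    by rewrite addr0 tensor_mapE uE mxE !eqxx scale1r.
  by rewrite tensor_mapE uE mxE eq_sym ji andbF scale0r.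
have -> : y i = 0 by apply: fI; rewrite fy raddf0.
exact: tmul0r.
Qed.

(* The injectivity hypothesis says that Tor_1(K, D) = 0. *)
Lemma tensor_left_exact A B D K L r (f : {linear A -> B}) (q : {linear B -> D})
    (i : {linear L -> 'rV[R]_r}) (g : {linear 'rV[R]_r -> K}) :
  ses f q -> ses i g -> injective (tensor_map i (idfun : {linear D -> D})) ->
  injective (tensor_map (idfun : {linear K -> K}) f).
Proof.
move=> fq ig iD; apply: linear_inj => z zE.
have [fI qf qE qS] := fq; have [iI gi gE gS] := ig.
(* A snake argument: the lift [y] of z maps to an element of R^r (x) B coming from some [l] in L (x)
   B. Since [l] vanishes in R^r (x) D, the hypothesis [iD] makes it come from L (x) A, and y comes
   from there too. *)
have [|y yz] := @tensor_map_surj R _ _ A A g idfun gS _ z; first by move=> x;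
  exists x.
have [|l lE] := tensor_right_exact_left (K := B) ig (z := tensor_map idfun f y).
  rewrite tensor_map_comp -[RHS]zE -yz tensor_map_comp.
  exact: tensor_map_eq.
have [|l' l'E] := tensor_right_exact (K := L) fq (z := l).
  apply: iD; rewrite raddf0 tensor_map_comp.
  have := congr1 (tensor_map (idfun : {linear 'rV[R]_r -> 'rV[R]_r}) q) lE.
  rewrite !tensor_map_comp => H.
  have -> : tensor_map (i \o idfun) (idfun \o q) l = tensor_map (idfun \o i)
    (q \o idfun) l.
    exact: tensor_map_eq.
  rewrite H; move: y {yz lE H}.
  apply: (@tensor_eq _ _ _ _ _ \0) => x y; rewrite tensor_mapE /= qf;
    exact: tmul0r.
have yE : y = tensor_map i idfun l'.
  apply: (row_tensor_inj fI); rewrite -lE -l'E !tensor_map_comp.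
  exact: tensor_map_eq.
rewrite -yz yE tensor_map_comp; move: (l').
apply: (@tensor_eq _ _ _ _ _ \0) => x w; rewrite tensor_mapE /= gi;
  exact: tmul0l.
Qed.

(** For [v] not injective, both maps descend to A / ker v, on which [v] becomes injective. *)
Lemma injective_factor A B (I : lmodType R) (v : {linear A -> B})
  (h : {linear A -> I}) :
  injective_mod I -> (forall a, v a = 0 -> h a = 0) ->
  exists e : {linear B -> I}, forall a, e (v a) = h a.
Proof.
move=> injI vh; pose X := [set a | v a = 0].
have Xs : submod_closed [in X].
  apply/submod_set_closed; split; first exact: raddf0.
  by move=> c x y xE yE; rewrite /X /= linearP xE yE scaler0 addr0.
have piE a : quot_pi X a = 0 <-> v a = 0.
  by split=> [/quot_pi_eq0/(span_subset Xs (@subset_refl _ _))//|va];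
    apply/quot_pi_eq0/sub_span.
have [|v' v'E] := factor_surj (h := v) (@quot_pi_surj _ _ X); first by move=>
  a /piE.
have [|h' h'E] := factor_surj (h := h) (@quot_pi_surj _ _ X).
  by move=> a /piE/vh.
have [|e eE] := injI _ _ v' h'.
  apply: linear_inj => d; have [a <-] := quot_pi_surj d.
  by rewrite v'E => /piE.
by exists e => a; rewrite -v'E eE h'E.
Qed.

End TensorExact.

(** * The Auslander class *)

Section AuslanderClass.
Variables (R : comPzRingType) (C : lmodType R).
Hypothesis noethR : noetherian R.
Hypothesis fgC : fin_gen C.
Hypothesis homC : forall h : {linear C -> C}, exists r : R, forall c,
  h c = r *: c.
Hypothesis extC : ext_vanish C C.
Implicit Types A B D I K L M N P Q V W Z : lmodType R.

Lemma hom_eval I : exists ev : {linear tensor C (hom C I) -> I},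
  forall c h, ev (tmul c h) = h c.
Proof.
apply: tensor_lift => [a x x' h|a x h h']; first by rewrite linearP.
by [].
Qed.

(* Injectivity of K (x) Hom(C, I) -> Hom(Hom(K, C), I). *)
Lemma tensor_hom_injective K (I : lmodType R)
  (ev : {linear tensor C (hom C I) -> I})
    (z : tensor K (hom C I)) :
  injective_mod I -> (forall c h, ev (tmul c h) = h c) -> fin_gen K ->
  (forall h : {linear K -> C},
    ev (tensor_map h (idfun : {linear hom C I -> hom C I}) z) = 0) ->
  z = 0.
Proof.
move=> injI evE fgK zE.
have [r [L [i [g [[s sL] [iI gi gE gS]]]]]] := fin_gen_resolve noethR fgK.
have [x zx] : exists x : 'I_r -> hom C I,
  z = \sum_k tmul (g (delta_mx 0 k)) (x k).
  have [|y <-] := @tensor_map_surj R _ _ _ _ g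
    (idfun : {linear hom C I -> hom C I}) gS _ z.
    by move=> h; exists h.
  have [x ->] := row_tensor y; exists x.
  rewrite (linear_sum (tensor_map g idfun)); apply: eq_bigr => k _;
    exact: tensor_mapE.
pose v (j : 'I_(size s)) (k : 'I_r) : R := i s`_j 0 k.
have [V VE] : exists V : {linear ('I_r -> C) -> ('I_(size s) -> C)},
    forall c j, V c j = \sum_k v j k *: c k.
  have [|V VE] := @linear_of_fun _ ('I_r -> C) ('I_(size s) -> C)
      (fun c j => \sum_k v j k *: c k).
    move=> a c c'; apply/funext => j;
      rewrite -[RHS]/(a *: _ + _) scaler_sumr -big_split.
    apply: eq_bigr => k _ /=.
    by rewrite -[(_ + _) k]/(a *: c k + c' k) scalerDr !scalerA mulrC.
  by exists V => c j; rewrite VE.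
have [xi xiE] : exists xi : {linear ('I_r -> C) -> I}, forall c,
  xi c = \sum_k x k (c k).
  apply: linear_of_fun => a c c'; rewrite scaler_sumr -big_split.
  by apply: eq_bigr => k _ /=; rewrite -[(_ + _) k]/(a *: c k + c' k) linearP.
(* The solutions of V c = 0 are the maps from K to C, described by the images of the generators, and
   there [xi] vanishes by [zE]. So [xi] factors through V, and the components of [eta] express the x
   k through the relations of K, which kill z. *)
have [c Vc|eta etaE] := injective_factor (v := V) (h := xi) injI.
  have [b ib|h hE] := factor_surj (h := row_comb c) gS.
    have [l <-] := gE _ ib; have := sL l.
    apply: (@span_subset _ _ _ [set l | row_comb c (i l) = 0]).
      apply/submod_set_closed; split; first by rewrite /= !raddf0.
      by move=> a u w /= uE wE; rewrite linearP linearP /= uE wE scaler0 addr0.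
    move=> l' /= ls; have ls' : (index l' s < size s)%N by rewrite index_mem.
    by have := congr1 (fun F => F (Ordinal ls')) Vc; rewrite VE /v /= nth_index.
  rewrite xiE -[RHS](zE h) zx.
  rewrite (linear_sum (tensor_map h idfun)) (linear_sum ev); apply: eq_bigr =>
    k _.
  by rewrite tensor_mapE evE hE /= row_comb_delta.
pose del n (j : 'I_n) (c : C) : 'I_n -> C := fun k => if k == j then c else 0.
have /choice[y yE] : forall j : 'I_(size s),
    exists y : hom C I, forall c, y c = eta (del _ j c).
  move=> j.
  have [|F FE] := @linear_of_fun _ C I (fun c => eta (del _ j c)).
    move=> a c c'; rewrite -linearP; congr (eta _); apply/funext => k.
    rewrite -[RHS]/(a *: del _ j c k + del _ j c' k) /del.
    by case: eqP => // _; rewrite scaler0 addr0.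
  by exists (to_hom F) => c; rewrite -FE.
have xE k : x k = \sum_j v j k *: y j.
  apply: val_inj; apply/funext => c /=.
  have -> : x k c = xi (del _ k c).
    rewrite xiE (bigD1 k)//= big1 /del ?eqxx ?addr0// => l /negPf ->.
    exact: raddf0.
  rewrite -etaE.
  have -> : V (del _ k c) = \sum_j del _ j (v j k *: c).
    apply/funext => j; rewrite VE fct_sumE (bigD1 k)//= big1 => [|l /negPf lk].
      rewrite (bigD1 j)//= big1 => [|l /negPf lj]; first by rewrite /del !eqxx.
      by rewrite /del eq_sym lj.
    by rewrite /del lk scaler0.
  have [E EE] : exists E : {linear hom C I -> I}, forall h, E h = h c.
    by apply: linear_of_fun.
  rewrite -EE !linear_sum; apply: eq_bigr => j _.
  by rewrite linearZ EE -yE -linearZ.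
rewrite zx; under eq_bigr => k _ do rewrite xE tmul_sumr.
rewrite exchange_big big1// => j _.
under eq_bigr => k _ do rewrite tmulZr -tmulZl -linearZ.
rewrite -tmul_suml -linear_sum -[X in g X]/(\sum_k i s`_j 0 k *: delta_mx 0 k).
rewrite -row_sum_delta gi; exact: tmul0l.
Qed.

(* Tor_n(K, N) = 0 for all n >= 1 and all K in a class of modules
   containing the syzygies of C. *)
Definition tor_vanish N := forall K, fin_gen K -> ext_vanish K C ->
  forall r L (i : {linear L -> 'rV[R]_r}) (g : {linear 'rV[R]_r -> K}),
    ses i g -> injective (tensor_map i (idfun : {linear N -> N})).

(* The unit is N -> Hom(C, C (x) N). *)
Definition unit_injective N := forall n : N, (forall c : C, tmul c n = 0) ->
  n = 0.

Definition unit_surjective N := forall h : {linear C -> tensor C N},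
  exists n, forall c, h c = tmul c n.

Definition auslander N :=
  [/\ tor_vanish N, unit_injective N & unit_surjective N].

(** All three parts reduce to evaluation. For the Tor condition, a map from L to C extends to R^r
    because Ext^1(K, C) = 0, so it cannot detect an element killed by i. For the unit, the preimage
    of h is ev h; the error dies under [ev], hence under every endomorphism of C, as these are
    homotheties. *)
Lemma auslander_hom (I : lmodType R) : injective_mod I -> auslander (hom C I).
Proof.
move=> injI; have [ev evE] := hom_eval I; split.
- move=> K fgK extK r L i g ig; apply: linear_inj => z zE.
  have fgL := ses_fin_gen noethR ig.
  apply: (tensor_hom_injective injI evE fgL) => h.
  have [e eE] := extK 0%N _ _ _ _ ig h.
  have -> : tensor_map h idfun z = tensor_map e idfun
    (tensor_map i (idfun : {linear hom C I -> hom C I}) z).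
    by rewrite tensor_map_comp; apply: tensor_map_eq => // l /=; rewrite eE.
  by rewrite zE !raddf0.
- move=> x xE; apply: val_inj; apply/funext => c.
  by rewrite -[LHS]/(x c) -evE xE raddf0.
- move=> h; exists (to_hom (ev \o h)) => c; apply/eqP; rewrite -subr_eq0;
    apply/eqP.
  apply: (tensor_hom_injective injI evE fgC) => k; have [r rE] := homC k.
  have -> w : tensor_map k (idfun : {linear hom C I -> hom C I}) w = r *: w.
    have [F FE] : exists F : {linear tensor C (hom C I) -> tensor C (hom C I)},
      forall w, F w = r *: w.
      apply: linear_of_fun => a x y.
      by rewrite scalerDr !scalerA mulrC.
    rewrite -FE; move: w; apply: tensor_eq => x y.
    by rewrite tensor_mapE FE rE tmulZl.
  by rewrite linearZ raddfB /= evE subrr scaler0.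
Qed.

Lemma auslander_isomorphic A B : isomorphic A B -> auslander A -> auslander B.
Proof.
move=> [f [g0 fK gK]] [torA injA surA].
have [|g gE] := @linear_of_fun _ B A g0.
  by move=> a x y; apply: (can_inj fK); rewrite linearP !gK.
have fgK x : f (g x) = x by rewrite gE.
have gfK x : g (f x) = x by rewrite gE.
split.
- move=> K fgK' extK r L i q iq; apply: linear_inj => z zE.
  have z0 : tensor_map (idfun : {linear L -> L}) g z = 0.
    apply: (torA _ fgK' extK _ _ _ _ iq); rewrite raddf0 tensor_map_comp.
    have <- : tensor_map (idfun : {linear 'rV[R]_r -> 'rV[R]_r}) g
      (tensor_map i idfun z) = 0.
      by rewrite zE raddf0.
    by rewrite tensor_map_comp; exact: tensor_map_eq.
  have <- : tensor_map (idfun : {linear L -> L}) f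
    (tensor_map (idfun : {linear L -> L}) g z) = z.
    by rewrite tensor_map_comp tensor_map_id.
  by rewrite z0 raddf0.
- move=> n nE; rewrite -(fgK n) (injA (g n)) ?raddf0// => c.
  by rewrite -[c]/(idfun c) -tensor_mapE nE raddf0.
- move=> h; have [n nE] := surA (tensor_map idfun g \o h); exists (f n) => c.
  have := congr1 (tensor_map (idfun : {linear C -> C}) f) (nE c).
  by rewrite tensor_mapE /= tensor_map_comp tensor_map_id.
Qed.

Lemma auslander_zero N : is_zero N -> auslander N.
Proof.
move=> N0; split.
- by move=> K _ _ r L i g _ x y _;
    rewrite (tensor_zero_r N0 x) (tensor_zero_r N0 y).
- by move=> n _; exact: N0.
- by move=> h; exists 0 => c; rewrite (tensor_zero_r N0 (h c)) tmul0r.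
Qed.

(** Since Tor_1(K, D) = 0, tensoring f with K stays injective. This is applied to K = C for the
    unit, and to the syzygy L, again in the class, for the Tor condition. *)
Lemma auslander_ses A B D (f : {linear A -> B}) (q : {linear B -> D}) :
  ses f q -> auslander B -> auslander D -> auslander A.
Proof.
move=> fq [torB injB surB] [torD injD surD]; have [fI qf qE qS] := fq.
have left_exact K : fin_gen K -> ext_vanish K C ->
    injective (tensor_map (idfun : {linear K -> K}) f).
  move=> fgK extK; have [r [L [i [g [fgL ig]]]]] := fin_gen_resolve noethR fgK.
  exact: tensor_left_exact fq ig (torD _ fgK extK _ _ _ _ ig).
split.
- move=> K fgK extK r L i g ig; apply: linear_inj => z zE.
  have extL := ext_vanish_syzygy ig (@row_projective _ _) extK.
  apply: (left_exact _ (ses_fin_gen noethR ig) extL); rewrite raddf0.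
  apply: (torB _ fgK extK _ _ _ _ ig); rewrite raddf0 tensor_map_comp.
  have <- : tensor_map (idfun : {linear 'rV[R]_r -> 'rV[R]_r}) f
    (tensor_map i idfun z) = 0.
      by rewrite zE raddf0.
  by rewrite tensor_map_comp; exact: tensor_map_eq.
- move=> n nE; apply: fI; rewrite raddf0; apply: injB => c.
  by rewrite -[c]/(idfun c) -tensor_mapE nE raddf0.
- move=> h; have [b bE] := surB (tensor_map idfun f \o h).
  have [|a ab] := qE b.
    apply: injD => c; rewrite -[c]/(idfun c) -tensor_mapE -bE /=
      tensor_map_comp.
    move: (h c); apply: (@tensor_eq _ _ _ _ _ \0) => x y.
    by rewrite tensor_mapE /= qf tmul0r.
  exists a => c; apply: (left_exact C fgC extC).
  by rewrite -[LHS]/((tensor_map idfun f \o h) c) bE tensor_mapE ab.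
Qed.

Lemma auslander_coresolved n N : coresolved (I_class C) n N -> auslander N.
Proof.
elim: n N => [|n IHn] N /=; first exact: auslander_zero.
move=> [B [D [f [q [[I injI IB] fq /IHn ausD]]]]].
apply: auslander_ses fq _ ausD.
exact: auslander_isomorphic IB (auslander_hom injI).
Qed.

End AuslanderClass.

(** * Flat modules and vanishing of Tor *)

Section FlatEquations.
Variable R : comPzRingType.
Implicit Types A B D I K L M N P Q V W Z : lmodType R.

Definition fun_delta N n (j : 'I_n) (c : N) : 'I_n -> N :=
  fun k => if k == j then c else 0.

Lemma fun_delta_linear N n (j : 'I_n) : linear (@fun_delta N n j).
Proof.
move=> a c c'; apply/funext => k.
rewrite -[RHS]/(a *: fun_delta j c k + fun_delta j c' k) /fun_delta.
by case: eqP => // _; rewrite scaler0 addr0.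
Qed.

HB.instance Definition _ N n j := GRing.isLinear.Build R N ('I_n -> N) *:%R
  (@fun_delta N n j) (@fun_delta_linear N n j).

Definition mx_act m n (A : 'I_m -> 'I_n -> R) N (x : 'I_n -> N) : 'I_m -> N :=
  fun i => \sum_j A i j *: x j.

Lemma mx_act_linear m n (A : 'I_m -> 'I_n -> R) N : linear (@mx_act m n A N).
Proof.
move=> a x y; apply/funext => i.
rewrite -[RHS]/(a *: mx_act A x i + mx_act A y i) /mx_act scaler_sumr
  -big_split.
by apply: eq_bigr => j _ /=;
  rewrite -[(_ + _) j]/(a *: x j + y j) scalerDr !scalerA mulrC.
Qed.

HB.instance Definition _ m n (A : 'I_m -> 'I_n -> R) N :=
  GRing.isLinear.Build R ('I_n -> N) ('I_m -> N) *:%R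
  (@mx_act m n A N) (@mx_act_linear m n A N).

(** The solutions in N form the kernel of a map from N^n to N^m, and tensoring with F preserves the
    exactness there. So the solutions in F (x) N come from F tensored with the solutions in N. *)
Lemma flat_equations F N m n (A : 'I_m -> 'I_n -> R) (x : 'I_n -> tensor F N) :
  flat F -> (forall i, \sum_j A i j *: x j = 0) ->
  exists q (f : 'I_q -> F) (z : 'I_q -> 'I_n -> N),
    (forall l i, \sum_j A i j *: z l j = 0) /\ forall j,
      x j = \sum_l tmul (f l) (z l j).
Proof.
move=> flatF xE; have [s sE] := tensor_swap F N; have [s' s'E] :=
  tensor_swap N F.
pose AN : {linear ('I_n -> N) -> ('I_m -> N)} := @mx_act m n A N.
pose dn (j : 'I_n) : {linear N -> ('I_n -> N)} := @fun_delta N n j.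
pose dm (j : 'I_m) : {linear N -> ('I_m -> N)} := @fun_delta N m j.
pose idF : {linear F -> F} := idfun.
(* [w] is the tuple x seen in N^n (x) F; the projections [pj] recover its entries. The swap [s] is
   there because [flat] tensors with F on the right. *)
pose w := \sum_j tensor_map (dn j) idF (s (x j)).
have AdE j y : tensor_map AN idF (tensor_map (dn j) idF y) =
    \sum_i A i j *: tensor_map (dm i) idF y.
  have [H HE] : exists H : {linear tensor N F -> tensor ('I_m -> N) F},
      forall y, H y = \sum_i A i j *: tensor_map (dm i) idF y.
    apply: linear_of_fun => a u v; rewrite scaler_sumr -big_split.
    apply: eq_bigr => i _ /=.
    by rewrite linearP scalerDr !scalerA mulrC.
  rewrite -HE; move: y;
    apply: (@tensor_eq _ _ _ _ (tensor_map AN idF \o tensor_map (dn j) idF)).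
  move=> c f; rewrite [LHS](congr1 (tensor_map AN idF) (tensor_mapE _ _ _ _))
    tensor_mapE HE.
  under eq_bigr => i _ do rewrite tensor_mapE -tmulZl.
  rewrite -tmul_suml; congr (tmul _ _); apply/funext => i.
  rewrite fct_sumE (bigD1 i)//= big1 => [|k /negPf ki]; last first.
    by rewrite -[LHS]/(A k j *: fun_delta k c i) /fun_delta eq_sym ki scaler0.
  rewrite addr0 -[LHS]/(mx_act A (fun_delta j c) i) /mx_act
    (bigD1 j)//= big1 => [|k /negPf kj].
    by rewrite addr0 -[RHS]/(A i j *: fun_delta i c i) /fun_delta !eqxx.
  by rewrite /fun_delta kj scaler0.
have Aw : tensor_map AN idF w = 0.
  rewrite (linear_sum (tensor_map AN idF)).
  under eq_bigr => j _ do rewrite AdE.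
  rewrite exchange_big big1// => i _ /=.
  have -> : \sum_j A i j *: tensor_map (dm i) idF (s (x j)) =
      tensor_map (dm i) idF (s (\sum_j A i j *: x j)).
    rewrite (linear_sum s) (linear_sum (tensor_map (dm i) idF)).
    by apply: eq_bigr => j _; rewrite !linearZ_LR.
  by rewrite xE !raddf0.
have exA : exact_at (val : {linear kernel AN -> _}) AN.
  apply/seteqP; split=> [_ [k _ <-]|c cE].
    by apply/eqP; exact: (valP k).
  have kc : c \in kernel_pred AN.
    by apply/eqP; exact: cE.
  by exists (Kernel kc).
have [y _ yw] : range (tensor_map (val : {linear kernel AN -> _}) idF) w.
  by rewrite (flatF _ _ _ _ _ exA).
have [q [k [f yE]]] := tensor_sum y.
exists q, f, (fun l => val (k l)); split=> [l i|j].
  have /eqP kE := valP (k l); exact: (congr1 (fun g => g i) kE).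
have [pj pjE] : exists pj : {linear ('I_n -> N) -> N}, forall c, pj c = c j.
  by apply: linear_of_fun.
have pw : tensor_map pj idF w = s (x j).
  have pdE i z : tensor_map pj idF (tensor_map (dn i) idF z) =
    if i == j then z else 0.
    rewrite tensor_map_comp; case: eqP => [->|/eqP/negPf ij].
      by apply: tensor_map_id => // c /=; rewrite pjE /fun_delta eqxx.
    move: z; apply: (@tensor_eq _ _ _ _ _ \0) => c g.
    by rewrite tensor_mapE /= pjE /fun_delta eq_sym ij tmul0l.
  rewrite (linear_sum (tensor_map pj idF))
    (bigD1 j)//= big1 ?addr0 ?pdE ?eqxx//.
  by move=> i /negPf ij; rewrite pdE ij.
have <- : s' (s (x j)) = x j.
  by apply: (@tensor_eq _ _ _ _ (s' \o s) idfun) => c g /=; rewrite sE s'E.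
rewrite -pw -yw yE (linear_sum (tensor_map val idF))
  (linear_sum (tensor_map pj idF)).
rewrite (linear_sum s'); apply: eq_bigr => l _.
by rewrite tensor_mapE tensor_mapE s'E pjE.
Qed.

End FlatEquations.

(** * Tor with a module annihilated by the nonunits *)

Section TorVanishing.
Variable S : comPzRingType.
Implicit Types A B D I K L M N P Q V W Z : lmodType S.

(** Stands in for a null homotopy of multiplication by a on a resolution; it holds when a
    annihilates K and passes to syzygies. *)
Definition factors_projective K (a : S) := exists2 P, projective P &
  exists (u : {linear K -> P}) (v : {linear P -> K}), forall x,
    v (u x) = a *: x.

Lemma scale_linear M (a : S) : exists f : {linear M -> M}, forall x,
  f x = a *: x.
Proof. by apply: linear_of_fun => b x y; rewrite scalerDr !scalerA mulrC. Qed.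

(** Lifting v through g gives a map on P which agrees with multiplication by a after g. The
    difference of the two lands in A, and on A it is multiplication by a. *)
Lemma factors_lift A P K a (i : {linear A -> P}) (g : {linear P -> K}) :
  ses i g -> projective P -> factors_projective K a ->
  exists w : {linear P -> A}, forall x, w (i x) = a *: x.
Proof.
move=> [iI gi gE gS] pP [Q pQ [u [v vE]]].
have [v' v'E] := pQ _ _ g v gS; have [m mE] := scale_linear P a.
have [|w wE] := @factor_inj _ _ _ _ i (m \- (v' \o (u \o g))) iI.
  by move=> x; apply: gE; rewrite raddfB /= mE v'E vE linearZ subrr.
by exists w => x; apply: iI; rewrite wE /= mE gi !raddf0 addr0 linearZ.
Qed.

Lemma syzygy_factors K a n :
  (forall x : K, a *: x = 0) -> factors_projective (syzygy K n) a.
Proof.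
move=> aK; elim: n => [|n IHn].
  exists 'rV[S]_0; first exact: row_projective.
  by exists \0, \0 => x; rewrite aK.
have [w wE] := factors_lift (eps_ses _) (@free_mod_projective _ _) IHn.
exists (free_mod S (syzygy K n)); first exact: free_mod_projective.
by exists val, w.
Qed.

Lemma eps_tensor_boundary K N n (z : tensor (free_mod S (syzygy K n)) N) :
  tensor_map (eps (syzygy K n)) (idfun : {linear N -> N}) z = 0 ->
  exists y, tensor_map (std_diff K n) (idfun : {linear N -> N}) y = z.
Proof.
move=> zE; have [y <-] := tensor_right_exact_left (eps_ses _) zE.
have [|x <-] := @tensor_map_surj S _ _ N N (eps (syzygy K n.+1)) idfun
  (@eps_surj _ _) _ y.
  by move=> t; exists t.
by exists x; rewrite tensor_map_comp; exact: tensor_map_eq.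
Qed.

Lemma tensor_map_scale M M' N N' a (f g : {linear M -> M'})
  (h k : {linear N -> N'}) z :
  (forall x, f x = a *: g x) -> h =1 k ->
    tensor_map f h z = a *: tensor_map g k z.
Proof.
move=> fg hk.
have [F FE] : exists F : {linear tensor M N -> tensor M' N'},
    forall z, F z = a *: tensor_map g k z.
  by apply: linear_of_fun => b x y; rewrite linearP scalerDr !scalerA mulrC.
rewrite -FE; move: z; apply: (@tensor_eq S M N _ (tensor_map f h) F) => x y.
by rewrite FE !tensor_mapE fg hk tmulZl.
Qed.

Lemma annihilator_Tor0 K N a (z : tensor (free_mod S K) N) :
  (forall x : K, a *: x = 0) ->
  exists y, tensor_map (std_diff K 0) (idfun : {linear N -> N}) y = a *: z.
Proof.
move=> aK; apply: (@eps_tensor_boundary K N 0).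
rewrite linearZ /= -(tensor_map_scale (f := \0) (h := idfun)) => [|x|//].
  move: z; apply: (@tensor_eq S _ N _ (tensor_map \0 idfun) \0) => x y.
  by rewrite tensor_mapE tmul0l.
by rewrite aK.
Qed.

(** The map [w] with w i = a on the syzygy turns the differential into a times [eps]. So a z is
    killed by the tensored [eps], and hence is a boundary. *)
Lemma annihilator_Tor K N a n (z : tensor (free_mod S (syzygy K n.+1)) N) :
  (forall x : K, a *: x = 0) ->
  tensor_map (std_diff K n) (idfun : {linear N -> N}) z = 0 ->
  exists y, tensor_map (std_diff K n.+1) (idfun : {linear N -> N}) y = a *: z.
Proof.
move=> aK zE; apply: eps_tensor_boundary.
have [w wE] := factors_lift (eps_ses _) (@free_mod_projective _ _)
  (syzygy_factors n aK).
have <- : tensor_map w (idfun : {linear N -> N})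
  (tensor_map (std_diff K n) idfun z) =
    tensor_map (eps (syzygy K n.+1)) idfun (a *: z).
  rewrite tensor_map_comp linearZ; apply: tensor_map_scale => // x /=.
  exact: wE.
by rewrite zE raddf0.
Qed.

Definition nonunit (a : S) := ~ exists b, b * a = 1.

(** For N = F (x) C over a local ring, with F flat and F = m F, this holds because the solutions
    form F tensored with the solutions in C. Stated for N alone, it can be transported along
    isomorphisms. *)
Definition solutions_decompose N :=
  forall m n (A : 'I_m -> 'I_n -> S) (x : 'I_n -> N),
  (forall i, \sum_j A i j *: x j = 0) ->
  x \in span [set w : 'I_n -> N | exists a y,
    [/\ nonunit a, forall i, \sum_j A i j *: y j = 0 & w = a *: y]].

Lemma free_modE (T : choiceType) (f : free_mod S T) (s : seq T) : uniq s ->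
  f @^-1` [set~ 0] `<=` [set` s] ->
    f = \sum_(t <- s) (f t : S) *: free_basis S t.
Proof.
move=> us fs; rewrite -(free_liftE (free_basis S) us fs).
apply: (@free_mod_eq S _ _ idfun (free_lift (free_basis S))) => t /=.
by rewrite free_lift_basis.
Qed.

(** A cycle, the sum of the x j (x) y j, says that y solves the linear system whose coefficients are
    the coordinates of the d (x j). It is finite since finitely many elements of T support all of
    them. *)
Lemma cycles_decompose (T : choiceType) L N (d : {linear L -> free_mod S T})
    (z : tensor L N) : solutions_decompose N ->
  tensor_map d (idfun : {linear N -> N}) z = 0 ->
  z \in span [set w | exists a y,
    [/\ nonunit a, tensor_map d (idfun : {linear N -> N}) y = 0 & w = a *: y]].
Proof.
move=> decN; have [n [x [y ->]]] := tensor_sum z => zE.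
pose U := \bigcup_(j in [set: 'I_n]) ((d (x j)) @^-1` [set~ 0]).
have finU : finite_set U.
  apply: bigcup_finite => [|j _]; first exact: finite_finset.
  exact: free_finite.
pose s := finmap.enum_fset (fset_set U).
have us : uniq s by exact: finmap.fset_uniq.
have sU j : (d (x j)) @^-1` [set~ 0] `<=` [set` s].
  by move=> t ft /=; rewrite in_fset_set// inE; exists j.
pose A (i : 'I_(size s)) (j : 'I_n) : S := d (x j) (tnth (in_tuple s) i).
have dE (y' : 'I_n -> N) :
    tensor_map d (idfun : {linear N -> N}) (\sum_j tmul (x j) (y' j)) =
    \sum_i tmul (free_basis S (tnth (in_tuple s) i)) (\sum_j A i j *: y' j).
  rewrite (linear_sum (tensor_map d idfun)).
  under [RHS]eq_bigr do rewrite tmul_sumr.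
  rewrite exchange_big; apply: eq_bigr => j _ /=.
  rewrite tensor_mapE {1}(free_modE us (sU j)) tmul_suml [LHS]big_tnth.
  by apply: eq_bigr => i _; rewrite tmulZl tmulZr.
have Ay i : \sum_j A i j *: y j = 0.
  have [u uE] : exists u : {linear tensor (free_mod S T) N -> N},
      forall f v, u (tmul f v) = (f (tnth (in_tuple s) i) : S) *: v.
    apply: tensor_lift => [a f f' v|a f v v'].
      by rewrite -[X in X *: _]/(a * f _ + f' _) scalerDl scalerA.
    by rewrite scalerDr !scalerA mulrC.
  have := congr1 u zE; rewrite raddf0 (linear_sum (tensor_map d idfun))
    (linear_sum u).
  by under eq_bigr => j _ do rewrite tensor_mapE uE.
have [G GE] : exists G : {linear ('I_n -> N) -> tensor L N},
    forall v, G v = \sum_j tmul (x j) (v j).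
  apply: linear_of_fun => a u v; rewrite scaler_sumr -big_split.
  by apply: eq_bigr => j _ /=; rewrite -[(_ + _) j]/(a *: u j + v j) linearP.
rewrite -GE; have := decN _ _ A y Ay.
set X := [set w | _]; set Y := [set w | _].
apply: (@span_subset _ _ _ [set v | G v \in span Y]).
  apply/submod_set_closed; split; first by rewrite /= raddf0 rpred0.
  by move=> a u v /= uY vY; rewrite linearP rpredD ?rpredZ.
move=> _ [a [v [na vE ->]]] /=; apply: sub_span; exists a, (G v); split=> //.
  by rewrite GE dE big1// => i _; rewrite vE tmul0r.
by rewrite linearZ.
Qed.

Lemma tensor_chain_boundary K N n
  (X : set (tensor (free_mod S (syzygy K n)) N)) :
  X `<=` [set z | exists y,
    tensor_map (std_diff K n) (idfun : {linear N -> N}) y = z] ->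
  forall z, z \in span X ->
  exists y, tensor_map (std_diff K n) (idfun : {linear N -> N}) y = z.
Proof.
move=> Xb; apply: span_subset Xb; apply/submod_set_closed; split.
  by exists 0; rewrite raddf0.
by move=> a _ _ [u <-] [v <-]; exists (a *: u + v); rewrite linearP.
Qed.

(** Cycles are combinations of nonunit multiples of cycles, and such multiples are boundaries. In
    degree 0 the cycles are those of the zero map. *)
Lemma Tor_vanish K N n : (forall a, nonunit a -> forall x : K, a *: x = 0) ->
  solutions_decompose N -> is_zero (Tor n K N).
Proof.
move=> aK decN; case: n => [|n]; apply: zero_homology => z zE.
  apply: (@tensor_chain_boundary K N 0 _ _ z
    (cycles_decompose (d := \0 : {linear free_mod S K -> free_mod S K}) decN
      _)).
    by move=> _ [a [y [na _ ->]]]; apply: annihilator_Tor0; exact: aK.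
  move: z {zE}; apply: (@tensor_eq _ _ _ _ _ \0) => x y.
  by rewrite tensor_mapE tmul0l.
apply: (@tensor_chain_boundary K N n.+1 _ _ z
  (cycles_decompose (d := std_diff K n) decN zE)).
by move=> _ [a [y [na yE ->]]]; apply: annihilator_Tor => //; exact: aK.
Qed.

End TorVanishing.

(** * Localization *)

Section Localization.
Variables (R : comPzRingType) (p : spectrum R).
Implicit Types (M N A B D X : lmodType R) (s t d e : denom p).
Notation S := (loc_ring p).
Notation dv := (@denom_val R p).
Notation r1 := (denom1 p).

Lemma denomP s : ~ prime_set p (dv s).
Proof. by apply/asboolP; exact: (valP s). Qed.

Lemma denom_intro (x : R) : ~ prime_set p x -> exists s, dv s = x.
Proof. by move=> /asboolP px; exists (Denom px). Qed.

Lemma prime0 : prime_set p 0.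
Proof. by have /submod_set_closed[] := prime_ideal p. Qed.

Lemma primeD x y : prime_set p x -> prime_set p y -> prime_set p (x + y).
Proof.
have /submod_set_closed[_ pP] := prime_ideal p.
by move=> px py; have := pP 1 x y px py; rewrite scale1r.
Qed.

Lemma primeMr a x : prime_set p x -> prime_set p (a * x).
Proof.
have /submod_set_closed[p0 pP] := prime_ideal p.
by move=> px; have := pP a x 0 px p0; rewrite addr0.
Qed.

Lemma frac0 M s : frac (0 : M) s = 0.
Proof. by apply/frac_eq; exists r1; rewrite !scaler0. Qed.

Lemma fracD M s (x y : M) : frac (x + y) s = frac x s + frac y s.
Proof.
rewrite -[RHS]/(loc_add _ _) loc_addE; apply/frac_eq; exists r1 => /=.
by rewrite !mul1r -scalerDr !scalerA.
Qed.

Lemma fracZ M (r : R) s t (x : M) :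
  frac (r *: x) (denomM s t) = (frac (r : R^o) s : S) *: frac x t.
Proof. by rewrite -[RHS]/(loc_scale _ _) loc_scaleE. Qed.

Lemma fracZ1 M (r : R) t (x : M) : frac (r *: x) t = (frac (r : R^o) r1 : S) *:
  frac x t.
Proof.
rewrite -fracZ; apply/frac_eq; exists r1 => /=.
by rewrite !mul1r.
Qed.

Lemma frac_sum M s I (r : seq I) (P : pred I) (F : I -> M) :
  frac (\sum_(i <- r | P i) F i) s = \sum_(i <- r | P i) frac (F i) s.
Proof.
apply: (big_morph (fun x => frac x s)); first exact: fracD.
exact: frac0.
Qed.

Lemma frac_cancel M s t (x : M) : frac (dv s *: x) (denomM s t) = frac x t.
Proof. by apply/frac_eq; exists r1 => /=; rewrite !mul1r scalerA mulrC. Qed.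

Lemma frac_eq0 M s (x : M) : frac x s = 0 <-> exists t, dv t *: x = 0.
Proof.
rewrite -(frac0 M r1); split=> [/frac_eq[t /=]|[t tx]].
  by rewrite mulr1 scaler0 => tx; exists t.
by apply/frac_eq; exists t; rewrite /= mulr1 scaler0.
Qed.

Lemma frac_unit s t : (frac (dv s : R^o) t : S) * (frac (dv t : R^o) s : S) = 1.
Proof.
rewrite -[LHS]/(loc_scale _ _) loc_scaleE; apply/frac_eq; exists r1 => /=.
rewrite !mul1r -![_ *: _]/(_ * _ : R) /=; ring.
Qed.

Lemma frac_nonunit (a : R) s :
  (exists b : S, b * (frac (a : R^o) s : S) = 1) <-> ~ prime_set p a.
Proof.
split=> [[b]|/denom_intro[t <-]]; last by exists (frac (dv s : R^o) t);
  exact: frac_unit.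
have [x [t ->]] := fracP b; rewrite -[_ * _]/(loc_scale _ _) loc_scaleE.
move=> /frac_eq[u /= E] pa; apply: (@denomP (denomM u (denomM t s))).
have /= <- : dv u * 1 * (x * a) = dv u * (dv t * dv s).
  by rewrite -[RHS]mulr1; exact: E.
by rewrite !mulrA; exact: primeMr.
Qed.

Lemma common_denom M n (z : 'I_n -> localization p M) :
  exists d (x : 'I_n -> M), forall j, z j = frac (x j) d.
Proof.
elim: n z => [|n IHn] z; first by exists r1, (fun=> 0) => -[].
have [d [x xE]] := IHn (fun j => z (lift ord0 j)).
have [y [t yE]] := fracP (z ord0).
exists (denomM d t),
  (fun j => if unlift ord0 j is Some k then dv t *: x k else dv d *: y).
move=> j; case: unliftP => [k ->|->]; last by rewrite yE frac_cancel.
rewrite xE -(frac_cancel t d); apply/frac_eq; exists r1 => /=.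
by rewrite !mul1r mulrC.
Qed.

Lemma common_annihilator M n (x : 'I_n -> M) :
  (forall j, exists t, dv t *: x j = 0) -> exists t, forall j, dv t *: x j = 0.
Proof.
elim: n x => [|n IHn] x xE; first by exists r1 => -[].
have [t tE] := IHn (fun j => x (lift ord0 j)) (fun j => xE _).
have [u uE] := xE ord0; exists (denomM u t) => j /=.
have [k ->|->] := unliftP ord0 j; first by rewrite -scalerA tE scaler0.
by rewrite mulrC -scalerA uE scaler0.
Qed.

Lemma loc_map A B (f : {linear A -> B}) :
  exists F : {linear localization p A -> localization p B},
    forall x s, F (frac x s) = frac (f x) s.
Proof.
have /choice[F FE] : forall z : localization p A, exists w : localization p B,
    forall x s, z = frac x s -> w = frac (f x) s.
  move=> z; have [x [s ->]] := fracP z; exists (frac (f x) s) => y t.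
  move=> /frac_eq[u uE]; apply/frac_eq; exists u.
  by rewrite -!linearZ_LR uE.
have {}FE x s : F (frac x s) = frac (f x) s by exact: FE.
have [|G GE] := @linear_of_fun _ (localization p A) (localization p B) F.
  move=> a u v; have [r [t ->]] := fracP a.
  have [x [s ->]] := fracP u; have [y [s' ->]] := fracP v.
  rewrite (FE x s) (FE y s').
  rewrite -[_ *: frac x s]/(loc_scale _ _) -[_ *: frac (f x) s]/(loc_scale _ _).
  rewrite !loc_scaleE -[X in F X]/(loc_add _ _) -[RHS]/(loc_add _ _) !loc_addE.
  apply: etrans (FE _ _) _; congr (frac _ _).
  by rewrite (linearD f) !(linearZ_LR f).
by exists G => x s; rewrite GE FE.
Qed.

Lemma loc_ses A B D (f : {linear A -> B}) (q : {linear B -> D})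
    (F : {linear localization p A -> localization p B})
    (Q : {linear localization p B -> localization p D}) :
  (forall x s, F (frac x s) = frac (f x) s) ->
  (forall x s, Q (frac x s) = frac (q x) s) -> ses f q -> ses F Q.
Proof.
move=> FE QE [fI qf qE qS]; split.
- move=> u v; have [x [s ->]] := fracP u; have [y [t ->]] := fracP v.
  rewrite !FE => /frac_eq[w wE]; apply/frac_eq; exists w; apply: fI.
  by rewrite !linearZ_LR.
- by move=> u; have [x [s ->]] := fracP u; rewrite FE QE qf frac0.
- move=> u; have [x [s ->]] := fracP u; rewrite QE => /frac_eq0[t tx].
  have [|a aE] := qE (dv t *: x); first by rewrite linearZ_LR.
  by exists (frac a (denomM t s)); rewrite FE aE frac_cancel.
- move=> u; have [x [s ->]] := fracP u; have [b bx] := qS x.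
  by exists (frac b s); rewrite QE bx.
Qed.

Lemma loc_coresolved (C : lmodType R -> Prop) (C' : lmodType S -> Prop) n M :
  (forall A, C A -> C' (localization p A)) ->
  coresolved C n M -> coresolved C' n (localization p M).
Proof.
move=> CC; elim: n M => [|n IHn] M /=.
  by move=> M0 u; have [x [s ->]] := fracP u; rewrite (M0 x) frac0.
move=> [B [D [f [q [CB fq /IHn corD]]]]].
have [F FE] := loc_map f; have [Q QE] := loc_map q.
exists (localization p B), (localization p D), F, Q; split=> //;
  first exact: CC.
exact: loc_ses FE QE fq.
Qed.

Lemma loc_noetherian : noetherian R -> noetherian S.
Proof.
move=> nR J Jid; have /submod_set_closed[J0 JP] := Jid.
pose I := [set r : R | J (frac (r : R^o) r1)].
have [|s sE] := nR I.
  apply/submod_set_closed; split; first by rewrite /I /= frac0.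
  move=> a u v Iu Iv; rewrite /I /= fracD (fracZ1 _ r1 u).
  exact: JP Iu Iv.
exists [seq frac (r : R^o) r1 : S | r <- s]; apply/seteqP; split=> z /=.
  have [x [t ->]] := fracP z => Jz.
  have Ix : I x.
    rewrite /I /=; have := JP (frac (dv t : R^o) r1) _ _ Jz J0.
    rewrite addr0 -[_ *: _]/(loc_scale _ _) loc_scaleE; congr J; apply/frac_eq;
      exists r1 => /=.
    by rewrite !mul1r scale1r.
  have xs : (x : R^o) \in span [set y : R^o | y \in s].
    by move: Ix; rewrite sE.
  have -> : frac (x : R^o) t = (frac (1 : R^o) t : S) *:
    (frac (x : R^o) r1 : S^o).
    rewrite -[RHS]/(loc_scale _ _) loc_scaleE; apply/frac_eq; exists r1 => /=.
    by rewrite !mul1r !mulr1 scale1r.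
  rewrite rpredZ//; move: xs.
  apply: (@span_subset _ _ _ [set x : R^o | (frac x r1 : S^o) \in
    span [set y : S^o | y \in [seq frac (r : R^o) r1 : S | r <- s]]]).
    apply/submod_set_closed; split; first by rewrite /= frac0 rpred0.
    by move=> a u v /= us vs; rewrite fracD (fracZ1 _ r1 u) rpredD ?rpredZ.
  by move=> y /= ys; apply: sub_span => /=; exact: map_f.
apply: (@span_subset S S^o _ J) => // _ /= /mapP[r rs ->].
have : I r by rewrite sE; exact: sub_span.
by [].
Qed.

Lemma loc_local : is_local S.
Proof.
pose m : set S := [set z | ~ exists b : S, b * z = 1].
have mE x s : m (frac (x : R^o) s) <-> prime_set p x.
  by rewrite /m /= frac_nonunit notK.
have mid : is_ideal m.
  apply/submod_set_closed; split; first by rewrite -(frac0 _ r1);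
    apply/mE/prime0.
  move=> a u v; have [r [t ->]] := fracP a.
  have [x [s ->]] := fracP u; have [y [s' ->]] := fracP v => /mE px /mE py.
  rewrite -[_ *: _]/(loc_scale _ _) loc_scaleE -[_ + _]/(loc_add _ _) loc_addE.
  apply/mE; apply: primeD; apply: primeMr => //.
  exact: primeMr.
have m1 : ~ m 1 by apply; exists 1; rewrite mulr1.
have proper (J : set S) : is_ideal J -> ~ J 1 -> J `<=` m.
  move=> /submod_set_closed[J0 JP] J1 z Jz [b bz]; apply: J1.
  by have := JP b z 0 Jz J0; rewrite addr0 -[_ *: _]/(b * z) bz.
exists m; split.
  split=> // J Jid mJ; have [J1|J1] := pselect (J 1).
    right; apply/seteqP; split=> // z _.
    have /submod_set_closed[J0 JP] := Jid.
    by have := JP z 1 0 J1 J0; rewrite addr0 -[_ *: _]/(z * 1) mulr1.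
  by left; apply/seteqP; split=> //; exact: proper.
move=> n [nid n1 nmax]; have [->//|mT] := nmax m mid (proper n nid n1).
by case: m1; rewrite mT.
Qed.

End Localization.

(** * Homological dimensions *)

Section Dimensions.
Import Order.TTheory.
Local Open Scope order_scope.

Lemma infimum_min (disp : Order.disp_t) (T : porderType disp) (x0 d : T)
  (D : set T) :
  D d -> lbound D d -> infimum x0 D = d.
Proof.
move=> Dd dD; rewrite /infimum ifF; last by apply/eqP => D0; rewrite D0 in Dd.
apply: xget_subset1; last exact: is_subset1_infimums.
by split=> // y; apply.
Qed.

Lemma supremum_eq (disp : Order.disp_t) (T : porderType disp) (x0 d : T)
  (D : set T) :
  D !=set0 -> supremums D d -> supremum x0 D = d.
Proof.
move=> D0 dD; rewrite /supremum ifF; last by apply/eqP => E; rewrite E in D0;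
  case: D0.
exact: xget_subset1 dD (@is_subset1_supremums _ _ D).
Qed.

Section Length.
Variable R : comPzRingType.
Implicit Types (X : nat -> lmodType R) (M : lmodType R).

Variant length_of_spec X : \bar int -> Prop :=
| LengthInfty : (forall m, exists2 n, (m < n)%N & ~ is_zero (X n)) ->
  length_of_spec X +oo%E
| LengthZero : (forall n, is_zero (X n)) -> length_of_spec X -oo%E
| LengthFin N : ~ is_zero (X N) -> (forall n, (N < n)%N -> is_zero (X n)) ->
    length_of_spec X (N%:Z)%:E%E.

(** [supremum] has its intended value only once a least upper bound is exhibited; this is done
    separately for empty, bounded and unbounded support. *)
Lemma length_ofP X : length_of_spec X (length_of X).
Proof.
rewrite /length_of; set A := [set _ | _ in _].
have [X0|/existsNP[n0 n0P]] := pselect (forall n, is_zero (X n)).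
  have -> : A = set0 by apply/seteqP; split=> // x [n /(_ (X0 n))].
  by rewrite supremum0; exact: LengthZero.
have A0 : A !=set0 by exists (n0%:Z)%:E%E, n0.
have [[m mP]|unb] :=
  pselect (exists m, forall n, ~ is_zero (X n) -> (n <= m)%N).
  have exn : exists n, `[< ~ is_zero (X n) >] by exists n0; exact/asboolP.
  have mP' n : `[< ~ is_zero (X n) >] -> (n <= m)%N by move/asboolP; exact: mP.
  case: (ex_maxnP exn mP') => N /asboolP NX Nmax.
  rewrite (@supremum_eq _ _ _ (N%:Z)%:E%E)//.
    by apply: LengthFin => // n Nn; apply: contrapT => /asboolP/Nmax;
      rewrite leqNgt Nn.
  split; first by move=> _ [n nX <-]; rewrite lee_fin lez_nat; apply: Nmax;
    exact/asboolP.
  by move=> y; apply; exists N.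
rewrite (@supremum_eq _ _ _ +oo%E)//.
  apply: LengthInfty => m; apply: contrapT => H; apply: unb; exists m => n nX.
  by rewrite leqNgt; apply/negP => mn; apply: H; exists n.
split; first by move=> y _; exact: leey.
move=> [r| |] ry //; last by have := ry _ (ex_intro2 _ _ n0 n0P erefl).
case: unb; exists `|r|%N => n nX.
have := ry _ (ex_intro2 _ _ n nX erefl); rewrite lee_fin => nr.
by rewrite -lez_nat abszE (le_trans nr)// Num.Theory.ler_norm.
Qed.

(** A length is -oo, a natural number or +oo. These values are well ordered, so the infimum is
    attained. *)
Lemma infimum_length (I : Type) (L : I -> nat -> lmodType R) (P : I -> Prop) :
  (exists i, P i) ->
  exists2 i, P i &
    infimum +oo%E [set d | exists2 i, P i & length_of (L i) = d] =
      length_of (L i) /\ forall j, P j -> length_of (L i) <= length_of (L j).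
Proof.
move=> [i0 Pi0]; set D := [set _ | _].
suff [i Pi iD] : exists2 i, P i & lbound D (length_of (L i)).
  exists i => //; split; last by move=> j Pj; apply: iD; exists j.
  by apply: infimum_min => //; exists i.
have [[i Pi iE]|nN] := pselect (exists2 i, P i & length_of (L i) = -oo%E).
  by exists i => // y _; rewrite iE leNye.
have [[i [N [Pi iE]]]|nF] :=
  pselect (exists i N, P i /\ length_of (L i) = (N%:Z)%:E%E).
  have exn : exists n : nat,
    `[< exists2 i, P i & length_of (L i) = (n%:Z)%:E%E >].
    by exists N; apply/asboolP; exists i.
  case: (ex_minnP exn) => n /asboolP[j Pj jE] nmin; exists j => // _ [k Pk <-].
  rewrite jE; case kE: (length_of (L k)) / (length_ofP (L k)) => [_|_|m _ _].
  - exact: leey.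
  - by case: nN; exists k.
  - by rewrite lee_fin lez_nat; apply: nmin; apply/asboolP; exists k.
exists i0 => // _ [k Pk <-].
case kE: (length_of (L k)) / (length_ofP (L k)) => [_|_|m _ _].
- exact: leey.
- by case: nN; exists k.
- by case: nF; exists k, m.
Qed.

End Length.
End Dimensions.

Section Resolutions.
Import Order.TTheory.
Variable R : comPzRingType.
Implicit Types (X : lmodType R -> Prop) (A B D K L M N P Q V W Z : lmodType R).

Lemma isomorphic_trans A B D : isomorphic A B -> isomorphic B D ->
  isomorphic A D.
Proof. by move=> [f fb] [g gb]; exists (g \o f); exact: bij_comp. Qed.

Lemma isomorphic_sym A B : isomorphic A B -> isomorphic B A.
Proof.
move=> [f [g fK gK]].
have [|h hE] := @linear_of_fun _ B A g.
  by move=> a x y; apply: (can_inj fK); rewrite linearP !gK.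
by exists h; exists f => x; rewrite hE ?gK ?fK.
Qed.

Lemma isomorphic_coresolved X n A B :
  isomorphic A B -> coresolved X n A -> coresolved X n B.
Proof.
move=> /isomorphic_sym[f [g fK gK]].
case: n => [A0 x|n [C [D [u [q [XC [uI qu uE qS] corD]]]]]].
  by rewrite -(fK x) (A0 (f x)) -(A0 (f 0)) fK.
exists C, D, (u \o f), q; split=> //; split=> //.
- by move=> x y /= /uI /(can_inj fK).
- by move=> a /=; rewrite qu.
- by move=> b /uE[a <-]; exists (g a); rewrite /= gK.
Qed.

Lemma bij_of_inj_surj A B (f : A -> B) :
  injective f -> (forall b, exists a, f a = b) -> bijective f.
Proof. by move=> fI /choice[g gK]; exists g => // a; apply: fI. Qed.

Lemma kernel_homology (L M N : lmodType R) (f : {linear L -> M})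
  (g : {linear M -> N}) :
  (forall x, f x = 0) -> isomorphic (kernel g) (homology f g).
Proof.
move=> f0; pose X := [set z : kernel g | range f (val z)].
exists (quot_pi X); apply: bij_of_inj_surj; last exact: quot_pi_surj.
move=> x y /quot_modP xy; apply/eqP; rewrite -subr_eq0; apply/eqP.
move: xy; apply: (@span_subset _ _ X [set 0]).
  apply/submod_set_closed; split=> // a u v -> ->.
  by rewrite scaler0 addr0.
by move=> z [t _ tz]; apply: val_inj; rewrite -tz f0 raddf0.
Qed.

Lemma proj_dim_zero X M :
  proj_dim X M = 0%E -> exists2 P, X P & isomorphic P M.
Proof.
have [[P0 DP0]|nD] :=
  pselect (exists P : chain_complex R, is_resolution X M P); last first.
  rewrite /proj_dim; set D := [set _ | _]; have -> : D = set0.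
    by apply/seteqP; split=> // d [P DP _]; apply: nD; exists P.
  by rewrite /infimum eqxx.
have [P DP [PE _]] := infimum_length (@ch_mod R) (ex_intro _ _ DP0).
rewrite /proj_dim PE => pd0.
(* The resolution attaining the infimum has length 0, so its H_0 is the module in degree 0. *)
have P1 : is_zero (P 1%N).
  by move: pd0; case: length_ofP => // N _ NP [N0]; apply: NP; rewrite N0.
have [XP PM _] := DP; exists (P 0%N) => //; apply: isomorphic_trans PM.
apply: isomorphic_trans (kernel_homology _ _); last first.
  by move=> x; rewrite (P1 x) raddf0.
have k0 x : x \in kernel_pred (\0 : {linear P 0%N -> P 0%N}) by rewrite inE.
apply: isomorphic_sym.
exists val; exists (fun x => Kernel (k0 x)) => // x; exact: val_inj.
Qed.

Lemma coresolution_coresolved X M (I : cochain_complex R) (N : nat) :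
  is_coresolution X M I -> (forall n, (N < n)%N -> is_zero (I n)) ->
  coresolved X N.+1 M.
Proof.
move=> [XI IM Iex] Iz; apply: isomorphic_coresolved IM _.
apply: isomorphic_coresolved (kernel_homology _ _) _ => //.
(* By exactness the kernel of the k-th differential is the k-th cosyzygy; [n] counts the terms still
   allowed from degree k on, hence N + 1 at the start. *)
suff H n k : (N < n + k)%N -> coresolved X n (kernel (coch_diff I k)).
  by apply: H; rewrite addn0.
elim: n k => [|n IHn] k Nk.
  by move=> x; apply: val_inj; apply: Iz.
pose d : {linear I k -> I k.+1} := coch_diff I k.
have dk x : d x \in kernel_pred (coch_diff I k.+1).
  by rewrite inE; apply/eqP/coch_diffK.
have [|q qE] := @linear_of_fun _ (I k) (kernel (coch_diff I k.+1))
  (fun x => Kernel (dk x)).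
  by move=> a x y; apply: val_inj; rewrite /= !linearP.
exists (I k), (kernel (coch_diff I k.+1)), val, q; split=> //; last first.
  by apply: IHn; rewrite addnS.
have qv x : val (q x) = d x by rewrite qE.
split=> //.
- by move=> a; apply: val_inj; rewrite qv raddf0; apply/eqP; exact: (valP a).
- move=> b /(congr1 val); rewrite qv raddf0 => db.
  have kb : b \in kernel_pred (coch_diff I k) by rewrite inE; apply/eqP.
  by exists (Kernel kb).
- move=> z; have zk : coch_diff I k.+1 (val z) = 0 by apply/eqP;
    exact: (valP z).
  have /homology_zero/(_ _ zk)[x xE] := Iex k.+1 isT.
  by exists x; apply: val_inj; rewrite qv.
Qed.

Lemma inj_dim_coresolved X M :
  (inj_dim X M < +oo)%E -> exists n, coresolved X n M.
Proof.
have [[J DJ]|nD] := pselect (exists I, is_coresolution X M I); last first.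
  rewrite /inj_dim; set D := [set _ | _]; have -> : D = set0.
    by apply/seteqP; split=> // d [I DI _]; apply: nD; exists I.
  by rewrite /infimum eqxx ltxx.
have [I DI [IE _]] := infimum_length (@coch_mod R) (ex_intro _ _ DJ).
rewrite /inj_dim IE.
case: length_ofP => [|I0 _|N _ IN _]; first by rewrite ltxx.
  by exists 1%N; apply: coresolution_coresolved DI _ => n _; exact: I0.
by exists N.+1; apply: coresolution_coresolved DI IN.
Qed.

Section ShiftComplex.
Variables (B : lmodType R) (Y : cochain_complex R) (d0 : {linear B -> Y 0%N}).
Hypothesis d0K : forall x, coch_diff Y 0 (d0 x) = 0.

Definition shift_mod (n : nat) : lmodType R := if n is m.+1 then Y m else B.

Definition shift_diff n : {linear shift_mod n -> shift_mod n.+1} :=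
  match n with 0 => d0 | m.+1 => coch_diff Y m end.

Lemma shift_diffK n x : shift_diff n.+1 (shift_diff n x) = 0.
Proof. by case: n x => [|n] x; [exact: d0K|exact: coch_diffK]. Qed.

Definition shift_complex : cochain_complex R := CochainComplex shift_diffK.

End ShiftComplex.

(** A [cochain_complex] has a module in every degree, so a coresolution that stops is continued by
    zero modules, which must belong to X. *)
Lemma coresolved_complex X n M : (forall Z, is_zero Z -> X Z) ->
  coresolved X n M ->
  exists (I : cochain_complex R) (f : {linear M -> I 0%N}),
    [/\ forall k, X (I k), injective f, forall x, coch_diff I 0 (f x) = 0 /\
          (forall y, coch_diff I 0 y = 0 -> exists z, f z = y),
        forall k x, coch_diff I k.+1 x = 0 -> exists y, coch_diff I k y = x &
        forall k, (n <= k)%N -> is_zero (I k)].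
Proof.
move=> X0; elim: n M => [|n IHn] M.
  move=> M0; have dK (k : nat) (x : M) : (\0 : {linear M -> M})
    ((\0 : {linear M -> M}) x) = 0 by [].
  exists (@CochainComplex R (fun=> M) (fun=> \0) dK), idfun; split.
  - by move=> k; exact: X0.
  - by [].
  - by move=> x; split=> // y _; exists y.
  - by move=> k x _; exists 0; rewrite (M0 x).
  - by [].
move=> [B [D [u [q [XB [uI qu uE qS] /IHn[Y [f [XY fI fE Yex Yz]]]]]]]].
have dK x : coch_diff Y 0 ((f \o q) x) = 0 by have [->] := fE (q x).
exists (shift_complex (d0 := f \o q) dK), u; split=> //.
- by case.
- move=> x; split; first by rewrite /= qu raddf0.
  by move=> y /=; rewrite -(raddf0 f) => /fI/uE.
- case=> [|k] x /= xE; last exact: Yex.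
  have [_ /(_ _ xE)[z <-]] := fE 0; have [b <-] := qS z.
  by exists b.
- by case=> // k nk; exact: Yz.
Qed.

Lemma coresolved_inj_dim n M :
  coresolved (@injective_mod R) n M -> (inj_dim (@injective_mod R) M < +oo)%E.
Proof.
move=> /coresolved_complex[|I [f [injI fI fE Iex Iz]]].
  by move=> Z Z0 A B u g _; exists \0 => x; rewrite (Z0 (g x)).
have DI : is_coresolution (@injective_mod R) M I.
  split=> //; last by case=> // k _; apply: zero_homology; exact: Iex.
  apply: (isomorphic_trans (isomorphic_sym (kernel_homology _ _))) => //.
  apply: isomorphic_sym.
  have fk x : f x \in kernel_pred (coch_diff I 0).
    by rewrite inE; apply/eqP; case: (fE x).
  have [|h hE] := @linear_of_fun _ M (kernel (coch_diff I 0))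
    (fun x => Kernel (fk x)).
    by move=> a x y; apply: val_inj; rewrite /= linearP.
  exists h; apply: bij_of_inj_surj.
    by move=> x y /(congr1 val); rewrite !hE => /fI.
  move=> z; have [_ H] := fE 0.
  have [|x xz] := H (val z); first by apply/eqP; exact: (valP z).
  by exists x; apply: val_inj; rewrite hE.
have [J _ [JE /(_ _ DI) JI]] := infimum_length (@coch_mod R) (ex_intro _ _ DI).
rewrite /inj_dim JE; apply: le_lt_trans JI _; case: length_ofP => [H|_|N _ _];
  rewrite ?ltry ?ltNyy//.
by have [k nk] := H n; case; apply: Iz; exact: ltnW.
Qed.

End Resolutions.

(** * The fiber at a prime ideal *)

Section Fibers.
Variables (R : comPzRingType) (p : spectrum R).
Implicit Types (F C M N : lmodType R) (s t d e : denom p).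
Notation S := (loc_ring p).
Notation dv := (@denom_val R p).

Definition prime_multiples F : set F :=
  [set y | exists a x, prime_set p a /\ y = a *: x].

(* The fiber of F at p is F_p / p F_p. *)
Definition fiber_zero F := forall u : quot_mod (@prime_multiples F), exists t,
  dv t *: u = 0.

(** Flatness writes x as a sum of f l (x) z l with every z l a solution in C. One denominator t
    moves all the f l into p F, and the coefficients in p then come out in front of solutions. *)
Lemma equations_decompose F C m n (B : 'I_m -> 'I_n -> R)
  (x : 'I_n -> tensor F C) :
  flat F -> fiber_zero F -> (forall i, \sum_j B i j *: x j = 0) ->
  exists t, (dv t *: x : 'I_n -> tensor F C) \in span
    [set w : 'I_n -> tensor F C | exists a y,
      [/\ prime_set p a, forall i, \sum_j B i j *: y j = 0 & w = a *: y]].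
Proof.
move=> flatF fF Bx; have [q [f [z [Bz xE]]]] := flat_equations flatF Bx.
have [t tf] := common_annihilator
  (fun l => fF (quot_pi (@prime_multiples F) (f l))).
exists t; set X := [set w | _].
have GE l : exists G : {linear F -> ('I_n -> tensor F C)}, forall y j,
  G y j = tmul y (z l j).
  have [|G GE] := @linear_of_fun _ F ('I_n -> tensor F C)
    (fun y j => tmul y (z l j)).
    by move=> a y y'; apply/funext => j; exact: tmulPl.
  by exists G => y j; rewrite GE.
have -> : dv t *: x = \sum_l (fun j => tmul (dv t *: f l) (z l j)) :>
  ('I_n -> tensor F C).
  apply/funext => j; rewrite fct_sumE -[LHS]/(dv t *: x j) xE scaler_sumr.
  by apply: eq_bigr => l _; rewrite tmulZl.
apply: rpred_sum => l _; have [G GlE] := GE l.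
have -> : (fun j => tmul (dv t *: f l) (z l j)) = G (dv t *: f l).
  by apply/funext => j; rewrite GlE.
have : dv t *: f l \in span (@prime_multiples F).
  by apply/quot_pi_eq0; rewrite linearZ; exact: tf.
apply: (@span_subset _ _ _ [set y | G y \in span X]).
  apply/submod_set_closed; split; first by rewrite /= raddf0 rpred0.
  by move=> a u v /= uX vX; rewrite linearP rpredD ?rpredZ.
move=> _ [a [y [pa ->]]] /=; apply: sub_span; exists a, (G y); split=> //.
  move=> i; under eq_bigr => j _ do rewrite GlE -tmulZr.
  by rewrite -tmul_sumr Bz tmul0r.
by rewrite linearZ.
Qed.

(** An equation between fractions holds over R after multiplying its numerators by some t i. This
    factor goes into row i of B, and [c] records it together with the denominators of the row. *)
Lemma loc_equations M m n (A : 'I_m -> 'I_n -> S)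
  (x : 'I_n -> localization p M) :
  (forall i, \sum_j A i j *: x j = 0) ->
  exists e (y : 'I_n -> M) (B : 'I_m -> 'I_n -> R) (c : 'I_m -> S),
    [/\ forall j, x j = frac (y j) e, forall i, \sum_j B i j *: y j = 0
      & forall i j, A i j = c i * (frac (B i j : R^o) (denom1 p) : S)].
Proof.
move=> Ax; have [e [y yE]] := common_denom x.
have /choice[da daE] : forall i, exists da : denom p * ('I_n -> R),
    forall j, A i j = frac (da.2 j : R^o) da.1.
  by move=> i; have [d [a aE]] :=
    common_denom (A i : 'I_n -> localization p R^o); exists (d, a).
have /choice[t tE] : forall i, exists t, dv t *: \sum_j (da i).2 j *: y j = 0.
  move=> i; apply/(@frac_eq0 _ _ _ (denomM (da i).1 e));
    rewrite -(Ax i) frac_sum.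
  by apply: eq_bigr => j _; rewrite fracZ daE yE.
exists e, y, (fun i j => dv (t i) * (da i).2 j),
  (fun i => frac (1 : R^o) (denomM (t i) (da i).1)).
split=> // i; first by rewrite -[RHS](tE i) scaler_sumr; apply: eq_bigr => j _;
  rewrite scalerA.
move=> j; rewrite daE -[RHS]/(loc_scale _ _) loc_scaleE; apply/frac_eq;
  exists (denom1 p) => /=.
by rewrite !mul1r mulr1 scale1r mulrC -scalerA.
Qed.

Lemma loc_solutions_decompose F C : flat F -> fiber_zero F ->
  solutions_decompose (localization p (tensor F C)).
Proof.
move=> flatF fF m n A x Ax.
have [e [y [B [c [xE By AE]]]]] := loc_equations Ax.
have [t ty] := equations_decompose flatF fF By.
set X := [set w | _].
pose phi (w : 'I_n -> tensor F C) : 'I_n -> localization p (tensor F C) :=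
  fun j => frac (w j) e.
have -> : x = (frac (1 : R^o) t : S) *: phi (dv t *: y).
  apply/funext => j; rewrite xE
    -[RHS]/((frac (1 : R^o) t : S) *: frac (dv t *: y j) e).
  by rewrite -fracZ scale1r frac_cancel.
rewrite rpredZ//; move: ty.
apply: (@span_subset _ _ _ [set w | phi w \in span X]).
  apply/submod_set_closed; split.
    by rewrite /= (_ : phi 0 = 0) ?rpred0//; apply/funext => j; exact: frac0.
  move=> a u v /= uX vX.
  have -> : phi (a *: u + v) = (frac (a : R^o) (denom1 p) : S) *: phi u + phi v.
    apply/funext => j.
    rewrite -[RHS]/((frac (a : R^o) (denom1 p) : S) *: frac (u j) e + frac
      (v j) e).
    by rewrite -fracZ1 -fracD.
  by rewrite rpredD ?rpredZ.
move=> _ [a [v [pa Bv ->]]] /=; apply: sub_span.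
exists (frac (a : R^o) (denom1 p)), (phi v); split.
- by rewrite /nonunit frac_nonunit; apply.
- move=> i; have : frac (\sum_j B i j *: v j) e = 0 by rewrite Bv frac0.
  rewrite frac_sum => /(congr1 (fun u => c i *: u));
    rewrite scaler0 scaler_sumr => E.
  rewrite -[RHS]E; apply: eq_bigr => j _; rewrite AE fracZ1.
  by rewrite scalerA.
- by apply/funext => j;
    rewrite -[RHS]/((frac (a : R^o) (denom1 p) : S) *: frac (v j) e) -fracZ1.
Qed.

Lemma isomorphic_solutions (Q : comPzRingType) (A B : lmodType Q) :
  isomorphic A B -> solutions_decompose A -> solutions_decompose B.
Proof.
move=> AB decA m n E x Ex; have [f [g0 fK gK]] := AB.
have [g gE] : exists g : {linear B -> A}, forall x, g x = g0 x.
  apply: linear_of_fun => a u v; apply: (can_inj fK).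
  by rewrite linearP !gK.
have Eg i : \sum_j E i j *: g (x j) = 0.
  transitivity (g (\sum_j E i j *: x j)); last by rewrite Ex raddf0.
  by rewrite (linear_sum g); apply: eq_bigr => j _; rewrite linearZ.
have [G GE] : exists G : {linear ('I_n -> A) -> ('I_n -> B)}, forall v,
  G v = f \o v.
  apply: linear_of_fun => a u v; apply/funext => j /=.
  by rewrite -[LHS]/(f (a *: u j + v j)) linearP.
have -> : x = G (fun j => g (x j)) by apply/funext => j; rewrite GE /= gE gK.
have := decA m n E (fun j => g (x j)) Eg; set X := [set w | _]; set Y :=
  [set w | _].
apply: (@span_subset _ _ _ [set w | G w \in span Y]).
  apply/submod_set_closed; split; first by rewrite /= raddf0 rpred0.
  by move=> a u v /= uX vX; rewrite linearP rpredD ?rpredZ.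
move=> _ [a [v [na vE ->]]] /=; apply: sub_span; exists a, (G v); split=> //.
  move=> i; transitivity (f (\sum_j E i j *: v j)); last by rewrite vE raddf0.
  by rewrite (linear_sum f); apply: eq_bigr => j _; rewrite GE /= linearZ.
by rewrite linearZ.
Qed.

Lemma loc_isomorphic A B : isomorphic A B ->
  isomorphic (localization p A) (localization p B).
Proof.
move=> AB; have [f [f' fK f'K]] := AB; have [F FE] := loc_map p f.
exists F; apply: bij_of_inj_surj.
  move=> u v; have [x [s ->]] := fracP u; have [y [t ->]] := fracP v.
  rewrite !FE => /frac_eq[w wE]; apply/frac_eq; exists w; apply: (can_inj fK).
  by rewrite !linearZ_LR.
by move=> u; have [x [s ->]] := fracP u; exists (frac (f' x) s); rewrite FE f'K.
Qed.

End Fibers.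

(** * Cyclicity of C at p, purity, and injectivity after localization *)

Section Cyclic.
Variables (R : comPzRingType) (p : spectrum R).
Implicit Types (F C M N : lmodType R) (s t d e : denom p).
Notation dv := (@denom_val R p).

Definition loc_generates C (x : seq C) :=
  exists t, forall c, dv t *: c \in span [set` x].

Notation resid := (quot_mod (prime_set p : set R^o)).

Lemma resid_eq0 (r : R) : quot_pi (prime_set p : set R^o) r = 0 <->
  prime_set p r.
Proof.
split=> [/quot_pi_eq0|pr]; last by apply/quot_pi_eq0; exact: sub_span.
by apply: span_subset => //; exact: prime_ideal.
Qed.

(* If x cannot be dropped from the generators x :: l of C_p, its coefficient is
   well defined modulo p. *)
Lemma coordinate C (x : C) l t :
  (forall c, dv t *: c \in span [set` x :: l]) -> ~ loc_generates l ->
  exists u : {linear C -> resid},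
    u x = quot_pi (prime_set p : set R^o) (dv t) /\
    forall y, y \in l -> u y = 0.
Proof.
move=> tC nl.
have [|||u uE] := @linear_of_rel _ C resid (fun c q => exists r : R,
    dv t *: c - r *: x \in span [set` l] /\ quot_pi (prime_set p : set R^o) r =
      q).
- move=> a c c' _ _ [r [rc <-]] [r' [rc' <-]]; exists (a * r + r'); split.
    rewrite scalerDr scalerDl opprD addrACA scalerA mulrC -!scalerA -scalerBr.
    by rewrite rpredD ?rpredZ.
  exact: (linearP (quot_pi (prime_set p : set R^o)) a r r').
- by move=> c; have /span_cons[r rc] := tC c;
    exists (quot_pi (prime_set p : set R^o) r), r.
(* A coefficient r of the zero vector outside p would put r x in the span of l, so that l alone
   would generate C_p. *)
- move=> q [r [rc <-]]; apply/resid_eq0; apply: contrapT => /denom_intro[s sr].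
  apply: nl; exists (denomM s t) => c; have /span_cons[r' rc'] := tC c.
  have sx : dv s *: x \in span [set` l].
    by move: rc; rewrite scaler0 sub0r sr => xl; rewrite -rpredN.
  rewrite /= -scalerA -[dv t *: c](subrK (r' *: x)) scalerDr rpredD//;
    first by rewrite rpredZ.
  by rewrite scalerA mulrC -scalerA rpredZ.
- exists u; split=> [|y yl]; apply/uE.
    by exists (dv t); rewrite subrr rpred0.
  exists 0; split; last exact: raddf0.
  by rewrite scale0r subr0 rpredZ//; exact: sub_span.
Qed.

Lemma resid_action (F : lmodType R) :
  exists P : {linear tensor resid (quot_mod (@prime_multiples R p F)) ->
    quot_mod (@prime_multiples R p F)},
    forall r u, P (tmul (quot_pi (prime_set p : set R^o) r) u) = (r : R) *: u.
Proof.
have kill (r : R) (u : quot_mod (@prime_multiples R p F)) : prime_set p r ->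
  r *: u = 0.
  move=> pr; have [f <-] := quot_pi_surj u; rewrite -linearZ.
  by apply/quot_pi_eq0; apply: sub_span; exists r, f.
have rE (r : R) u : (repr (quot_pi (prime_set p : set R^o) r) : R) *: u = r *:
  u :> quot_mod (@prime_multiples R p F).
  apply/eqP; rewrite -subr_eq0 -scalerBl; apply/eqP; apply: kill;
    apply/resid_eq0.
  by rewrite raddfB /= {1}/quot_pi reprK subrr.
have [||P PE] := @tensor_lift R resid (quot_mod (@prime_multiples R p F))
  (quot_mod (@prime_multiples R p F))
    (fun q u => (repr q : R) *: u).
- move=> a q q' u; have [r <-] := quot_pi_surj q; have [r' <-] :=
    quot_pi_surj q'.
  rewrite -(linearP (quot_pi (prime_set p : set R^o))) !rE.
  by rewrite -[X in X *: u]/(a * (r : R) + (r' : R)) scalerDl scalerA.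
- by move=> a q u u'; rewrite scalerDr !scalerA mulrC.
by exists P => r u; rewrite PE rE.
Qed.

Lemma two_generators F C (x y : C) l t :
  (forall c, dv t *: c \in span [set` x :: y :: l]) ->
  ~ loc_generates (y :: l) -> ~ loc_generates (x :: l) ->
  unit_surjective C (tensor F C) -> fiber_zero p F.
Proof.
move=> tC ny nx surC.
have tC' c : dv t *: c \in span [set` y :: x :: l].
  apply: span_sub (tC c) => z /=; rewrite !inE.
  by case/or3P => ->; rewrite ?orbT.
have [u [ux u0]] := coordinate tC ny; have [v [vy v0]] := coordinate tC' nx.
have {u0}uy : u y = 0 by apply: u0; rewrite inE eqxx.
have {v0}vx : v x = 0 by apply: v0; rewrite inE eqxx.
have [P PE] := resid_action F.
have [sw swE] := tensor_swap (quot_mod (@prime_multiples R p F)) resid.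
pose mu : {linear tensor F C -> quot_mod (@prime_multiples R p F)} :=
  P \o (sw \o tensor_map (quot_pi (@prime_multiples R p F)) u).
have muE f : mu (tmul f x) = dv t *: quot_pi (@prime_multiples R p F) f.
  by rewrite -[LHS]/(P
    (sw (tensor_map (quot_pi (@prime_multiples R p F)) u (tmul f x))))
      tensor_mapE swE ux PE.
(* One factor t comes from v y = t, the other from u x = t. Since v x = 0, applying v and [mu] to
   the identity in [E] kills the right-hand side and leaves t^2 f = 0 in F / p F. *)
move=> w; have [f <-] := quot_pi_surj w; exists (denomM t t).
have [n nE] := surC (@tmul R C (tensor F C) y \o @tmul R F C f).
have E : tmul y (tmul f x) = tmul x n by exact: nE.
have := congr1 (tensor_map v mu) E.
rewrite [RHS]tensor_mapE vx tmul0l [LHS]tensor_mapE vy muE.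
by move/(congr1 P); rewrite PE raddf0 scalerA.
Qed.

Lemma cyclic_at F C : fin_gen C ->
  (forall r : R, (forall c : C, r *: c = 0) -> r = 0) ->
  unit_surjective C (tensor F C) -> ~ fiber_zero p F ->
  exists (c0 : C) t, forall c, exists r, dv t *: c = r *: c0.
Proof.
move=> [x0 x0E] faith surC nF.
have exn : exists n, `[< exists2 x : seq C, size x = n & loc_generates x >].
  exists (size x0); apply/asboolP; exists x0 => //; exists (denom1 p) => c.
  by rewrite scale1r.
have [n /asboolP[x xn [t tx]] nmin] := ex_minnP exn.
have small (y : seq C) : loc_generates y -> (size x <= size y)%N.
  by move=> gy; rewrite xn; apply: nmin; apply/asboolP; exists y.
case: x xn tx small => [|x [|y l]] _ tx small.
- case: (denomP (s := t)); rewrite (faith (dv t)); first exact: prime0.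
  by move=> c; apply: span_nil.
- exists x, t => c; have /span_cons[r /span_nil/eqP] := tx c.
  by rewrite subr_eq0 => /eqP; exists r.
- by case: nF; apply: (two_generators tx _ _ surC) => /small; rewrite ltnn.
Qed.

(** After localization, b / t^2 is inverse to 1 |-> c0. The r in t c = r c0 is determined up to the
    annihilator of c0; since t times that annihilator kills C, it is zero by faithfulness, and t r
    is well defined. *)
Lemma cyclic_retract C (c0 : C) t :
  (forall r : R, (forall c : C, r *: c = 0) -> r = 0) ->
  (forall c, exists r, dv t *: c = r *: c0) ->
  exists b : {linear C -> R^o}, b c0 = dv t * dv t /\
    forall c, (b c : R) *: c0 = (dv t * dv t) *: c.
Proof.
move=> faith tC.
have [|||b bE] := @linear_of_rel _ C R^o
  (fun c q => exists r : R, dv t *: c = r *: c0 /\ q = dv t * r).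
- move=> a c c' _ _ [r [rc ->]] [r' [rc' ->]]; exists (a * r + r'); split.
    by rewrite scalerDr scalerDl scalerA mulrC -!scalerA rc rc'.
  rewrite -[a *: _]/(a * (dv t * r)); ring.
- by move=> c; have [r rc] := tC c; exists (dv t * r), r.
- move=> q [r [rc ->]]; apply: faith => c; have [r' rc'] := tC c.
  by rewrite mulrC -scalerA rc' scalerA mulrC -scalerA -rc !scaler0.
have b0 : b c0 = dv t * dv t by apply/bE; exists (dv t).
exists b; split=> // c; have [r rc] := tC c.
have -> : b c = dv t * r by apply/bE; exists r.
by rewrite -scalerA -rc scalerA.
Qed.

(** Taking w = f0 (x) c0 as one more unknown makes the system homogeneous, and [flat_equations]
    decomposes it into solutions in C, which b maps to solutions in R. If all of these had their
    entry for w in p, a multiple of f0 by a denominator would lie in p F. So some entry is a unit in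
    R_p, and dividing by it solves the original system. *)
Lemma pure_generator F C (c0 : C) t (b : {linear C -> R^o}) (f0 : F) :
  flat F -> b c0 = dv t * dv t ->
  (forall s, dv s *: quot_pi (@prime_multiples R p F) f0 <> 0) ->
  pure_element (frac (tmul f0 c0) (denom1 p) : localization p (tensor F C)).
Proof.
move=> flatF b0 f0n m n be A x bA.
pose E (i : 'I_m) (k : 'I_n.+1) : loc_ring p :=
  if unlift ord0 k is Some j then - A i j else be i.
pose z (k : 'I_n.+1) : localization p (tensor F C) :=
  if unlift ord0 k is Some j then x j else frac (tmul f0 c0) (denom1 p).
have Ez i : \sum_k E i k *: z k = 0.
  rewrite big_ord_recl /E /z unlift_none bA -(big_split _ _ _ _ _) /=.
  by rewrite big1// => j _; rewrite liftK scaleNr subrr.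
have [e [y [B [c [zE By EE]]]]] := loc_equations Ez.
have [q [f [w [Bw yE]]]] := flat_equations flatF By.
have [v Bv v0] : exists2 v : 'I_n.+1 -> R, forall i,
  \sum_k B i k * v k = 0 & ~ prime_set p (v ord0).
  apply: contrapT => nv.
  have pv l : prime_set p (b (w l ord0)).
    apply: contrapT => pn; apply: nv; exists (fun k => b (w l k)) => // i.
    transitivity (b (\sum_k B i k *: w l k) : R); last by rewrite Bw raddf0.
    by rewrite (linear_sum b); apply: eq_bigr => k _; rewrite linearZ.
  have [K KE] : exists K : {linear tensor F C -> F}, forall f c,
    K (tmul f c) = (b c : R) *: f.
    apply: tensor_lift => [a g g' d|a g d d'].
      by rewrite scalerDr !scalerA mulrC.
    by rewrite linearP -[X in X *: _]/(a * (b d : R) + (b d' : R)) scalerDl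
      scalerA.
  have /frac_eq[u uE] : frac (y ord0) e = frac (tmul f0 c0) (denom1 p).
    by rewrite -zE /z unlift_none.
  have Ky : quot_pi (@prime_multiples R p F) (K (y ord0)) = 0.
    rewrite yE !linear_sum big1// => l _; rewrite KE.
    by apply/quot_pi_eq0/sub_span; exists (b (w l ord0)), (f l).
  have [T TE] : exists T :
    {linear tensor F C -> quot_mod (@prime_multiples R p F)},
      forall w, T w = quot_pi (@prime_multiples R p F) (K w).
    by exists (quot_pi (@prime_multiples R p F) \o K).
  have := congr1 T uE;
    rewrite !linearZ_LR !TE Ky scaler0 KE b0 linearZ_LR scalerA => /esym.
  exact: (f0n (denomM (denomM u e) (denomM t t))).
have [s0 s0E] := denom_intro v0.
exists (fun j => frac (v (lift ord0 j) : R^o) s0) => i.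
have := Bv i; rewrite big_ord_recl => Bvi.
have fE k : E i k * (frac (v k : R^o) s0 : loc_ring p) =
    c i * (frac (B i k * v k : R^o) s0 : loc_ring p).
  by rewrite EE -mulrA; congr (_ * _);
    rewrite -[B i k * v k]/(B i k *: (v k : R^o)) fracZ1.
have : \sum_k E i k * (frac (v k : R^o) s0 : loc_ring p) = 0.
  under eq_bigr => k _ do rewrite fE.
  rewrite -mulr_sumr -(frac_sum s0 _ _ (fun k => B i k * v k : R^o)).
  by rewrite big_ord_recl Bvi frac0 mulr0.
rewrite big_ord_recl {1}/E unlift_none -s0E.
have -> : (frac (dv s0 : R^o) s0 : loc_ring p) = 1.
  by apply/frac_eq; exists (denom1 p);
    rewrite /= !mul1r scale1r -[RHS]/(dv s0 * 1) mulr1.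
rewrite mulr1 => /eqP; rewrite addr_eq0 => /eqP ->.
by rewrite -sumrN; apply: eq_bigr => j _; rewrite /E liftK mulNr opprK.
Qed.

(** Baer's criterion up to a denominator. As t depends neither on the ideal nor on the map, the
    condition yields injectivity of X_p over a noetherian ring. *)
Definition loc_baer (X : lmodType R) := exists t,
  forall (a : set R) (h : R -> X),
  is_ideal a -> (forall r x y, a x -> a y -> h (r * x + y) = r *: h x + h y) ->
  exists u, forall x, a x -> dv t *: h x = x *: u.

(** Evaluation at c0 reduces to Baer's criterion for I, which gives u. Then c |-> b(c) u works,
    because t^2 h(x)(c) = h(x)(b(c) c0) = b(c) x u. *)
Lemma hom_loc_baer C (I : lmodType R) (c0 : C) t (b : {linear C -> R^o}) :
  (forall c, (b c : R) *: c0 = (dv t * dv t) *: c) ->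
  injective_mod I -> loc_baer (hom C I).
Proof.
move=> bE injI; exists (denomM t t) => a h aid hlin.
have [|u uE] := injective_ideal_ext (h := fun r => h r c0) injI aid.
  by move=> r x y ax ay; rewrite (hlin r x y ax ay).
have [|g gE] := @linear_of_fun _ C I (fun c => (b c : R) *: u).
  by move=> r x y; rewrite linearP -[X in X *: _]/(r * (b x : R) + (b y : R))
    scalerDl scalerA.
exists (to_hom g) => x ax; apply: val_inj; apply/funext => c.
rewrite -[LHS]/((dv t * dv t) *: h x c) -[RHS]/(x *: g c) gE scalerA
  [x * _]mulrC -[RHS]scalerA.
have hxE r (w : C) : r *: h x w = h x (r *: w) by rewrite linearZ.
by rewrite -uE// hxE [RHS]hxE bE.
Qed.

Lemma isomorphic_loc_baer A B : isomorphic A B -> loc_baer A -> loc_baer B.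
Proof.
move=> [f [g fK gK]] [t tA]; exists t => a h aid hlin.
have [|u uE] := tA a (g \o h) aid.
  move=> r x y ax ay; apply: (can_inj fK).
  by rewrite /= linearP !gK; exact: hlin.
exists (f u) => x ax; rewrite -linearZ_LR -uE//.
by rewrite linearZ_LR /= gK.
Qed.

(** The map on J is determined by its values on finitely many generators of the contracted ideal
    [a]. Putting these over a common denominator gives numerators in X, from which a linear map on
    [a] is built so that [loc_baer] applies. *)
Lemma loc_injective (X : lmodType R) : noetherian R -> loc_baer X ->
  injective_mod (localization p X).
Proof.
move=> nR [t tX]; apply: baer => J h Jid hlin.
have [A [i [q [k [iq kh iJ]]]]] := ideal_hom Jid hlin.
have /submod_set_closed[J0 JP] := Jid.
pose a := [set r : R | J (frac (r : R^o) (denom1 p))].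
have aid : is_ideal a.
  apply/submod_set_closed; split; first by rewrite /a /= frac0.
  move=> r u v au av; rewrite /a /= fracD (fracZ1 _ (denom1 p) u).
  exact: JP au av.
have [s sE] := nR a aid; pose n := size s.
have as_ (l : 'I_n) : a s`_l.
  by rewrite sE; apply: sub_span => /=; rewrite mem_nth.
have /choice[al alE] : forall l : 'I_n, exists y,
  i y = frac (s`_l : R^o) (denom1 p).
  by move=> l; apply: iJ; exact: as_.
have [d [x xE]] := common_denom (fun l => k (al l)).
pose comb : {linear 'rV[R]_n -> R^o} := row_comb (fun l : 'I_n => s`_l : R^o).
pose xcomb : {linear 'rV[R]_n -> X} := row_comb x.
have combE (v : 'rV[R]_n) (y : A) : i y = frac (comb v) (denom1 p) ->
    k y = frac (xcomb v) d.
  move=> iy; have [iI _ _ _] := iq.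
  have -> : y = \sum_l (frac (v 0 l : R^o) (denom1 p) : loc_ring p) *: al l.
    apply: iI; rewrite iy -[comb v]/(\sum_l v 0 l *: (s`_l : R^o)) frac_sum
      linear_sum.
    by apply: eq_bigr => l _; rewrite linearZ /= alE fracZ1.
  rewrite linear_sum -[xcomb v]/(\sum_l v 0 l *: x l) frac_sum.
  by apply: eq_bigr => l _; rewrite linearZ /= xE fracZ1.
have fgK : fin_gen (kernel comb).
  exact: (@fin_gen_sub R (kernel comb) 'rV[R]_n val nR
    (@fin_gen_row R n) val_inj).
have [g gE] := fgK.
(* On a syzygy v of s the combination of the numerators vanishes only in X_p. The syzygies are
   finitely generated, so one denominator kills all these combinations. *)
have [t1 t1E] : exists t1 : denom p, forall v, comb v = 0 ->
  dv t1 *: xcomb v = 0.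
  have [|t1 t1E] := @common_annihilator _ p X (size g)
    (fun l => xcomb (val g`_l)).
    move=> l; apply/(frac_eq0 d); rewrite -(combE _ 0) ?raddf0//.
    by have /eqP -> := valP g`_l; rewrite frac0.
  exists t1 => v v0; have kv : v \in kernel_pred comb by apply/eqP.
  have := gE (Kernel kv); pose xk : {linear kernel comb -> X} := xcomb \o val.
  apply: (@span_subset _ _ _ [set w : kernel comb | dv t1 *: xk w = 0]).
    apply/submod_set_closed; split; first by rewrite /= !raddf0.
    move=> c u w /= uE wE; rewrite linearP scalerDr scalerA mulrC.
    by rewrite -scalerA uE wE scaler0 addr0.
  move=> w /= wg; have wg' : (index w g < size g)%N by rewrite index_mem.
  by have := t1E (Ordinal wg'); rewrite /= nth_index.
(* The expression v r of r in the generators is arbitrary. It fails to be linear in r by a syzygy,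
   which the factor [t1] makes harmless. *)
have /choice[v vE] : forall r : R, exists v : 'rV[R]_n, a r -> comb v = r.
  move=> r; have [ar|nr] := pselect (a r); last by exists 0.
  have rs : (r : R^o) \in span [set y : R^o | y \in s] by move: ar; rewrite sE.
  by have [v vr] := span_row_comb rs; exists v => _; rewrite vr.
have [r c e ar ac|u uE] := tX a (fun r => dv t1 *: xcomb (v r)) aid.
  have arce : a (r * c + e) by have /submod_set_closed[_ aP] := aid; exact: aP.
  have v0 : comb (v (r * c + e) - (r *: v c + v e)) = 0.
    by rewrite (linearB comb) (linearP comb) !vE//; exact: subrr.
  have /eqP := t1E _ v0;
    rewrite (linearB xcomb) (linearP xcomb) scalerBr subr_eq0.
  by move=> /eqP ->; rewrite scalerDr !scalerA mulrC.
(* The denominator collects [t] from [loc_baer], [t1] from the syzygies, and the common denominator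
   [d] of the values on the generators. *)
exists (frac u (denomM (denomM t t1) d)) => z Jz.
have [r [e ze]] := fracP z.
have rE : frac (r : R^o) (denom1 p) =
  (frac (dv e : R^o) (denom1 p) : loc_ring p) *: (z : (loc_ring p)^o).
  rewrite ze -[RHS]/(loc_scale _ _) loc_scaleE; apply/frac_eq;
    exists (denom1 p) => /=.
  by rewrite !mul1r scale1r.
have ar : a r.
  by rewrite /a /= rE -[X in J X]addr0; exact: JP.
have [y yz] := iJ z Jz; have [y' y'r] := iJ _ ar.
have [iI _ _ _] := iq; have [_ ky] := kh y; have [_ ky'] := kh y'.
have yE : y = (frac (1 : R^o) e : loc_ring p) *: y'.
  apply: iI; rewrite yz linearZ /= y'r ze -[RHS]/(loc_scale _ _) loc_scaleE.
  by apply/frac_eq; exists (denom1 p); rewrite /= !mul1r !mulr1 scale1r.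
have -> : h z = frac (xcomb (v r)) (denomM e d).
  have -> : h z = k y by rewrite ky yz.
  rewrite yE linearZ /= (combE (v r) y'); last by rewrite vE.
  by rewrite -fracZ scale1r.
rewrite ze -fracZ -uE//; apply/frac_eq; exists (denom1 p); rewrite /= !scalerA.
congr (_ *: _); ring.
Qed.

End Cyclic.

(** * Width and the Gorenstein property *)

Lemma residue_field_annihilated (S : comPzRingType) (a : S)
  (x : residue_field S) :
  nonunit a -> a *: x = 0.
Proof.
move=> na; have [r <-] := quot_pi_surj x; rewrite -linearZ.
apply/quot_pi_eq0; apply: sub_span => -[b ba]; apply: na; exists (b * (r : S)).
by rewrite -mulrA [(r : S) * a]mulrC.
Qed.

Lemma width_solutions_decompose (S : comPzRingType) (N : lmodType S) :
  solutions_decompose N -> width N = +oo%E.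
Proof.
move=> decN; rewrite /width; set W := [set _ | _ in _].
have -> : W = set0.
  apply/seteqP; split=> // d [i /= nz _]; apply: nz; apply: Tor_vanish =>
    // a na x.
  exact: residue_field_annihilated.
by rewrite /infimum eqxx.
Qed.

Theorem corollary2p15 (R : comPzRingType) (C M : lmodType R) :
  noetherian R ->
  semidualizing C ->
  F_pd C M = 0%E ->
  (I_id C M < +oo)%E ->
  forall p : spectrum R,
    width (localization p M : lmodType (loc_ring p)) \is a fin_num ->
    gorenstein_local (loc_ring p).
Proof.
move=> nR [fgC homC /Ext_ext_vanish extC] /proj_dim_zero[P [F flatF FCP] PM].
have FCM := isomorphic_trans FCP PM.
move=> /inj_dim_coresolved[n corM] p widthM.
have {corM} corT := isomorphic_coresolved (isomorphic_sym FCM) corM.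
have homC' (h : {linear C -> C}) : exists r : R, forall c, h c = r *: c.
  have [g _ gK] := homC; exists (g (to_hom h)) => c.
  by rewrite -[LHS]/(to_hom h c) -{1}[to_hom h]gK.
have faith (r : R) : (forall c : C, r *: c = 0) -> r = 0.
  move=> rC; apply: (bij_inj homC); apply: val_inj; apply/funext => c.
  by rewrite -[LHS]/(r *: c) -[RHS]/(0 *: c) rC scale0r.
have [_ _ surT] := auslander_coresolved nR fgC homC' extC corT.
have nF : ~ fiber_zero p F.
  move=> fF; move: widthM; rewrite width_solutions_decompose//.
  apply: isomorphic_solutions (loc_isomorphic p FCM) _.
  exact: loc_solutions_decompose.
have [c0 [t tC]] := cyclic_at fgC faith surT nF.
have [b [b0 bE]] := cyclic_retract faith tC.
have /existsNP[u /forallNP uN] := nF; have [f0 f0E] := quot_pi_surj u.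
have wpure := @pure_generator R p F C c0 t b f0 flatF b0.
have nS := loc_noetherian (p := p) nR.
split=> //; first exact: loc_local.
(* The n terms for M_p give Ext^(n+1)(K, R_p) = 0 for finitely generated K. So the n-th cosyzygy of
   R_p is injective, which makes n + 1 terms. *)
apply: (@coresolved_inj_dim _ n.+1).
apply: (pure_coresolved nS (wpure _)); first by move=> s; rewrite f0E;
  exact: uN.
(* The cyclicity of C at p is used once more, to turn the modules Hom(C, I) of the coresolution into
   injective R_p-modules. *)
apply: loc_coresolved corT => A [I injI IA]; apply: loc_injective => //.
exact: isomorphic_loc_baer IA (hom_loc_baer bE injI).
Qed.
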